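(* Let $N\ge 1$, $p\ge p_N:=1+\frac2N$, and $z\in\Omega$. Set $$f_z(x):=\begin{cases}|x-z|^{-\frac2{p-1}}\chi_{B_\Omega(z,1)}(x)&\text{if }p>p_N,\\[3pt]|x-z|^{-N}\big|\log|x-z|\big|^{-\frac N2-1}\chi_{B_\Omega(z,1/2)}(x)&\text{if }p=p_N,\end{cases}$$ for $x\in\Omega$. Then there exists $\kappa_z>0$ with the following properties: (i) problem (P) possesses a local-in-time solution with $\mu=\kappa x_Nf_z(x)$ if $0<\kappa<\kappa_z$; (ii) problem (P) possesses no local-in-time solutions with $\mu=\kappa x_Nf_z(x)$ if $\kappa>\kappa_z$. Here $\sup_{z\in\Omega}\kappa_z<\infty$.
   Context: $\Omega:=\mathbb R^{N-1}\times(0,\infty)$ if $N\ge2$ and $\Omega:=(0,\infty)$ if $N=1$; points are written $x=(x',x_N)$. $B(x,r)$ is the open ball in $\mathbb R^N$, $B_\Omega(x,r):=B(x,r)\cap\overline\Omega$, and $\chi_E$ is the characteristic function of $E$. $Q_T:=\Omega\times(0,T)$. $\mathcal L(Q_T)$ is the set of nonnegative, measurable, almost everywhere finite functions on $Q_T$. A locally integrable function $g$ on $\overline\Omega$ is identified with the measure $g(x)\,dx$. Kernels: $\Gamma_d(x,t):=(4\pi t)^{-d/2}\exp(-|x|^2/(4t))$ on $\mathbb R^d\times(0,\infty)$. The Dirichlet heat kernel of $\Omega$ is $$G(x,y,t):=\Gamma_N(x-y,t)\left(1-\exp\left(-\frac{x_Ny_N}{t}\right)\right),\qquad x,y\in\overline\Omega,\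 t>0,$$ and, for $x,y\in\overline\Omega$, $t>0$, $K(x,y,t):=y_N^{-1}G(x,y,t)$ if $y_N>0$ and $K(x,y,t):=(\partial_{y_N}G)(x,y,t)=\frac{x_N}{t}\Gamma_N(x-y,t)$ if $y_N=0$. Problem (P), for a nonnegative Radon measure $\mu$ on $\overline\Omega$, is $\partial_tu=\Delta u+u^p$ in $\Omega$, $t>0$, with $u=0$ on $\partial\Omega$ and $x_Nu(x,0)=\mu$ on $\overline\Omega$. A function $u\in\mathcal L(Q_T)$ is a solution to (P) in $Q_T$ if $$u(x,t)=\int_{\overline\Omega}K(x,y,t)\,d\mu(y)+\int_0^t\int_\Omega G(x,y,t-s)u(y,s)^p\,dy\,ds$$ for almost all $(x,t)\in Q_T$. A local-in-time solution is a solution in $Q_T$ for some $T>0$. *)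

(* Defs.v *)
From HB Require Import structures.
From mathcomp Require Import all_boot all_order all_algebra.
From mathcomp Require Import all_classical all_reals all_analysis.
From mathcomp Require Import measurable_realfun.

Set Implicit Arguments.
Unset Strict Implicit.
Unset Printing Implicit Defensive.

Import Order.TTheory GRing.Theory Num.Theory.
Import numFieldNormedType.Exports.

Local Open Scope classical_set_scope.
Local Open Scope ring_scope.

(** [measurableTypeR R] is the real line with its Borel sigma-algebra, on which
    [lebesgue_measure] is defined; tuples carry the product sigma-algebra. *)
Notation euclidean R N := (N.-tuple (measurableTypeR R)).

(** The library has no N-dimensional Lebesgue measure: it is obtained here by
    iterating the product with the one-dimensional one. *)
Section lebesgue_tuple.
Context {R : realType}.
Local Open Scope ereal_scope.

Definition tuple_cons n (x : measurableTypeR R * euclidean R n) :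
  euclidean R n.+1 := [tuple of x.1 :: x.2].

Lemma measurable_tuple_cons n : measurable_fun setT (@tuple_cons n).
Proof. by apply: measurable_cons; [exact: measurable_fst|exact: measurable_snd]. Qed.

Section step.
Context n (m : {sigma_finite_measure set (euclidean R n) -> \bar R}).

Let mc := @measurable_tuple_cons n.

Definition lebesgue_cons : set (euclidean R n.+1) -> \bar R :=
  pushforward (lebesgue_measure \x m) (@tuple_cons n).

Let mlebesgue_cons := measure_function_pushforward__canonical__measure_function_Measure
  (lebesgue_measure \x m) mc.

HB.instance Definition _ := isMeasure.Build _ _ _ lebesgue_cons
  (@measure0 _ _ _ mlebesgue_cons) (@measure_ge0 _ _ _ mlebesgue_cons)
  (@measure_semi_sigma_additive _ _ _ mlebesgue_cons).

Let lebesgue_cons_sigma_finite : sigma_finite setT lebesgue_cons.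
Proof.
have /sigma_finiteP[F [TF ndF Foo]] := sigma_finiteT (@lebesgue_measure R).
have /sigma_finiteP[G [TG ndG Goo]] := sigma_finiteT m.
pose split (t : euclidean R n.+1) : measurableTypeR R * euclidean R n :=
  (thead t, [tuple of behead t]).
have splitK A : @tuple_cons n @^-1` (split @^-1` A) = A.
  rewrite -comp_preimage (_ : _ \o _ = id) ?preimage_id//.
  apply/funext => -[a b]; rewrite /split /tuple_cons/= theadE/=.
  by congr pair; exact: val_inj.
have msplit : measurable_fun setT split.
  by apply/measurable_fun_pairP; split; [exact: measurable_tnth|exact: measurable_behead].
have FGT : \bigcup_i (F i `*` G i) = setT.
  apply/seteqP; split => // -[x y] _.
  have [i _ Fix] : (\bigcup_i F i) x by rewrite -TF.
  have [j _ Gjy] : (\bigcup_i G i) y by rewrite -TG.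
  exists (maxn i j) => //; split => /=.
  - by move: x Fix; exact/subsetPset/ndF/leq_maxl.
  - by move: y Gjy; exact/subsetPset/ndG/leq_maxr.
exists (fun i => split @^-1` (F i `*` G i)).
  by rewrite -preimage_bigcup FGT preimage_setT.
move=> i; have [mF Fi] := Foo i; have [mG Gi] := Goo i; split.
  by rewrite -[X in measurable X]setTI; apply: msplit => //; exact: measurableX.
rewrite /lebesgue_cons /pushforward splitK product_measure1E//.
by rewrite lte_mul_pinfty// ge0_fin_numE.
Qed.

HB.instance Definition _ := Measure_isSigmaFinite.Build _ _ _ lebesgue_cons
  lebesgue_cons_sigma_finite.

End step.

Fixpoint lebesgue_tuple n : {sigma_finite_measure set (euclidean R n) -> \bar R} :=
  if n is n'.+1 then lebesgue_cons (lebesgue_tuple n') else dirac [tuple].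

Lemma lebesgue_tuple_box n (A : 'I_n -> set (measurableTypeR R)) :
  (forall i, measurable (A i)) ->
  lebesgue_tuple n [set x | forall i, A i (tnth x i)] =
  \prod_(i < n) lebesgue_measure (A i).
Proof.
elim: n A => [|n IH] A mA /=.
  rewrite big_ord0 /dirac indicE mem_set//=.
  by case.
rewrite big_ord_recl -IH// /lebesgue_cons /pushforward.
pose B := [set x : euclidean R n | forall i, A (lift ord0 i) (tnth x i)].
have mB : measurable B.
  rewrite (_ : B = \bigcap_(i in [set: 'I_n])
      (fun x : euclidean R n => tnth x i) @^-1` A (lift ord0 i)); last first.
    by apply/seteqP; split => [x Bx i _|x Bx i]; exact: Bx.
  apply: fin_bigcap_measurable => // i _.
  by rewrite -[X in measurable X]setTI; exact: measurable_tnth.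
rewrite -product_measure1E//; congr (product_measure1 _ _ _).
apply/seteqP; split => -[a b] /=.
  move=> H; split; first by have := H ord0; rewrite tnth0.
  by move=> i; have := H (lift ord0 i); rewrite tnthS.
move=> [Aa Bb] i; case: (unliftP ord0 i) => [j ->|->]; last by rewrite tnth0.
by rewrite tnthS; exact: Bb.
Qed.

End lebesgue_tuple.

Section density.
Context d (T : measurableType d) (R : realType).
Context (m : {measure set T -> \bar R}) (g : T -> R).
Hypothesis (g0 : forall x, 0 <= g x) (mg : measurable_fun setT g).

(** The measure g dm; the proofs are arguments so that it is canonically a
    measure. *)
Definition density (_ : forall x, 0 <= g x) (_ : measurable_fun setT g)
  (A : set T) : \bar R := (\int[m]_(x in A) (g x)%:E)%E.

Let density_set0 : density g0 mg set0 = 0%E.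
Proof. exact: integral_set0. Qed.

Let density_ge0 A : (0 <= density g0 mg A)%E.
Proof. by apply: integral_ge0 => x _; rewrite lee_fin. Qed.

Let density_sigma_additive : semi_sigma_additive (density g0 mg).
Proof.
move=> F mF tF mUF; rewrite [X in _ --> X]ge0_integral_bigcup//.
- by apply: is_cvg_nneseries => i _ _; exact: density_ge0.
- by apply/measurable_EFinP; exact: (measurable_funS measurableT).
- by move=> x _; rewrite lee_fin.
Qed.

HB.instance Definition _ := isMeasure.Build _ _ _ (density g0 mg)
  density_set0 density_ge0 density_sigma_additive.

End density.

Section half_space.
Context {R : realType} (N : nat).
Implicit Types x y z : euclidean R N.

(** The last coordinate x_N: tuples are indexed from 0. *)
Definition height x : R := nth 0 x N.-1.

Definition enorm x : R := Num.sqrt (\sum_(i < N) (tnth x i : R) ^+ 2).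

Definition esub x y : euclidean R N :=
  [tuple (tnth x i : R) - (tnth y i : R) | i < N].

Definition half_space : set (euclidean R N) := [set x | 0 < height x].

Definition closed_half_space : set (euclidean R N) := [set x | 0 <= height x].

Definition ball_half_space z (r : R) : set (euclidean R N) :=
  [set x | enorm (esub x z) < r] `&` closed_half_space.

Definition gauss_kernel x (t : R) : R :=
  (4 * pi * t) `^ (- (N%:R / 2)) * expR (- (enorm x ^+ 2 / (4 * t))).

Definition dirichlet_kernel x y (t : R) : R :=
  gauss_kernel (esub x y) t * (1 - expR (- (height x * height y / t))).

(** On the closed half-space the second case is y_N = 0, where the formula is
    the derivative of [dirichlet_kernel] with respect to y_N. *)
Definition K_kernel x y (t : R) : R :=
  if 0 < height y then (height y)^-1 * dirichlet_kernel x y t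
  else height x / t * gauss_kernel (esub x y) t.

Definition cylinder (T : R) : set (euclidean R N * measurableTypeR R) :=
  [set w | half_space w.1 /\ 0 < w.2 < T].

(** Solutions are \bar R-valued: almost everywhere finite means almost
    everywhere different from +oo. *)
Definition in_L (T : R) (u : euclidean R N * measurableTypeR R -> \bar R) :=
  [/\ measurable_fun (cylinder T) u,
      forall w, cylinder T w -> (0 <= u w)%E &
      {ae (lebesgue_tuple N \x lebesgue_measure)%E,
        forall w, cylinder T w -> u w \is a fin_num}].

(** Solutions of the problem in Q_T with initial data mu. The theory is set up
    for Radon measures mu on the closed half-space; only the restriction of mu
    to that set matters. *)
Definition is_solution (p : R) (mu : {measure set (euclidean R N) -> \bar R})
    (T : R) (u : euclidean R N * measurableTypeR R -> \bar R) :=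
  in_L T u /\
  {ae (lebesgue_tuple N \x lebesgue_measure)%E, forall w, cylinder T w ->
    let: (x, t) := w in
    u (x, t) =
    (\int[mu]_(y in closed_half_space) (K_kernel x y t)%:E +
     \int[lebesgue_measure]_(s in `]0%R, (t : R)[)
       \int[lebesgue_tuple N]_(y in half_space)
         ((dirichlet_kernel x y (t - s)%R)%:E * (u (y, s) `^ p)))%E}.

Definition has_local_solution (p : R)
    (mu : {measure set (euclidean R N) -> \bar R}) :=
  exists2 T : R, 0 < T & exists u, is_solution p mu T u.

Definition critical_exponent : R := 1 + 2 / N%:R.

(** At x = z the library's conventions give the value 0 instead of +oo; this
    does not affect the measure f_z dx. *)
Definition f_sing (p : R) z x : R :=
  let r := enorm (esub x z) in
  if critical_exponent < p then
    r `^ (- (2 / (p - 1))) * \1_(ball_half_space z 1) x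
  else
    r `^ (- N%:R) * `|ln r| `^ (- (N%:R / 2) - 1) *
      \1_(ball_half_space z (2^-1)) x.

Lemma measurable_height : measurable_fun setT height.
Proof.
have [N0|N0] := posnP N.
  rewrite (_ : height = cst 0)//; apply/funext => x.
  by rewrite /height nth_default// size_tuple N0.
have lN : (N.-1 < N)%N by rewrite prednK.
rewrite (_ : height = fun x => tnth x (Ordinal lN)); first exact: measurable_tnth.
by apply/funext => x; rewrite /height (tnth_nth 0).
Qed.

Lemma measurable_dist z : measurable_fun setT (fun x => enorm (esub x z)).
Proof.
apply: (measurableT_comp (continuous_measurable_fun (@sqrt_continuous R))).
rewrite (_ : (fun x => _) =
    fun x => \sum_(i < N) ((tnth x i : R) - (tnth z i : R)) ^+ 2); last first.
  by apply/funext => x; apply: eq_bigr => i _; rewrite tnth_mktuple.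
apply: measurable_sum => i; apply: measurable_funX.
by apply: measurable_funB => //; exact: measurable_tnth.
Qed.

Lemma measurable_ball_half_space z r : measurable (ball_half_space z r).
Proof.
apply: measurableI.
- rewrite -[X in measurable X]setTI.
  have := @measurable_dist z measurableT _ (measurable_itv `]-oo, r[).
  by congr (measurable (_ `&` _)); apply/seteqP; split => x /=; rewrite in_itv.
- rewrite -[X in measurable X]setTI.
  have := @measurable_height measurableT _ (measurable_itv `[0, +oo[).
  by congr (measurable (_ `&` _)); apply/seteqP; split => x /=; rewrite in_itv/= andbT.
Qed.

Lemma measurable_f_sing p z : measurable_fun setT (f_sing p z).
Proof.
rewrite /f_sing; case: (critical_exponent < p).
  apply: measurable_funM.
    by apply: (measurableT_comp (@measurable_powR R _)); exact: measurable_dist.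
  by apply: measurable_indic; exact: measurable_ball_half_space.
apply: measurable_funM.
  apply: measurable_funM.
    by apply: (measurableT_comp (@measurable_powR R _)); exact: measurable_dist.
  apply: (measurableT_comp (@measurable_powR R _)).
  apply: measurableT_comp => //.
  by apply: (measurableT_comp (@measurable_ln _)); exact: measurable_dist.
by apply: measurable_indic; exact: measurable_ball_half_space.
Qed.

Definition initial_density (p : R) z (kappa : {posnum R}) x : R :=
  kappa%:num * height x * f_sing p z x.

Lemma initial_density_ge0 p z kappa x : 0 <= initial_density p z kappa x.
Proof.
rewrite /initial_density -mulrA mulr_ge0// /f_sing.
case: ifPn => _; rewrite indicE.
all: have [|_] := boolP (x \in _); rewrite ?mulr0// inE => -[_ x0].
all: by rewrite ?mulr1; apply: mulr_ge0 => //; rewrite ?mulr_ge0// powR_ge0.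
Qed.

Lemma measurable_initial_density p z kappa :
  measurable_fun setT (initial_density p z kappa).
Proof.
apply: measurable_funM; last exact: measurable_f_sing.
by apply: measurable_funM => //; exact: measurable_height.
Qed.

(** kappa x_N f_z(x) dx; f_z vanishes outside the closed half-space, so this is
    a measure on R^N carried by it. *)
Definition initial_measure (p : R) z (kappa : {posnum R}) :
    {measure set (euclidean R N) -> \bar R} :=
  density (lebesgue_tuple N) (initial_density_ge0 p z kappa)
    (measurable_initial_density p z kappa).

End half_space.

Arguments half_space {R N}.
Arguments closed_half_space {R N}.

(* Main.v *)
(* Existence.  For 0 < k the integral equation has a solution as soon as it has a supersolution w
   (monotone iteration), so the admissible k form an interval.  Let v(x,t) be a superposition,
   with weight nu(r) dr, of Gaussians centred at z at times r + t; the heat semigroup maps v(.,s)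
   to v(.,t), so if w^p <= phi(s) v + psi(s) then the Duhamel term of w at time t is at most
   (int_0^t phi) v + int_0^t psi.  For p > p_N take v(.,0) of the order of f_z^alpha with
   1 < alpha < min(p, N(p-1)/2) and w = b v^(1/alpha).  For p = p_N take v(.,0) of the order of
   |x-z|^-N |log|x-z||^-(N/4+1) and w = b (t^-(N/(2(N+2))) + |log t|^(-N/4) v).  In both cases
   b small works.

   Nonexistence, with a bound that does not see z.  Near z the Dirichlet kernel is comparable with
   h^-N on cubes of side h for times of order h^2.  With h_i = 2^i h_0 and X_i the initial mass
   of the cube of size h_0 plus the integral of u^p over the space-time blocks of sizes
   h_0, ..., h_(i-1), one gets X_(i+1) >= X_i + c X_i^p h_i^(N+2-Np) with c = c(N,p), while X_n stays
   bounded when h_n is fixed and h_0 -> 0.  For k large this recursion forces X_n to infinity. *)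
Require Import Defs.
From HB Require Import structures.
From mathcomp Require Import all_boot all_order all_algebra.
From mathcomp Require Import all_classical all_reals all_analysis.
From mathcomp Require Import measurable_realfun ring lra zify.
Set Implicit Arguments.
Unset Strict Implicit.
Unset Printing Implicit Defensive.
Import Order.TTheory GRing.Theory Num.Theory.
Import numFieldNormedType.Exports.
Local Open Scope classical_set_scope.
Local Open Scope ring_scope.

(** The boundary enters on one side only. For existence the Dirichlet kernel is bounded by the
    Gaussian on the whole space, where the semigroup law is exact. For nonexistence z_N limits the
    largest scale h_n, but the constants of the recursion do not involve that scale and the number
    of dyadic steps below it is unlimited; hence a bound independent of z.

    The two exponents differ in kind. Above p_N the ratio of X_i to h_i^(N - 2/(p-1)) starts from a
    value that does not depend on h_0 and doubles at each step once k is large. At p_N the recursion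
    contains no power of h and the initial mass only decays like |log h_0|^(-N/2): half of the
    available steps bring it up to a fixed threshold, the other half make it blow up.

    For existence above p_N, f_z^alpha is still locally integrable for some alpha > 1, and
    v^(1/alpha) gains over v itself. At p_N no power above 1 is integrable near z. The substitute is
    a cut of f_z at a radius t^q depending on time, with the logarithm of f_z shared equally between
    v and a factor in t. *)

Section monotone_iteration.
Context d (E : measurableType d) (R : realType).
Context (m : {sigma_finite_measure set E -> \bar R}) (p : R) (p0 : 0 < p).
Context (L : E -> \bar R) (H : E * E -> R).
Hypotheses (mL : measurable_fun setT L) (L0 : forall e, (0 <= L e)%E).
Hypotheses (mH : measurable_fun setT H) (H0 : forall e, 0 <= H e).
Local Open Scope ereal_scope.

(** Space and time are merged into one sigma-finite space, so that the Duhamel term is a single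
    integral operator; causality will be encoded in the kernel [H]. *)
Definition power_op (w : E -> \bar R) e := \int[m]_e' ((H (e, e'))%:E * w e' `^ p).

Lemma measurable_power_op w : measurable_fun setT w ->
  measurable_fun setT (power_op w).
Proof.
move=> mw.
apply: (@measurable_fun_fubini_tonelli_F _ _ _ _ _ m
   (fun z => (H z)%:E * w z.2 `^ p)) => [|x].
  apply: emeasurable_funM; first exact/measurable_EFinP.
  apply: (measurableT_comp (@measurable_poweR R p)).
  by apply: measurableT_comp => //; exact: measurable_snd.
by rewrite mule_ge0// ?lee_fin// poweR_ge0.
Qed.

Lemma measurable_power_op_integrand w e : measurable_fun setT w ->
  measurable_fun setT (fun e' => (H (e, e'))%:E * w e' `^ p).
Proof.
move=> mw; apply: emeasurable_funM.
  apply/measurable_EFinP; exact: (measurableT_comp mH (pair1_measurable e)).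
by apply: (measurableT_comp (@measurable_poweR R p)).
Qed.

Lemma power_op_ge0 w e : 0 <= power_op w e.
Proof. by apply: integral_ge0 => x _; rewrite mule_ge0// ?lee_fin// poweR_ge0. Qed.

Lemma le_poweR2r (a b : \bar R) r : (0 <= r)%R -> 0 <= a -> a <= b -> a `^ r <= b `^ r.
Proof.
move=> r0 a0 ab; have b0 := le_trans a0 ab.
by apply: gt0_ler_poweR; rewrite ?in_itv/= ?a0 ?b0 ?leey.
Qed.

Lemma le_power_op v w e : measurable_fun setT v -> measurable_fun setT w ->
  (forall x, 0 <= v x) -> (forall x, 0 <= w x) ->
  {ae m, forall x, v x <= w x} -> power_op v e <= power_op w e.
Proof.
move=> mv mw v0 w0 vw; apply: ae_ge0_le_integral => //.
- by move=> x _; rewrite mule_ge0// ?lee_fin// poweR_ge0.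
- exact: measurable_power_op_integrand.
- by move=> x _; rewrite mule_ge0// ?lee_fin// poweR_ge0.
- exact: measurable_power_op_integrand.
apply: filterS vw => x vw _; rewrite lee_wpmul2l ?lee_fin//.
by apply: le_poweR2r => //; exact: ltW.
Qed.

(** On [0, +oo] the p-th power is an increasing bijection whose inverse is the power 1/p, so it
    commutes with suprema, the value +oo included. *)
Lemma cvg_poweR (a : (\bar R)^nat) : {homo a : i j / (i <= j)%N >-> i <= j} ->
  (forall n, 0 <= a n) -> a n `^ p @[n --> \oo] --> limn a `^ p.
Proof.
move=> nda a0.
have ndp : {homo (fun n => a n `^ p) : i j / (i <= j)%N >-> i <= j}.
  by move=> i j ij; apply: le_poweR2r; [exact: ltW| |exact: nda].
have := ereal_nondecreasing_cvgn ndp.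
rewrite (cvg_lim _ (ereal_nondecreasing_cvgn nda))//.
set s := ereal_sup (range a); set t := ereal_sup _.
have s0 : 0 <= s by apply: le_trans (a0 0%N) _; apply: ereal_sup_ubound; exists 0%N.
have t0 : 0 <= t.
  apply: (@le_trans _ _ (a 0%N `^ p)); first exact: poweR_ge0.
  by apply: ereal_sup_ubound; exists 0%N.
suff -> : s `^ p = t by [].
apply/eqP; rewrite eq_le; apply/andP; split.
- have -> : t = (t `^ p^-1) `^ p by rewrite -poweRrM mulVf ?gt_eqF// poweRe1.
  apply: le_poweR2r => //; first exact: ltW.
  apply: ge_ereal_sup => _ [n _ <-].
  have -> : a n = (a n `^ p) `^ p^-1 by rewrite -poweRrM mulfV ?gt_eqF// poweRe1.
  apply: le_poweR2r; [by rewrite invr_ge0 ltW|exact: poweR_ge0|].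
  by apply: ereal_sup_ubound; exists n.
- apply: ge_ereal_sup => _ [n _ <-].
  apply: le_poweR2r => //; first exact: ltW.
  by apply: ereal_sup_ubound; exists n.
Qed.

(** The iterates of [v |-> L + power_op v] from 0 increase everywhere and stay below [w] almost
    everywhere, by induction: the integral does not see null sets. Monotone convergence makes the
    limit an exact solution at every point; only the comparison with [w] is up to a null set. *)
Lemma solution_below_supersolution (w : E -> \bar R) :
  measurable_fun setT w -> (forall e, 0 <= w e) ->
  {ae m, forall e, L e + power_op w e <= w e} ->
  exists u : E -> \bar R, [/\ measurable_fun setT u, forall e, 0 <= u e,
    forall e, u e = L e + power_op u e & {ae m, forall e, u e <= w e}].
Proof.
move=> mw w0 sw.
pose U := fun n => iter n (fun v e => L e + power_op v e) (fun=> 0).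
have US n e : U n.+1 e = L e + power_op (U n) e by [].
have mU n : measurable_fun setT (U n).
  elim: n => [|n IH]; first exact: measurable_cst.
  by apply: emeasurable_funD => //; exact: measurable_power_op.
have U0 n e : 0 <= U n e.
  by case: n => [//|n]; rewrite US adde_ge0// power_op_ge0.
have Uw n : {ae m, forall e, U n e <= w e}.
  elim: n => [|n IH]; first by apply/nearW => e; exact: w0.
  apply: filterS sw => e; apply: le_trans; rewrite US leeD2l//.
  exact: le_power_op.
have US_le n e : U n e <= U n.+1 e.
  elim: n e => [|n IH] e; first exact: U0.
  rewrite !US leeD2l//; apply: le_power_op => //.
  by apply/nearW => x; exact: IH.
have ndU e : {homo U ^~ e : i j / (i <= j)%N >-> i <= j}.
  by apply/nondecreasing_seqP => n; exact: US_le.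
have cU e : U n e @[n --> \oo] --> limn (U ^~ e).
  by apply: ereal_nondecreasing_is_cvgn; exact: ndU.
exists (fun e => limn (U ^~ e)); split.
- by apply: (emeasurable_fun_cvg U) => // e _; exact: cU.
- by move=> e; apply: lime_ge; [exact: cU|exact: nearW].
- move=> e; apply/cvg_lim => //.
  rewrite -(cvg_shiftS (U ^~ e)); apply: cvgeD.
  + by rewrite ge0_adde_def// inE ?L0 ?power_op_ge0.
  + exact: cvg_cst.
  + rewrite /power_op.
    have -> : \int[m]_e' ((H (e, e'))%:E * limn (U^~ e') `^ p) =
       \int[m]_e' limn (fun n => (H (e, e'))%:E * U n e' `^ p).
      apply: eq_integral => e' _; apply/esym/cvg_lim => //.
      by apply: cvgeZl => //; exact: cvg_poweR.
    apply: (@cvg_monotone_convergence _ _ _ m setT measurableT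
      (fun n e' => (H (e, e'))%:E * U n e' `^ p)).
    * by move=> n; exact: measurable_power_op_integrand.
    * by move=> n x _; rewrite mule_ge0// ?lee_fin// poweR_ge0.
    * move=> x _ i j ij; rewrite lee_wpmul2l ?lee_fin//.
      by apply: le_poweR2r; [exact: ltW| |exact: ndU].
- have : {ae m, forall e n, U n e <= w e}.
    by apply/ae_foralln => n; exact: Uw.
  apply: filterS => e Ue; apply: lime_le; first exact: cU.
  exact: nearW.
Qed.

End monotone_iteration.

(** The inverse is discontinuous at 0, so measurability is taken from real powers. Squaring makes
    the base nonnegative, where the power -1 is the inverse; at 0 both sides are 0 by convention. *)
Lemma measurable_invr (R : realType) : measurable_fun [set: R] (@GRing.inv R).
Proof.
have -> : @GRing.inv R = fun t : R => t * (t ^+ 2) `^ (-1).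
  apply/funext => t; rewrite powR_inv1 ?sqr_ge0//.
  have [->|t0] := eqVneq t 0; first by rewrite invr0 mul0r.
  by rewrite expr2 invfM mulrA mulfV// mul1r.
apply: measurable_funM => //.
by apply: (measurableT_comp (@measurable_powR R _)); exact: measurable_funX.
Qed.

(** * Measurability of the heat kernels *)

Section measurable_kernels.
Context d (T : measurableType d) (R : realType) (N : nat).
Context (X Y : T -> euclidean R N) (t : T -> R).
Hypotheses (mX : measurable_fun setT X) (mY : measurable_fun setT Y).
Hypothesis mt : measurable_fun setT t.

Lemma measurable_enorm : measurable_fun setT (fun a => enorm (X a)).
Proof.
apply: (measurableT_comp (continuous_measurable_fun (@sqrt_continuous R))).
apply: measurable_sum => i; apply: measurable_funX.
exact: (measurableT_comp (measurable_tnth i) mX).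
Qed.

Lemma measurable_esub : measurable_fun setT (fun a => esub (X a) (Y a)).
Proof.
apply/measurable_fun_tnthP => i.
have -> : (@tnth _ (measurableTypeR R) ^~ i) \o (fun a => esub (X a) (Y a)) =
    fun a => (tnth (X a) i : R) - (tnth (Y a) i : R).
  by apply/funext => a /=; rewrite tnth_mktuple.
apply: measurable_funB.
  exact: (measurableT_comp (measurable_tnth i) mX).
exact: (measurableT_comp (measurable_tnth i) mY).
Qed.

Lemma measurable_gauss_kernel :
  measurable_fun setT (fun a => gauss_kernel (X a) (t a)).
Proof.
apply: measurable_funM.
  apply: (measurableT_comp (@measurable_powR R _)).
  exact: measurable_funM.
apply: (measurableT_comp (@measurable_expR R)); apply: measurable_funN.
apply: measurable_funM; first exact/measurable_funX/measurable_enorm.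
by apply: (measurableT_comp (@measurable_invr R)); exact: measurable_funM.
Qed.

End measurable_kernels.

Section measurable_dirichlet.
Context d (T : measurableType d) (R : realType) (N : nat).
Context (X Y : T -> euclidean R N) (t : T -> R).
Hypotheses (mX : measurable_fun setT X) (mY : measurable_fun setT Y).
Hypothesis mt : measurable_fun setT t.

Lemma measurable_dirichlet_kernel :
  measurable_fun setT (fun a => dirichlet_kernel (X a) (Y a) (t a)).
Proof.
apply: measurable_funM.
  by apply: measurable_gauss_kernel => //; exact: measurable_esub.
apply: measurable_funB => //.
apply: (measurableT_comp (@measurable_expR R)); apply: measurable_funN.
apply: measurable_funM; last exact: (measurableT_comp (@measurable_invr R)).
by apply: measurable_funM; apply: measurableT_comp => //; exact: measurable_height.
Qed.

Lemma measurable_K_kernel :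
  measurable_fun setT (fun a => K_kernel (X a) (Y a) (t a)).
Proof.
apply: measurable_fun_ifT => /=.
- apply: measurable_fun_ltr => //.
  by apply: measurableT_comp => //; exact: measurable_height.
- apply: measurable_funM; last exact: measurable_dirichlet_kernel.
  apply: (measurableT_comp (@measurable_invr R)).
  by apply: measurableT_comp => //; exact: measurable_height.
- apply: measurable_funM.
    apply: measurable_funM.
      by apply: measurableT_comp => //; exact: measurable_height.
    exact: (measurableT_comp (@measurable_invr R)).
  by apply: measurable_gauss_kernel => //; exact: measurable_esub.
Qed.

End measurable_dirichlet.

Section density_integral.
Context d (T : measurableType d) (R : realType).
Context (m : {measure set T -> \bar R}) (g : T -> R).
Hypothesis (g0 : forall x, 0 <= g x) (mg : measurable_fun setT g).
Local Open Scope ereal_scope.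
Import HBNNSimple.

(** For a simple function this is the definition of [density] on each level set; monotone
    convergence on both sides extends it to [f]. *)
Lemma ge0_integral_density (f : T -> \bar R) : measurable_fun setT f ->
  (forall x, 0 <= f x) ->
  \int[density m g0 mg]_x f x = \int[m]_x ((g x)%:E * f x).
Proof.
move=> mf f0.
pose f_ := nnsfun_approx measurableT mf.
have gf0 n x : 0 <= (g x)%:E * (f_ n x)%:E by rewrite mule_ge0// lee_fin.
have mgf n : measurable_fun setT (fun x => (g x)%:E * (f_ n x)%:E).
  by apply: emeasurable_funM; apply/measurable_EFinP => //; exact/measurable_funP.
transitivity (limn (fun n => \int[density m g0 mg]_x (f_ n x)%:E)).
  rewrite -monotone_convergence//.
  - apply: eq_integral => y _; apply/esym/cvg_lim => //.
    by apply: cvg_nnsfun_approx.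
  - by move=> n; exact/measurable_EFinP/measurable_funP.
  - by move=> n y _; rewrite lee_fin.
  - by move=> y _ i j ij; rewrite lee_fin; exact/lefP/nd_nnsfun_approx.
rewrite [X in limn X](_ : _ = (fun n => \int[m]_x ((g x)%:E * (f_ n x)%:E))).
  rewrite -monotone_convergence//; last first.
    move=> x _ i j ij; rewrite lee_wpmul2l ?lee_fin//.
    exact/lefP/nd_nnsfun_approx.
  apply: eq_integral => x _ /=; apply/cvg_lim => //.
  by apply: cvgeZl => //; exact: cvg_nnsfun_approx.
apply/funext => n.
rewrite integralT_nnsfun sintegralE.
transitivity (\sum_(k \in range (f_ n))
    \int[m]_x ((g x)%:E * (k * \1_(f_ n @^-1` [set k]) x)%:E)).
  apply: eq_fsbigr => r; rewrite inE => -[y _ ryE].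
  have r0 : (0 <= r)%R by rewrite -ryE.
  rewrite /density -ge0_integralZl_EFin//.
  - rewrite integral_mkcond; apply: eq_integral => x _; rewrite patchE indicE.
    by case: ifPn => _; rewrite ?mulr1 ?mulr0 ?mule0// muleC.
  - by move=> x _; rewrite lee_fin.
  - by apply/measurable_EFinP; exact: measurable_funTS.
rewrite -ge0_integral_fsum//.
- apply: eq_integral => x _; rewrite (fimfunE (f_ n)) -fsumEFin// ge0_mule_fsumr//.
  by move=> r; rewrite EFinM nnfun_muleindic_ge0.
- move=> r; apply: emeasurable_funM; first exact/measurable_EFinP.
  exact/measurable_EFinP/measurable_funM.
- by move=> r x _; rewrite mule_ge0 ?lee_fin// -lee_fin EFinM nnfun_muleindic_ge0.
Qed.

End density_integral.

(** * The integral equation *)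

Section integral_equation.
Context {R : realType} (N : nat).
Local Notation E := (euclidean R N * measurableTypeR R)%type.

Definition space_time_measure : set E -> \bar R :=
  (lebesgue_tuple N \x lebesgue_measure)%E.

(* The library's canonical sigma-finite structure on products only covers
   subprobabilities: the one for sigma-finite factors has to be redeclared. *)
HB.instance Definition _ := Measure.on space_time_measure.
HB.instance Definition _ := Measure_isSigmaFinite.Build _ _ _ space_time_measure
  (isSigmaFinite.sigma_finiteT
    (lebesgue_integral_fubini.measure_function_Measure_isSigmaFinite__to__measure_function_isSigmaFinite
      (lebesgue_tuple N) lebesgue_measure)).

Definition space_time : {sigma_finite_measure set E -> \bar R} :=
  space_time_measure.

Lemma measurable_half_space : measurable (@half_space R N).
Proof.
rewrite -[X in measurable X]setTI.
have := @measurable_height R N measurableT _ (measurable_itv `]0, +oo[).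
by congr (measurable (_ `&` _)); apply/seteqP; split => x /=; rewrite in_itv/= andbT.
Qed.

Lemma measurable_closed_half_space : measurable (@closed_half_space R N).
Proof.
rewrite -[X in measurable X]setTI.
have := @measurable_height R N measurableT _ (measurable_itv `[0, +oo[).
by congr (measurable (_ `&` _)); apply/seteqP; split => x /=; rewrite in_itv/= andbT.
Qed.

Lemma cylinderE T : cylinder T = half_space `*` `]0, T[%classic :> set E.
Proof. by apply/seteqP; split => -[x t] /=; rewrite /cylinder/= in_itv/=. Qed.

Lemma measurable_cylinder T : measurable (cylinder T : set E).
Proof.
rewrite cylinderE; apply: measurableX; first exact: measurable_half_space.
exact: measurable_itv.
Qed.

Definition causal_pairs T : set (E * E) :=
  (cylinder T `*` cylinder T) `&` [set z | z.2.2 < z.1.2].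

(** The indicator turns the iterated integral over 0 < s < t and the half-space into one integral
    over all of space-time, and makes the kernel nonnegative everywhere, as the monotone iteration
    requires. *)
Definition duhamel_kernel T (z : E * E) : R :=
  \1_(causal_pairs T) z * dirichlet_kernel z.1.1 z.2.1 (z.1.2 - z.2.2).

Lemma measurable_causal_pairs T : measurable (causal_pairs T).
Proof.
apply: measurableI; first by apply: measurableX; exact: measurable_cylinder.
rewrite -[X in measurable X]setTI.
have mlt : measurable_fun setT (fun z : E * E => z.2.2 < z.1.2 :> R).
  apply: measurable_fun_ltr.
    by apply: measurableT_comp; [exact: measurable_snd|exact: measurable_snd].
  by apply: measurableT_comp; [exact: measurable_snd|exact: measurable_fst].
have := mlt measurableT [set true] I.
by congr measurable.
Qed.

Lemma measurable_duhamel_kernel T : measurable_fun setT (duhamel_kernel T).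
Proof.
apply: measurable_funM.
  by apply: measurable_indic; exact: measurable_causal_pairs.
apply: measurable_dirichlet_kernel.
- by apply: measurableT_comp; [exact: measurable_fst|exact: measurable_fst].
- by apply: measurableT_comp; [exact: measurable_fst|exact: measurable_snd].
- apply: measurable_funB.
    by apply: measurableT_comp; [exact: measurable_snd|exact: measurable_fst].
  by apply: measurableT_comp; [exact: measurable_snd|exact: measurable_snd].
Qed.

Lemma gauss_kernel_ge0 (x : euclidean R N) t : 0 <= gauss_kernel x t.
Proof. by rewrite mulr_ge0 ?powR_ge0 ?expR_ge0. Qed.

Lemma dirichlet_kernel_ge0 (x y : euclidean R N) t :
  0 < t -> 0 <= height x -> 0 <= height y -> 0 <= dirichlet_kernel x y t.
Proof.
move=> t0 x0 y0; rewrite mulr_ge0 ?gauss_kernel_ge0// subr_ge0 -expR0 ler_expR.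
by rewrite oppr_le0 divr_ge0 ?mulr_ge0// ltW.
Qed.

Lemma dirichlet_le_gauss (x y : euclidean R N) t :
  dirichlet_kernel x y t <= gauss_kernel (esub x y) t.
Proof. by rewrite ler_piMr ?gauss_kernel_ge0// lerBlDr lerDl expR_ge0. Qed.

Lemma duhamel_kernel_ge0 T z : 0 <= duhamel_kernel T z.
Proof.
rewrite /duhamel_kernel indicE.
have [|_] := boolP (z \in _); rewrite ?mul0r// mul1r => /set_mem[[[x0 _] [y0 _]] st].
by rewrite dirichlet_kernel_ge0 ?subr_gt0//; exact: ltW.
Qed.

Lemma f_sing_ge0 p z (x : euclidean R N) : 0 <= f_sing p z x.
Proof. by rewrite /f_sing; case: ifPn => _; rewrite ?mulr_ge0 ?powR_ge0. Qed.

(** The Dirichlet heat semigroup applied to f_z: the weight x_N of the initial measure cancels the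
    factor 1/y_N of [K_kernel], and the constant kappa is left out. *)
Definition initial_potential p z T (e : E) : \bar R :=
  (\int[lebesgue_tuple N]_y (\1_(cylinder T) e * \1_half_space y *
     (dirichlet_kernel e.1 y e.2 * f_sing p z y))%:E)%E.

Lemma initial_potential_integrand_ge0 p z T (e : E) y :
  0 <= \1_(cylinder T) e * \1_half_space y *
     (dirichlet_kernel e.1 y e.2 * f_sing p z y).
Proof.
rewrite !indicE; have [|_] := boolP (e \in _); rewrite ?mul0r// mul1r.
move=> /set_mem[/= x0 /andP[t0 _]].
have [|_] := boolP (y \in _); rewrite ?mul0r// => /set_mem y0.
by rewrite mul1r mulr_ge0 ?f_sing_ge0// dirichlet_kernel_ge0//; exact: ltW.
Qed.

Lemma initial_potential_ge0 p z T e : (0 <= initial_potential p z T e)%E.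
Proof.
by apply: integral_ge0 => y _; rewrite lee_fin initial_potential_integrand_ge0.
Qed.

Lemma measurable_initial_potential p z T :
  measurable_fun setT (initial_potential p z T).
Proof.
apply: (@measurable_fun_fubini_tonelli_F _ _ _ _ _ (lebesgue_tuple N)
   (fun a : E * euclidean R N => (\1_(cylinder T) a.1 * \1_half_space a.2 *
     (dirichlet_kernel a.1.1 a.2 a.1.2 * f_sing p z a.2))%:E)) => [|a].
  apply/measurable_EFinP; apply: measurable_funM.
    apply: measurable_funM.
      have m1 : measurable_fun setT (\1_(cylinder T) : E -> R).
        by apply: measurable_indic; exact: measurable_cylinder.
      exact: (measurableT_comp m1 measurable_fst).
    have m1 : measurable_fun setT (\1_half_space : euclidean R N -> R).
      by apply: measurable_indic; exact: measurable_half_space.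
    exact: (measurableT_comp m1 measurable_snd).
  apply: measurable_funM.
    apply: measurable_dirichlet_kernel.
    - by apply: measurableT_comp; exact: measurable_fst.
    - exact: measurable_snd.
    - by apply: measurableT_comp; [exact: measurable_snd|exact: measurable_fst].
  by apply: (measurableT_comp (measurable_f_sing _ _)); exact: measurable_snd.
by rewrite lee_fin initial_potential_integrand_ge0.
Qed.

(** In the interior y_N cancels. On the boundary, where [K_kernel] takes its second form, the
    density of the initial measure vanishes with y_N. *)
Lemma integral_K_kernel p z (k : {posnum R}) T x t : cylinder T (x, t) ->
  (\int[initial_measure p z k]_(y in closed_half_space) (K_kernel x y t)%:E =
   k%:num%:E * initial_potential p z T (x, t))%E.
Proof.
move=> xt; have [x0 /andP[t0 _]] := xt; rewrite /= in x0 t0.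
have cxt : \1_(cylinder T) (x, t) = 1 :> R by rewrite indicE mem_set.
rewrite integral_mkcond.
have K0 y : closed_half_space y -> 0 <= K_kernel x y t.
  move=> y0; rewrite /K_kernel; case: ifPn => y0'.
    by rewrite mulr_ge0 ?invr_ge0 ?dirichlet_kernel_ge0//; exact: ltW.
  by rewrite mulr_ge0 ?gauss_kernel_ge0// divr_ge0//; exact: ltW.
rewrite ge0_integral_density; last 2 first.
- apply/measurable_restrict => //; first exact: measurable_closed_half_space.
  apply/measurable_EFinP; apply: measurable_funTS.
  exact: measurable_K_kernel.
- move=> y; rewrite patchE; case: ifPn => //; rewrite inE => y0.
  by rewrite lee_fin K0.
rewrite -ge0_integralZl_EFin//; last 2 first.
- by move=> y _; rewrite lee_fin initial_potential_integrand_ge0.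
- apply/measurable_EFinP; apply: measurable_funM.
    by apply: measurable_funM => //; apply: measurable_indic; exact: measurable_half_space.
  by apply: measurable_funM; [exact: measurable_dirichlet_kernel|exact: measurable_f_sing].
apply: eq_integral => y _; rewrite patchE cxt mul1r indicE.
have [y0|y0] := ltrP 0 (height y).
  rewrite (mem_set (y0 : half_space y)) mem_set; last exact: ltW.
  rewrite /= /initial_density /K_kernel y0 mul1r -EFinM; congr EFin.
  by field; rewrite gt_eqF.
have ny : ~ half_space y by move=> h; move: y0; rewrite leNgt h.
rewrite (memNset ny)/=.
rewrite mul0r mule0; case: ifPn => [/set_mem y1|_]; last by rewrite mule0.
have {y0 y1} y0 : height y = 0 by apply/eqP; rewrite eq_le y0 y1.
by rewrite /initial_density y0 mulr0 mul0r mul0e.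
Qed.

(** Tonelli, with time as the outer variable. [u] and [w] are compared in the cylinder only, so that
    a solution given there can be replaced by an extension [w] that is measurable everywhere. *)
Lemma duhamel_integral p T (u w : E -> \bar R) x t : 
  measurable_fun setT w -> (forall e, 0 <= w e)%E ->
  (forall e, cylinder T e -> u e = w e) ->
  cylinder T (x, t) ->
  (\int[lebesgue_measure]_(s in `]0%R, (t : R)[)
     \int[lebesgue_tuple N]_(y in half_space)
       ((dirichlet_kernel x y (t - s)%R)%:E * (u (y, s) `^ p)) =
   power_op space_time p (duhamel_kernel T) w (x, t))%E.
Proof.
move=> mw w0 uw xt.
rewrite /power_op fubini_tonelli2; last 2 first.
- apply: measurable_power_op_integrand => //.
  exact: measurable_duhamel_kernel.
- by move=> e; rewrite mule_ge0// ?poweR_ge0// lee_fin duhamel_kernel_ge0.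
rewrite integral_mkcond; apply: eq_integral => s _.
rewrite patchE /fubini_G; case: ifPn => [/set_mem|] st.
  rewrite [LHS]integral_mkcond; apply: eq_integral => y _; rewrite /= patchE.
  have [/set_mem y0|] := boolP (y \in half_space); last first.
    move=> /negP y0; rewrite /duhamel_kernel indicE memNset/= ?mul0r ?mul0e//.
    by move=> [[_ [/= ys _]]] _; apply: y0; rewrite inE.
  have [/= x0 /andP[t0 tT]] := xt; move: st; rewrite /= in_itv/= => /andP[s0 st].
  have ys : cylinder T (y, s) by split => //=; rewrite s0 (lt_trans st).
  by rewrite uw// /duhamel_kernel indicE mem_set//= mul1r.
rewrite [RHS]integral0_eq// => y _.
rewrite /duhamel_kernel indicE memNset/= ?mul0r ?mul0e// => -[[_ [_ /= s0]] ts].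
by move/negP: st; apply; rewrite inE/= in_itv/= ts; case/andP: s0 => ->.
Qed.

(** The same [w] serves every smaller nonnegative [k], a monotonicity that is not visible on exact
    solutions. Here [k] is any real and [w] lives on all of space-time. *)
Definition supersolvable p z (k : R) T := exists w : E -> \bar R,
  [/\ measurable_fun setT w, forall e, (0 <= w e)%E,
      {ae space_time, forall e, w e \is a fin_num} &
      {ae space_time, forall e, (k%:E * initial_potential p z T e +
         power_op space_time p (duhamel_kernel T) w e <= w e)%E}].

(** Forward, the extension of [u] by zero is a supersolution, since both sides vanish off the
    cylinder. Backward, the solution constructed below [w] satisfies the equation at every point and
    inherits finiteness almost everywhere from [w]. *)
Lemma solution_supersolvable p z (k : {posnum R}) T : 0 < p ->
  (exists u, is_solution p (initial_measure p z k) T u) <->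
  supersolvable p z k%:num T.
Proof.
move=> p0; split.
  move=> [u [[mu u0 ufin] usol]].
  have w0 e : (0 <= (u \_ (cylinder T)) e)%E.
    by rewrite patchE; case: ifPn => // /set_mem; exact: u0.
  have mw : measurable_fun setT (u \_ (cylinder T)).
    have mC := @measurable_cylinder T.
    by apply/(measurable_restrictT _ mC).
  exists (u \_ (cylinder T)); split => //.
    apply: filterS ufin => e he; rewrite patchE; case: ifPn => // /set_mem.
    exact: he.
  apply: filterS usol => -[x t] he; rewrite patchE; case: ifPn => [/set_mem|] xt.
    rewrite he// (integral_K_kernel _ _ _ xt) leeD2l//.
    rewrite (@duhamel_integral p T _ (u \_ (cylinder T)))//.
    by move=> e ce; rewrite patchE mem_set.
  have -> : initial_potential p z T (x, t) = 0%E.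
    apply: integral0_eq => y _.
    by rewrite indicE (negbTE xt) !mul0r.
  rewrite mule0 add0e /power_op integral0_eq// => e _.
  rewrite /duhamel_kernel indicE memNset/= ?mul0r ?mul0e// => -[[h _] _].
  by move/negP: xt; apply; rewrite inE.
move=> [w [mw w0 wfin wsup]].
pose L e : \bar R := (k%:num%:E * initial_potential p z T e)%E.
have [||u [mu u0 ue uw]] := @solution_below_supersolution _ _ _ space_time p p0
  L (duhamel_kernel T) _ _ (@measurable_duhamel_kernel T) (@duhamel_kernel_ge0 T)
  w mw w0 wsup.
- by apply: emeasurable_funM => //; exact: measurable_initial_potential.
- by move=> e; rewrite mule_ge0 ?lee_fin// initial_potential_ge0.
exists u; split; first split.
- exact: measurable_funTS.
- by [].
- apply: filterS2 wfin uw => e we ue' _; rewrite ge0_fin_numE//.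
  by apply: le_lt_trans ue' _; rewrite ltey_eq we.
- apply/nearW => -[x t] xt; rewrite ue (integral_K_kernel _ _ _ xt).
  by rewrite (@duhamel_integral p T _ u).
Qed.

Lemma supersolvable_le p z k k' T : 0 <= k -> k <= k' ->
  supersolvable p z k' T -> supersolvable p z k T.
Proof.
move=> k0 kk' [w [mw w0 wfin wsup]]; exists w; split => //.
apply: filterS wsup => e; apply: le_trans; rewrite leeD2r//.
by rewrite lee_wpmul2r ?lee_fin// initial_potential_ge0.
Qed.

End integral_equation.

(** * Nonexistence *)

Section cubes.
Context {R : realType} (N : nat).
Implicit Types (x y z : euclidean R N) (h t : R).

(** Balls of the sup norm rather than Euclidean ones: their measure is an explicit product, and
    halving the radius gives dyadic shells of known volume. *)
Definition cube z h : set (euclidean R N) :=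
  [set x | forall i, `|tnth x i - tnth z i : R| <= h].

Lemma cube_box z h : cube z h = [set x : euclidean R N |
  forall i, `[(tnth z i : R) - h, (tnth z i : R) + h]%classic (tnth x i)].
Proof.
apply/seteqP; split => x + i => /(_ i) /=; rewrite in_itv/=.
  by rewrite ler_distl.
by rewrite ler_distl.
Qed.

Lemma measurable_cube z h : measurable (cube z h).
Proof.
rewrite (_ : cube z h = \bigcap_(i in [set: 'I_N])
    ((fun x : euclidean R N => tnth x i) @^-1`
      `[(tnth z i : R) - h, (tnth z i : R) + h]%classic)); last first.
  by rewrite cube_box; apply/seteqP; split => [x Bx i _|x Bx i]; exact: Bx.
apply: fin_bigcap_measurable => // i _.
rewrite -[X in measurable X]setTI; by apply: measurable_tnth.
Qed.

Lemma lebesgue_cube z h : 0 <= h ->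
  lebesgue_tuple N (cube z h) = ((2 * h) ^+ N)%:E.
Proof.
move=> h0; rewrite cube_box.
rewrite (@lebesgue_tuple_box R N (fun i : 'I_N =>
  `[(tnth z i : R) - h, (tnth z i : R) + h]%classic)); last first.
  by move=> i; exact: measurable_itv.
under eq_bigr => i _.
  rewrite lebesgue_measure_itv/= lte_fin.
  rewrite (_ : (if _ then _ else _) = (2 * h)%:E); last first.
    case: ifPn => [_|]; first by rewrite -EFinB; congr EFin; ring.
    rewrite -leNgt => hh; congr EFin; apply/eqP.
    by rewrite eq_le mulr_ge0//=; lra.
  over.
by rewrite prodEFin big_const_ord iter_mulr_1.
Qed.

Lemma sub_cube z h h' : h <= h' -> cube z h `<=` cube z h'.
Proof. by move=> hh' x xh i; exact: le_trans (xh i) _. Qed.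

Lemma cube_height z h x : (0 < N)%N -> cube z h x -> `|height x - height z| <= h.
Proof.
move=> N0 xh; have lN : (N.-1 < N)%N by rewrite prednK.
by have := xh (Ordinal lN); rewrite !(tnth_nth 0).
Qed.

Lemma enorm_ge0 x : 0 <= enorm x. Proof. exact: sqrtr_ge0. Qed.

Lemma sqr_enorm x : enorm x ^+ 2 = \sum_(i < N) (tnth x i : R) ^+ 2.
Proof. by rewrite sqr_sqrtr// sumr_ge0// => i _; rewrite sqr_ge0. Qed.

Lemma sqr_enorm_esub x y :
  enorm (esub x y) ^+ 2 = \sum_(i < N) ((tnth x i : R) - tnth y i) ^+ 2.
Proof. by rewrite sqr_enorm; apply: eq_bigr => i _; rewrite tnth_mktuple. Qed.

Lemma sqr_enorm_cube z h x y : cube z h x -> cube z h y ->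
  enorm (esub x y) ^+ 2 <= N%:R * (4 * h ^+ 2).
Proof.
move=> xh yh; rewrite sqr_enorm_esub.
apply: (@le_trans _ _ (\sum_(i < N) (4 * h ^+ 2))).
  apply: ler_sum => i _.
  have -> : 4 * h ^+ 2 = (h + h) ^+ 2 by ring.
  rewrite -[leLHS]real_normK ?num_real// ler_sqr ?nnegrE//; last first.
    by rewrite addr_ge0// (le_trans _ (xh i)).
  rewrite -[X in `|X|](subrKA (tnth z i : R)) (le_trans (ler_normD _ _))//.
  by rewrite lerD// distrC.
by rewrite sumr_const card_ord -[leLHS]mulr_natl.
Qed.

Lemma le_coord_enorm x i : `|tnth x i : R| <= enorm x.
Proof.
rewrite -(@ler_sqr _) ?nnegrE ?enorm_ge0// sqr_enorm (bigD1 i)//=.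
by rewrite real_normK ?num_real// lerDl sumr_ge0// => j _; rewrite sqr_ge0.
Qed.

Lemma enorm_cube z h x : (0 < N)%N -> 0 <= h -> cube z h x ->
  enorm (esub x z) <= N%:R * h.
Proof.
move=> N0 h0 xh.
rewrite -(@ler_sqr _) ?nnegrE ?enorm_ge0 ?mulr_ge0// sqr_enorm_esub.
apply: (@le_trans _ _ (\sum_(i < N) h ^+ 2)).
  apply: ler_sum => i _; rewrite -[leLHS]real_normK ?num_real//.
  by rewrite ler_sqr ?nnegrE.
rewrite sumr_const card_ord exprMn -[leLHS]mulr_natl ler_wpM2r ?sqr_ge0//.
by rewrite expr2 ler_peMr// ler1n.
Qed.

Lemma enorm_not_cube z h x : ~ cube z h x -> h < enorm (esub x z).
Proof.
move=> /existsNP[i /negP]; rewrite -ltNge => hi.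
apply: lt_le_trans hi _; have := le_coord_enorm (esub x z) i.
by rewrite tnth_mktuple.
Qed.

(** The three factors are lower bounds, for h^2/2 <= t <= 2h^2, of (4 pi t)^(-N/2) up to h^-N, of
    the exponential with |x-y|^2 <= 4 N h^2, and of the Dirichlet correction, which is at least 1 -
    1/e and so at least 1/2. *)
Definition cube_const : R :=
  (8 * pi) `^ (- (N%:R / 2)) * expR (- (2 * N%:R)) / 2.

Lemma cube_const_gt0 : 0 < cube_const.
Proof. by rewrite divr_gt0// mulr_gt0 ?expR_gt0// powR_gt0 // mulr_gt0// pi_gt0. Qed.

(** The assumption 8 h^2 <= z_N^2 keeps both heights above z_N/2, so x_N y_N >= z_N^2/4 >= 2h^2 >=
    t, and the correction factor is bounded away from 0 whatever [z] is. *)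
Lemma dirichlet_kernel_cube z h x y t : (0 < N)%N -> 0 < h -> 0 < height z ->
  8 * h ^+ 2 <= height z ^+ 2 -> cube z h x -> cube z h y ->
  h ^+ 2 / 2 <= t <= 2 * h ^+ 2 ->
  cube_const * h `^ (- N%:R) <= dirichlet_kernel x y t.
Proof.
move=> N0 h0 z0 hz xh yh /andP[th1 th2].
have hh : 0 < h ^+ 2 by rewrite exprn_gt0.
have t0 : 0 < t by lra.
have h2 : 2 * h <= height z.
  by rewrite -(@ler_sqr _) ?nnegrE ?mulr_ge0 ?ltW// exprMn; nra.
have xz : height z / 2 <= height x.
  by have := cube_height N0 xh; rewrite ler_distl => /andP[+ _]; lra.
have yz : height z / 2 <= height y.
  by have := cube_height N0 yh; rewrite ler_distl => /andP[+ _]; lra.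
have xy : 1 <= height x * height y / t.
  rewrite ler_pdivlMr// mul1r (le_trans th2)//.
  apply: (@le_trans _ _ (height z / 2 * (height z / 2))); first nra.
  by rewrite ler_pM// divr_ge0// ltW.
rewrite /dirichlet_kernel /gauss_kernel /cube_const.
have -> : (8 * pi) `^ (- (N%:R / 2)) * expR (- (2 * N%:R)) / 2 * h `^ (- N%:R) =
  (8 * pi * h ^+ 2) `^ (- (N%:R / 2)) * expR (- (2 * N%:R)) * 2^-1.
  rewrite [in RHS]powRM ?mulr_ge0 ?pi_ge0 ?ltW// -[h ^+ 2]powR_mulrn ?ltW// -powRrM.
  by rewrite (_ : 2 * - (N%:R / 2) = - N%:R); [ring|field].
apply: ler_pM; rewrite ?mulr_ge0 ?powR_ge0 ?expR_ge0//.
  apply: ler_pM; rewrite ?powR_ge0 ?expR_ge0//.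
    rewrite !powRN lef_pV2 ?posrE ?powR_gt0 ?mulr_gt0 ?pi_gt0//.
    apply: ge0_ler_powR;
      rewrite ?nnegrE ?divr_ge0 ?mulr_ge0 ?pi_ge0 ?sqr_ge0 ?(ltW t0) ?(ltW h0)//.
    have -> : 8 * pi * h ^+ 2 = 4 * pi * (2 * h ^+ 2) by ring.
    by rewrite ler_wpM2l// mulr_ge0// pi_ge0.
  rewrite ler_expR lerN2 ler_pdivrMr ?mulr_gt0//.
  apply: le_trans (sqr_enorm_cube xh yh) _.
  have -> : 2 * N%:R * (4 * t) = N%:R * (4 * (2 * t)) by ring.
  by rewrite ler_wpM2l//; lra.
have : expR (- (height x * height y / t)) <= expR (- 1).
  by rewrite ler_expR lerN2.
have : expR (- 1) <= (2^-1 : R).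
  by rewrite expRN lef_pV2 ?posrE ?expR_gt0//; have := expR_ge1Dx (1 : R); lra.
lra.
Qed.

End cubes.

(** * Lower bounds across dyadic space-time blocks *)

Section lower_bound.
Context {R : realType} (N : nat) (N0 : (0 < N)%N) (p : R).
Context (z : euclidean R N) (T : R) (z0 : 0 < height z).
Context (h : nat -> R) (h0 : forall i, 0 < h i) (hS : forall i, h i.+1 = 2 * h i).
Local Notation E := (euclidean R N * measurableTypeR R)%type.

Definition block (r : R) : set E := cube z r `*` `]r ^+ 2, 2 * r ^+ 2[%classic.

Lemma measurable_block r : measurable (block r).
Proof. by apply: measurableX; [exact: measurable_cube|exact: measurable_itv]. Qed.

Lemma space_time_block r : 0 < r ->
  space_time N (block r) = ((2 * r) ^+ N * r ^+ 2)%:E.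
Proof.
move=> r0; have mc := @measurable_cube R N z r.
rewrite [LHS](product_measure1E _ _ mc)//=.
rewrite lebesgue_cube ?ltW//= lebesgue_measure_itv/= lte_fin.
rewrite ifT; last by rewrite ltr_pMl ?exprn_gt0// ltr1n.
by rewrite -EFinB -EFinM; congr (_ * _)%:E; ring.
Qed.

(** Scales double, so every time in the tower is below h_i^2/2, while the times of block i lie
    between h_i^2 and 2 h_i^2. The elapsed time is then between h_i^2/2 and 2 h_i^2, the window in
    which the kernel on the cube of size h_i is bounded below. *)
Definition tower i : set E := \big[setU/set0]_(j < i) block (h j).

Lemma measurable_tower i : measurable (tower i).
Proof. by apply: bigsetU_measurable => j _; exact: measurable_block. Qed.

Lemma towerP i e : tower i e -> exists2 j, (j < i)%N & block (h j) e.
Proof. by rewrite /tower -(bigcup_mkord i (fun j => block (h j))) => -[j ji]; exists j. Qed.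

Lemma scale_homo i j : (i <= j)%N -> h i <= h j.
Proof.
by move: i j; apply/nondecreasing_seqP => n; rewrite hS ler_peMl ?ler1n// ltW.
Qed.

Lemma scale_lt i j : (i < j)%N -> 2 * h i <= h j.
Proof. by move=> ij; rewrite -hS; exact: scale_homo. Qed.

Lemma sqr_scale_lt i j : (i < j)%N -> 4 * h i ^+ 2 <= h j ^+ 2.
Proof.
move=> /scale_lt ij; have -> : 4 * h i ^+ 2 = (2 * h i) ^+ 2 by ring.
by rewrite ler_sqr// nnegrE ?mulr_ge0// ltW.
Qed.

Lemma tower_time i e : tower i e -> 0 < e.2 < h i ^+ 2 / 2.
Proof.
move=> /towerP[j ji [_ /=]]; rewrite in_itv/= => /andP[e1 e2].
have := sqr_scale_lt ji; have := sqr_ge0 (h j) => ? ?.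
by apply/andP; split; lra.
Qed.

Lemma tower_space i e : tower i e -> cube z (h i) e.1.
Proof.
move=> /towerP[j ji [ej _]]; apply: sub_cube ej; apply: scale_homo; exact: ltnW.
Qed.

Lemma tower_disjoint i : tower i `&` block (h i) = set0.
Proof.
apply/seteqP; split => // e [/tower_time/andP[_ ei] [_ /=]].
rewrite in_itv/= => /andP[+ _]; have := sqr_ge0 (h i); lra.
Qed.

Context (n : nat) (hn : 8 * h n ^+ 2 <= height z ^+ 2) (hT : 2 * h n ^+ 2 < T).

Lemma small_scale i : (i <= n)%N ->
  8 * h i ^+ 2 <= height z ^+ 2 /\ 2 * h i ^+ 2 < T.
Proof.
move=> /scale_homo hi; have : h i ^+ 2 <= h n ^+ 2.
  by rewrite ler_sqr// nnegrE ltW.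
by move: hn hT => ? ? ?; split; lra.
Qed.

Lemma cube_half_space r x : 0 < r -> 8 * r ^+ 2 <= height z ^+ 2 ->
  cube z r x -> half_space x.
Proof.
move=> r0 rz xr; rewrite /half_space/=.
have : 2 * r <= height z.
  by rewrite -(@ler_sqr _) ?nnegrE ?mulr_ge0 ?ltW// exprMn; nra.
by have := cube_height N0 xr; rewrite ler_distl => /andP[+ _]; lra.
Qed.

Lemma block_cylinder i e : (i <= n)%N -> block (h i) e -> cylinder T e.
Proof.
move=> ni [ei /=]; rewrite in_itv/= => /andP[e1 e2].
have [hz hiT] := small_scale ni; split; first exact: cube_half_space ei.
by apply/andP; split; [have := sqr_ge0 (h i); lra|exact: lt_trans hiT].
Qed.

Lemma duhamel_kernel_tower i e e' : (i <= n)%N -> block (h i) e -> tower i e' ->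
  cube_const N * h i `^ (- N%:R) <= duhamel_kernel T (e, e').
Proof.
move=> ni ei e'i; have [hz hiT] := small_scale ni.
have /andP[t1 t2] := tower_time e'i.
have ce' : cylinder T e'.
  split; first exact: (@cube_half_space (h i)) (tower_space e'i).
  by apply/andP; split => //; have := sqr_ge0 (h i); lra.
have ce := block_cylinder ni ei.
move: (ei) => [eh /=]; rewrite in_itv/= => /andP[e1 e2].
rewrite /duhamel_kernel indicE mem_set ?mul1r//=; last first.
  by split => //=; have := sqr_ge0 (h i); lra.
apply: (@dirichlet_kernel_cube _ _ z) => //; first exact: tower_space.
by apply/andP; split; lra.
Qed.

Context (w : E -> \bar R) (mw : measurable_fun setT w).

(** A point of block i receives both the initial mass of the smallest cube and all of [w^p] in the
    tower, each through a kernel of size at least [cube_const N] times h_i^-N. *)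
Lemma lower_bound_step k M i e : 0 <= k -> 
  (M%:E <= \int[lebesgue_tuple N]_(x in cube z (h 0)) (f_sing p z x)%:E)%E ->
  (i <= n)%N -> block (h i) e ->
  ((cube_const N * h i `^ (- N%:R))%:E *
     ((k * M)%:E + \int[space_time N]_(e' in tower i) w e' `^ p) <=
   k%:E * initial_potential p z T e + power_op (space_time N) p (duhamel_kernel T) w e)%E.
Proof.
move=> k0 hM ni ei; have [hz hiT] := small_scale ni.
have c0 : 0 <= cube_const N * h i `^ (- N%:R).
  by rewrite mulr_ge0 ?powR_ge0// ltW// cube_const_gt0.
have wp0 e' : (0 <= w e' `^ p)%E by exact: poweR_ge0.
have mwp : measurable_fun setT (fun e' => w e' `^ p)%E.
  exact: (measurableT_comp (@measurable_poweR R p)).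
have ce := block_cylinder ni ei.
rewrite muleDr ?fin_num_adde_defr ?fin_num_adde_defl//.
apply: leeD.
- rewrite (EFinM k M) muleCA lee_wpmul2l ?lee_fin//.
  apply: (@le_trans _ _ (\int[lebesgue_tuple N]_(x in cube z (h 0))
     ((cube_const N * h i `^ (- N%:R))%:E * (f_sing p z x)%:E))%E).
    rewrite ge0_integralZl_EFin//; last 3 first.
    + exact: measurable_cube.
    + by move=> x _; rewrite lee_fin f_sing_ge0.
    + by apply/measurable_EFinP/measurable_funTS; exact: measurable_f_sing.
    by rewrite lee_wpmul2l ?lee_fin.
  rewrite integral_mkcond; apply: ge0_le_integral => //.
  + move=> x _; rewrite patchE; case: ifPn => // _.
    by rewrite mule_ge0 ?lee_fin// f_sing_ge0.
  + have mC := @measurable_cube R N z (h 0).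
    apply/(measurable_restrictT _ mC); apply: measurable_funTS.
    apply: emeasurable_funM => //; apply/measurable_EFinP; exact: measurable_f_sing.
  + apply/measurable_EFinP; apply: measurable_funM.
      apply: measurable_funM => //; apply: measurable_indic.
      exact: measurable_half_space.
    by apply: measurable_funM; [exact: measurable_dirichlet_kernel|exact: measurable_f_sing].
  + move=> x _; rewrite patchE; case: ifPn => [/set_mem xh|_]; last first.
      by rewrite lee_fin initial_potential_integrand_ge0.
    have xi : cube z (h i) x by apply: sub_cube xh; exact: scale_homo.
    have hx := cube_half_space (h0 i) hz xi.
    rewrite -EFinM lee_fin !indicE !mem_set// !mul1r.
    rewrite ler_wpM2r ?f_sing_ge0//.
    move: ei => [ei1 /=]; rewrite in_itv/= => /andP[e1 e2].
    apply: (@dirichlet_kernel_cube _ _ z) => //.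
    by have := sqr_ge0 (h i) => ?; apply/andP; split; lra.
- rewrite -ge0_integralZl_EFin//; last 2 first.
  + exact: measurable_tower.
  + exact: measurable_funTS.
  rewrite integral_mkcond; apply: ge0_le_integral => //.
  + move=> e' _; rewrite patchE; case: ifPn => // _.
    by rewrite mule_ge0.
  + have mC := measurable_tower i.
    apply/(measurable_restrictT _ mC); apply: measurable_funTS.
    by apply: emeasurable_funM.
  + by apply: measurable_power_op_integrand => //; exact: measurable_duhamel_kernel.
  + move=> e' _; rewrite patchE; case: ifPn => [/set_mem e'i|_]; last first.
      by rewrite mule_ge0// lee_fin duhamel_kernel_ge0.
    by rewrite lee_wpmul2r// lee_fin duhamel_kernel_tower.
Qed.

End lower_bound.

(** * The recursion for the accumulated mass *)

Section recursion.
Context {R : realType} (N : nat) (N0 : (0 < N)%N) (p : R) (p0 : 0 < p).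
Context (z : euclidean R N) (T : R) (z0 : 0 < height z).
Local Notation E := (euclidean R N * measurableTypeR R)%type.
Context (k : R) (k0 : 0 <= k) (H : R) (H0 : 0 < H).
Context (Hz : 8 * H ^+ 2 <= height z ^+ 2) (HT : 2 * H ^+ 2 < T).

(** [cube_const] is raised to the power p with the pointwise bound, and 2^N comes from the volume
    (2h)^N h^2 of a block; the remaining powers of h combine to h^(N+2-Np). *)
Definition recursion_const : R := cube_const N `^ p * 2 ^+ N.

Lemma recursion_const_gt0 : 0 < recursion_const.
Proof. by rewrite mulr_gt0 ?exprn_gt0// powR_gt0// cube_const_gt0. Qed.

(** A block has positive measure, so it is not contained in the exceptional null set. The point is
    used to evaluate the supersolution inequality where [w] is finite. *)
Lemma ae_block (P : E -> Prop) : {ae space_time N, forall e, P e} ->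
  exists2 e, block z H e & P e.
Proof.
move=> [A [mA A0 PA]]; apply: contrapT => /forall2NP nP.
have mb := measurable_block z H.
have /(le_measure (space_time N)) : block z H `<=` A.
  by move=> e be; apply: PA => /= Pe; case: (nP e).
rewrite !inE => /(_ mb mA); rewrite [leRHS]A0 [leLHS](space_time_block z H0) lee_fin.
by rewrite leNgt mulr_gt0 ?exprn_gt0// mulr_gt0.
Qed.

(** [X i] is [k * M] plus the integral of [w^p] over the tower of height i. The lower bound for [w]
    holds almost everywhere on block i; integrating its p-th power gives the increment. The bound
    [C] comes from one good point in the block of the fixed size [H], chosen before [n] and [M]. *)
Lemma recursion : supersolvable p z k T -> exists C : R, forall n M, 0 <= M ->
  (M%:E <= \int[lebesgue_tuple N]_(x in cube z (H / 2 ^+ n)) (f_sing p z x)%:E)%E ->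
  exists X : nat -> R, [/\ X 0%N = k * M, forall i, (i < n)%N -> X i +
      recursion_const * X i `^ p *
        (H * 2 ^+ i / 2 ^+ n) `^ (N%:R + 2 - N%:R * p) <= X i.+1,
    X n <= C & forall i, (i <= n)%N -> 0 <= X i].
Proof.
move=> [w [mw w0 wfin wsup]].
have [e eb [efin esup]] := ae_block (filterI wfin wsup).
have c0 : 0 < cube_const N * H `^ (- N%:R).
  by rewrite mulr_gt0 ?powR_gt0// cube_const_gt0.
exists (fine (w e) / (cube_const N * H `^ (- N%:R))) => n M M0 hM.
pose h i := H * 2 ^+ i / 2 ^+ n.
have h0 i : 0 < h i by rewrite divr_gt0 ?mulr_gt0 ?exprn_gt0.
have hS i : h i.+1 = 2 * h i by rewrite /h exprS; ring.
have hn : h n = H by rewrite /h mulfK// expf_neq0.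
have hM' : (M%:E <= \int[lebesgue_tuple N]_(x in cube z (h 0%N)) (f_sing p z x)%:E)%E.
  by rewrite /h expr0 mulr1.
have hz : 8 * h n ^+ 2 <= height z ^+ 2 by rewrite hn.
have hT : 2 * h n ^+ 2 < T by rewrite hn.
have step := lower_bound_step N0 z0 h0 hS hz hT mw k0 hM'.
have wp0 e' : (0 <= w e' `^ p)%E by exact: poweR_ge0.
have mwp : measurable_fun setT (fun e' => w e' `^ p)%E.
  exact: (measurableT_comp (@measurable_poweR R p)).
pose Y i := (\int[space_time N]_(e' in tower z h i) w e' `^ p)%E.
have Y0 i : (0 <= Y i)%E by exact: integral_ge0.
have YS i : Y i.+1 = (Y i + \int[space_time N]_(e' in block z (h i)) w e' `^ p)%E.
  rewrite /Y /tower big_ord_recr/= ge0_integral_setU//.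
  - exact: measurable_tower.
  - exact: measurable_block.
  - exact: measurable_funTS.
  - by rewrite disj_set2E; apply/eqP; exact: tower_disjoint.
have Yle i j : (i <= j)%N -> (Y i <= Y j)%E.
  by move: i j; apply/nondecreasing_seqP => i; rewrite YS leeDl// integral_ge0.
have Yn : ((k * M)%:E + Y n <= (fine (w e) / (cube_const N * H `^ (- N%:R)))%:E)%E.
  rewrite (EFinM (fine _)) fineK// lee_pdivlMr// muleC.
  apply: le_trans esup; have := step n e (leqnn n); rewrite hn; exact.
(* The bound on [Y n] makes all earlier integrals finite, without which [fine] would lose
   information. *)
have Yfin i : (i <= n)%N -> Y i \is a fin_num.
  move=> /Yle iN; rewrite ge0_fin_numE//; apply: le_lt_trans iN _.
  rewrite -(@lteD2lE _ (k * M)%:E)//.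
  by apply: le_lt_trans Yn _; rewrite addey// ltry.
exists (fun i => k * M + fine (Y i)); split.
- by rewrite /Y /tower big_ord0 integral_set0 addr0.
- move=> i ni; have Xi0 : 0 <= k * M + fine (Y i).
    by rewrite addr_ge0 ?mulr_ge0// fine_ge0.
  rewrite -addrA lerD2l -lee_fin EFinD !fineK ?Yfin//; last exact: ltnW.
  rewrite YS leeD2l//.
  set c := (cube_const N * h i `^ (- N%:R)) * (k * M + fine (Y i)).
  have ci0 : 0 <= c by rewrite !mulr_ge0 ?powR_ge0// ltW// cube_const_gt0.
  have mb := measurable_block z (h i).
  apply: (@le_trans _ _ (\int[space_time N]_(e' in block z (h i)) (c `^ p)%:E)%E).
    rewrite integral_cst// (_ : (_ * _)%E =
      (c `^ p * ((2 * h i) ^+ N * h i ^+ 2))%:E); last first.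
      by rewrite EFinM; congr (_ * _)%E; exact: (space_time_block z (h0 i)).
    rewrite lee_fin /c -/(h i).
    rewrite powRM// ?mulr_ge0 ?powR_ge0// ?(ltW (cube_const_gt0 _))//.
    rewrite powRM// ?powR_ge0// ?(ltW (cube_const_gt0 _))//.
    rewrite /recursion_const exprMn -powRrM powRD; last first.
      by rewrite (gt_eqF (h0 i)) implybT.
    rewrite powRD; last by rewrite (gt_eqF (h0 i)) implybT.
    rewrite !powR_mulrn ?(ltW (h0 i))// mulNr.
    by rewrite le_eqVlt; apply/orP; left; apply/eqP; ring.
  apply: ae_ge0_le_integral => //.
  + by move=> x _; rewrite lee_fin powR_ge0.
  + exact: measurable_funTS.
  apply: filterS wsup => e' e'sup e'b; rewrite -poweR_EFin.
  apply: le_poweR2r; [exact: ltW|by rewrite lee_fin|].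
  apply: le_trans e'sup; rewrite EFinM EFinD fineK; last exact/Yfin/ltnW.
  by apply: step => //; exact: ltnW.
- by rewrite -lee_fin EFinD fineK// Yfin.
- by move=> i _; rewrite addr_ge0 ?mulr_ge0// fine_ge0.
Qed.

End recursion.

Lemma ler_powRN (R : realType) (a b q : R) :
  0 < a -> a <= b -> 0 <= q -> b `^ (- q) <= a `^ (- q).
Proof.
move=> a0 ab q0; have b0 := lt_le_trans a0 ab.
rewrite !powRN lef_pV2 ?posrE ?powR_gt0//.
by rewrite ge0_ler_powR// nnegrE ltW.
Qed.

(** * Mass of f_z on small cubes *)

Section mass.
Context {R : realType} (N : nat) (N0 : (0 < N)%N) (p : R) (z : euclidean R N).

Definition shell h := cube z h `\` cube z (h / 2).

Lemma measurable_shell h : measurable (shell h).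
Proof. by apply: measurableD; exact: measurable_cube. Qed.

(** The volume of the shell is (2h)^N - h^N, which is at least h^N because N >= 1. The subtraction
    is done on an arbitrary extended real [v], so finiteness need not be known beforehand. *)
Lemma shell_mass h c : 0 < h -> 0 <= c ->
  (forall x, shell h x -> c <= f_sing p z x) ->
  ((c * h ^+ N)%:E <= \int[lebesgue_tuple N]_(x in shell h) (f_sing p z x)%:E)%E.
Proof.
move=> h0 c0 cf.
apply: (@le_trans _ _ (\int[lebesgue_tuple N]_(x in shell h) c%:E)%E); last first.
  apply: ge0_le_integral => //; first exact: measurable_shell.
  by apply/measurable_EFinP/measurable_funTS; exact: measurable_f_sing.
rewrite integral_cst//; last exact: measurable_shell.
rewrite EFinM lee_wpmul2l ?lee_fin//.
have sub : cube z (h / 2) `<=` cube z h by apply: sub_cube; lra.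
have : (lebesgue_tuple N (cube z h) = lebesgue_tuple N (cube z (h / 2)) +
    lebesgue_tuple N (shell h))%E.
  rewrite -measureU.
  - by congr (_ _); rewrite /shell setDUK.
  - exact: measurable_cube.
  - exact: measurable_shell.
  - by rewrite /shell setDIK.
rewrite !lebesgue_cube; [|lra|lra].
have -> : 2 * (h / 2) = h by field.
suff key (v : \bar R) : (((2 * h) ^+ N)%:E = (h ^+ N)%:E + v -> (h ^+ N)%:E <= v)%E.
  exact: key.
case: v => [s| |]//= [hs].
rewrite lee_fin.
have : 2 * h ^+ N <= (2 * h) ^+ N.
  rewrite exprMn ler_wpM2r ?exprn_ge0 ?(ltW h0)//.
  by rewrite -[leLHS]expr1 ler_eXn2l// ltr1n.
by rewrite hs; lra.
Qed.

(** The [m] dyadic shells are disjoint parts of the cube. A single one will do above the critical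
    exponent; at it, the number of shells gains a factor over the mass of each. *)
Lemma cube_mass_shells h b m : 0 < h ->
  (forall j, (j < m)%N ->
    (b%:E <= \int[lebesgue_tuple N]_(x in shell (h / 2 ^+ j)) (f_sing p z x)%:E)%E) ->
  ((m%:R * b)%:E <= \int[lebesgue_tuple N]_(x in cube z h) (f_sing p z x)%:E)%E.
Proof.
elim: m h => [|m IH] h h0 hb.
  by rewrite mul0r integral_ge0// => x _; rewrite lee_fin f_sing_ge0.
have sub : cube z (h / 2) `<=` cube z h by apply: sub_cube; lra.
rewrite -(setDUK sub) ge0_integral_setU//.
- rewrite -natr1 mulrDl mul1r EFinD; apply: leeD; last first.
    by have := hb 0%N isT; rewrite expr0 divr1.
  apply: IH; first by rewrite divr_gt0.
  move=> j jm; have := hb j.+1 jm.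
  by rewrite exprS invfM mulrA.
- exact: measurable_cube.
- exact: measurable_shell.
- by apply/measurable_EFinP/measurable_funTS; exact: measurable_f_sing.
- by move=> x _; rewrite lee_fin f_sing_ge0.
- by rewrite disj_set2E setDIK.
Qed.

Context (h : R) (h0 : 0 < h) (hN : N%:R * h < 2^-1) (z0 : 0 < height z)
  (hz : 8 * h ^+ 2 <= height z ^+ 2).

Lemma shell_radius x : shell h x ->
  [/\ h / 2 < enorm (esub x z), enorm (esub x z) <= N%:R * h,
      ball_half_space z 1 x & ball_half_space z 2^-1 x].
Proof.
move=> [xh /enorm_not_cube xh2]; have xN := enorm_cube N0 (ltW h0) xh.
have hx : closed_half_space x by apply: ltW; exact: (cube_half_space N0 z0 h0 hz xh).
split => //; split => //; rewrite /=; move: hN; lra.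
Qed.

(** The outermost shell already has mass of the right order: there |x-z| <= N h, so f_z is at least
    (N h)^(-2/(p-1)), on a volume of at least h^N. *)
Lemma cube_mass_supercritical : critical_exponent N < p -> 1 < p ->
  ((N%:R `^ (- (2 / (p - 1))) * h `^ (N%:R - 2 / (p - 1)))%:E <=
   \int[lebesgue_tuple N]_(x in cube z h) (f_sing p z x)%:E)%E.
Proof.
move=> pN p1.
have -> : N%:R `^ (- (2 / (p - 1))) * h `^ (N%:R - 2 / (p - 1)) =
    (N%:R * h) `^ (- (2 / (p - 1))) * h ^+ N.
  rewrite powRM ?ler0n ?(ltW h0)// -mulrA -powR_mulrn ?(ltW h0)// -powRD ?(gt_eqF h0) ?implybT//.
  by congr (_ * _ `^ _); rewrite [LHS]addrC.
have := @cube_mass_shells h ((N%:R * h) `^ (- (2 / (p - 1))) * h ^+ N) 1 h0.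
rewrite mul1r; apply => -[|//] _.
rewrite expr0 divr1; apply: shell_mass => //; first exact: powR_ge0.
move=> x /shell_radius[r1 r2 b1 _].
rewrite /f_sing pN indicE mem_set// mulr1.
by apply: ler_powRN => //; [by move: h0; lra|rewrite divr_ge0// subr_ge0 ltW].
Qed.

(** The volume h^N cancels the lower bound (N h)^-N of |x-z|^-N, so that only the logarithm remains.
    It is bounded at [h / 2], which every |x-z| in the shell exceeds. *)
Lemma shell_mass_critical : critical_exponent N = p ->
  ((N%:R `^ (- N%:R) * (- ln (h / 2)) `^ (- (N%:R / 2 + 1)))%:E <=
   \int[lebesgue_tuple N]_(x in shell h) (f_sing p z x)%:E)%E.
Proof.
move=> pN.
have -> : N%:R `^ (- N%:R) * (- ln (h / 2)) `^ (- (N%:R / 2 + 1)) =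
    (N%:R * h) `^ (- N%:R) * (- ln (h / 2)) `^ (- (N%:R / 2 + 1)) * h ^+ N.
  have hh : h `^ (- N%:R) * h ^+ N = 1.
    rewrite -powR_mulrn ?(ltW h0)// -powRD ?(gt_eqF h0) ?implybT//.
    by rewrite addNr powRr0.
  rewrite powRM ?ler0n ?(ltW h0)// [RHS]mulrAC -[in RHS](mulrA _ (h `^ _)) hh.
  by rewrite mulr1.
apply: shell_mass => //; first by rewrite mulr_ge0 ?powR_ge0.
move=> x /shell_radius[r1 r2 _ [b1 b2]].
have r0 : 0 < enorm (esub x z) by move: h0; lra.
rewrite /f_sing pN ltxx indicE mem_set// mulr1 -opprD.
have {}b1 : enorm (esub x z) < 2^-1 := b1.
have lr : ln (enorm (esub x z)) < 0 by apply: ln_lt0; rewrite r0; lra.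
apply: ler_pM; rewrite ?powR_ge0//.
  by apply: ler_powRN => //; rewrite ler0n.
rewrite ltr0_norm//; apply: ler_powRN; first by rewrite oppr_gt0.
  by rewrite lerN2 ler_ln ?posrE//; move: h0; lra.
by rewrite addr_ge0// divr_ge0.
Qed.

End mass.

(** * Geometric growth above the doubling threshold *)

Section numeric_recursion.
Context {R : realType} (c p th : R) (c0 : 0 < c) (p1 : 1 < p).
Context (h X : nat -> R) (n : nat).
Hypotheses (h0 : forall i, 0 < h i) (hS : forall i, h i.+1 = 2 * h i).
Hypothesis X0 : forall i, (i <= n)%N -> 0 <= X i.
Hypothesis XS : forall i, (i < n)%N ->
  X i + c * X i `^ p * h i `^ (- th) <= X i.+1.

(** Above the critical exponent [th] will be Np - N - 2, and [e] is then N - 2/(p-1), the exponent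
    of the mass of f_z on a cube: [b] is the quantity invariant under the scaling of the equation.
    At the critical exponent [th] is 0 and [b] is [X]. *)
Let e := th / (p - 1).
Let b i := X i * h i `^ (- e).

(** In terms of [b] the recursion reads b_(i+1) >= 2^-e (b_i + c b_i^p). When c b_i^(p-1) >= 2^(1+e)
    the second term alone is at least 2 b_i, and the condition persists because [b] has grown. *)
Lemma scaled_doubling m j : (m + j <= n)%N -> 0 < X m ->
  2 `^ (1 + e) <= c * b m `^ (p - 1) -> 2 ^+ j * b m <= b (m + j)%N.
Proof.
move=> + Xm bm; have bm0 : 0 < b m by rewrite mulr_gt0// powR_gt0.
have q0 : 0 < p - 1 by rewrite subr_gt0.
elim: j => [|j IH] mjn; first by rewrite expr0 mul1r addn0.
rewrite addnS in mjn *; have {}IH := IH (ltnW mjn).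
set i := (m + j)%N in mjn IH *.
have bi : b m <= b i.
  by apply: le_trans IH; rewrite ler_peMl ?(ltW bm0)// exprn_ege1// ler1n.
have bi0 := lt_le_trans bm0 bi.
have cbi : 2 `^ (1 + e) <= c * b i `^ (p - 1).
  apply: le_trans bm _; rewrite ler_wpM2l ?(ltW c0)// ge0_ler_powR ?nnegrE ?(ltW q0)//.
  - exact: ltW.
  - exact: ltW.
have eq1 : X i = b i * h i `^ e.
  by rewrite /b -mulrA -powRD ?(gt_eqF (h0 i)) ?implybT// addNr powRr0 mulr1.
have eq2 : c * X i `^ p * h i `^ (- th) = c * b i `^ (p - 1) * b i * h i `^ e.
  rewrite eq1 powRM ?powR_ge0 ?(ltW bi0)// -powRrM.
  have -> : b i `^ p = b i `^ (p - 1) * b i.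
    rewrite -{3}[b i]powRr1 ?(ltW bi0)// -powRD ?(gt_eqF bi0) ?implybT//.
    by rewrite subrK.
  have <- : h i `^ (e * p) * h i `^ (- th) = h i `^ e.
    rewrite -powRD ?(gt_eqF (h0 i)) ?implybT//; congr (_ `^ _).
    by rewrite /e; field; rewrite gt_eqF.
  by ring.
have hSi : h i.+1 `^ (- e) = 2 `^ (- e) * h i `^ (- e).
  by rewrite hS powRM// ltW.
apply: (@le_trans _ _ (2 * b i)); first by rewrite exprS -mulrA ler_wpM2l.
rewrite {2}/b.
apply: (@le_trans _ _ ((X i + c * X i `^ p * h i `^ (- th)) * h i.+1 `^ (- e)));
  last first.
  by rewrite ler_wpM2r ?powR_ge0// XS.
rewrite eq2 {1}eq1 hSi.
have hh : h i `^ e * h i `^ (- e) = 1.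
  by rewrite -powRD ?(gt_eqF (h0 i)) ?implybT// subrr powRr0.
have -> : (b i * h i `^ e + c * b i `^ (p - 1) * b i * h i `^ e) *
    (2 `^ (- e) * h i `^ (- e)) =
  (2 `^ (- e) * b i + (2 `^ (- e) * (c * b i `^ (p - 1))) * b i) * (h i `^ e * h i `^ (- e)) by ring.
rewrite hh mulr1.
have : 2 <= 2 `^ (- e) * (c * b i `^ (p - 1)).
  apply: (@le_trans _ _ (2 `^ (- e) * 2 `^ (1 + e))); last by rewrite ler_wpM2l ?powR_ge0.
  by rewrite -powRD ?pnatr_eq0 ?implybT// addrCA addNr addr0 powRr1.
have : 0 <= 2 `^ (- e) * b i by rewrite mulr_ge0 ?powR_ge0// ltW.
by move=> ? ?; nra.
Qed.

End numeric_recursion.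

(** * Growth below the doubling threshold *)

Section critical_recursion.
Context {R : realType} (c p : R) (c0 : 0 < c) (p1 : 1 < p).
Let q := p - 1.

(* With y = c x^q < 2 one step multiplies x^-q by
   (1 + y)^-q <= exp (- q y / 3) <= (1 + q y / 3)^-1, and x^-q y = c. *)
Lemma inverse_power_step (x : R) : 0 < x -> c * x `^ q < 2 ->
  (x + c * x `^ p) `^ (- q) + c * q / (3 + 2 * q) <= x `^ (- q).
Proof.
move=> x0 y2; set y := c * x `^ q in y2.
have q0 : 0 < q by rewrite subr_gt0.
have y0 : 0 < y by rewrite mulr_gt0// powR_gt0.
have -> : x + c * x `^ p = x * (1 + y).
  have -> : x `^ p = x * x `^ q.
    rewrite -{2}[x]powRr1 ?(ltW x0)// -powRD ?(gt_eqF x0) ?implybT//.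
    by rewrite /q addrC subrK.
  by rewrite /y; ring.
(* 1/(1 - y/3) bounds the exponential, and (1 + y)(1 - y/3) = 1 + y(2 - y)/3 is at least 1 as long
   as y is between 0 and 2. *)
have ey : expR (y / 3) <= 1 + y.
  have h1 : 0 < 1 - y / 3 by lra.
  have h2 : 1 - y / 3 <= expR (- (y / 3)) by have := expR_ge1Dx (- (y / 3)).
  have h3 : expR (y / 3) * (1 - y / 3) <= 1.
    apply: (@le_trans _ _ (expR (y / 3) * expR (- (y / 3)))).
      by rewrite ler_wpM2l ?expR_ge0.
    by rewrite -expRD subrr expR0.
  have h4 : 1 <= (1 + y) * (1 - y / 3) by nra.
  by rewrite -(ler_pM2r h1); lra.
have h5 : (1 + y) `^ (- q) <= (1 + q * y / 3)^-1.
  apply: (@le_trans _ _ (expR (y / 3) `^ (- q))).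
    by apply: ler_powRN; rewrite ?expR_gt0// ltW.
  rewrite powRN lef_pV2 ?posrE ?powR_gt0 ?expR_gt0//; last first.
    by rewrite ltr_wpDl// divr_gt0// mulr_gt0.
  rewrite -expRM (_ : y / 3 * q = q * y / 3); last by field.
  exact: expR_ge1Dx.
have xq : x `^ (- q) * y = c.
  by rewrite /y mulrCA -powRD ?(gt_eqF x0) ?implybT// addNr powRr0 mulr1.
rewrite powRM ?(ltW x0)//; last by lra.
(* The left side equals 1 - qy/(3 + qy), and y < 2 bounds the denominator by 3 + 2q. *)
have h6 : (1 + q * y / 3)^-1 <= 1 - y * (q / (3 + 2 * q)).
  have qy : 0 < q * y by rewrite mulr_gt0.
  have d0 : 0 < 1 + q * y / 3 by lra.
  rewrite -(ler_pM2r d0) mulVf ?gt_eqF//.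
  have -> : (1 - y * (q / (3 + 2 * q))) * (1 + q * y / 3) =
    1 + q * y * q * (2 - y) / (3 * (3 + 2 * q)) by field; rewrite gt_eqF//; lra.
  rewrite lerDl divr_ge0//; last by lra.
  by apply: mulr_ge0; [exact: ltW (mulr_gt0 qy q0)|lra].
have : x `^ (- q) * (1 + y) `^ (- q) <= x `^ (- q) * (1 - y * (q / (3 + 2 * q))).
  by rewrite ler_wpM2l ?powR_ge0// (le_trans h5).
have -> : x `^ (- q) * (1 - y * (q / (3 + 2 * q))) =
  x `^ (- q) - x `^ (- q) * y * q / (3 + 2 * q) by ring.
by rewrite xq; lra.
Qed.

Context (X : nat -> R) (n : nat) (X0 : 0 < X 0%N).
Hypothesis XS : forall i, (i < n)%N -> X i + c * X i `^ p <= X i.+1.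

(** A discrete form of X' = c X^p: below the threshold, X^-q loses a fixed amount at each step, and
    being positive it can do so only a number of times proportional to X_0^-q. The value 2 is the
    condition of [scaled_doubling] for e = 0. *)
Lemma threshold m : (m <= n)%N ->
  (exists2 j, (j <= m)%N & 0 < X j /\ 2 <= c * X j `^ q) \/
  (0 < X m /\ X m `^ (- q) + m%:R * (c * q / (3 + 2 * q)) <= X 0%N `^ (- q)).
Proof.
have q0 : 0 < q by rewrite subr_gt0.
elim: m => [|m IH] mn; first by right; split => //; rewrite mul0r addr0.
have [[j jm hj]|[Xm hm]] := IH (ltnW mn); first by left; exists j => //; exact: ltnW.
have [h2|h2] := leP 2 (c * X m `^ q); first by left; exists m.
right; have cX : 0 < X m + c * X m `^ p.
  by rewrite ltr_wpDr// mulr_ge0 ?powR_ge0// ltW.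
have XmS := XS mn; split; first exact: lt_le_trans XmS.
have := inverse_power_step Xm h2; rewrite -/q.
have : X m.+1 `^ (- q) <= (X m + c * X m `^ p) `^ (- q).
  by apply: ler_powRN => //; exact: ltW.
have -> : m.+1%:R = m%:R + 1 :> R by rewrite natr1.
by move: (c * q / _) hm => D hm ? ?; rewrite mulrDl mul1r; lra.
Qed.

End critical_recursion.

(** * Nonexistence for large constants, uniformly in z *)

Section nonexistence.
Context {R : realType} (N : nat) (N0 : (0 < N)%N) (p : R).

Lemma unbounded_pow2 (a C : R) : 0 < a -> (forall n, 2 ^+ n * a <= C) -> False.
Proof.
move=> a0 aC; have := archi_boundP (normr_ge0 (C / a)).
set n := Num.bound _ => hn; have := aC n.
rewrite -ler_pdivlMr//; apply/negP; rewrite -ltNge.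
apply: le_lt_trans (ler_norm _) _; apply: lt_trans hn _.
by rewrite -natrX ltr_nat ltn_expl.
Qed.

Lemma small_pow2 (d : R) : 0 < d -> exists n0 : nat, (2 ^+ n0)^-1 < d.
Proof.
move=> d0; apply: contrapT => /forallNP hd.
apply: (@unbounded_pow2 d 1 d0) => n.
have /negP := hd n; rewrite -leNgt => hn.
by rewrite mulrC -ler_pdivlMr ?exprn_gt0// mul1r.
Qed.

Lemma critical_exponent_gt1 : 1 < critical_exponent N :> R.
Proof. by rewrite ltrDl divr_gt0// ltr0n. Qed.

(** [z] and [T] influence this top scale only, never the thresholds [ks]. A power of 2 is taken so
    that the logarithms of all smaller scales are integer multiples of ln 2. *)
Lemma base_scale (z : euclidean R N) T : 0 < height z -> 0 < T ->
  exists n0 : nat, let H := (2 ^+ n0)^-1 : R in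
    [/\ N%:R * H < 2^-1, 8 * H ^+ 2 <= height z ^+ 2 & 2 * H ^+ 2 < T].
Proof.
move=> z0 T0; have N0' : 0 < N%:R :> R by rewrite ltr0n.
have [n0] := @small_pow2
  (Num.min (2^-1 / N%:R) (Num.min (height z / 3) (Num.min 1 (T / 2))))
  ltac:(by rewrite !lt_min ?divr_gt0//=; lra).
set H := (_ ^-1); rewrite !lt_min => /and4P[h1 h2 h3 h4].
have H0 : 0 < H by rewrite invr_gt0 exprn_gt0.
exists n0; rewrite /= -/H; clearbody H; split.
- by rewrite mulrC -ltr_pdivlMr.
- have : H ^+ 2 <= (height z / 3) ^+ 2 by rewrite ler_sqr ?nnegrE ?divr_ge0 ?ltW.
  have -> : (height z / 3) ^+ 2 = height z ^+ 2 / 9 by field.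
  by have := sqr_ge0 (height z); lra.
- have : H ^+ 2 <= H by rewrite expr2 ler_piMr ?ltW.
  by lra.
Qed.

Lemma subscale (H : R) n : 0 < H -> 0 < H / 2 ^+ n <= H.
Proof.
move=> H0; apply/andP; split; first by rewrite divr_gt0 ?exprn_gt0.
by rewrite ler_pdivrMr ?exprn_gt0// ler_peMr ?(ltW H0)// exprn_ege1// ler1n.
Qed.

Lemma small_subscale (z : euclidean R N) (H : R) n : 0 < H -> N%:R * H < 2^-1 ->
  8 * H ^+ 2 <= height z ^+ 2 ->
  N%:R * (H / 2 ^+ n) < 2^-1 /\ 8 * (H / 2 ^+ n) ^+ 2 <= height z ^+ 2.
Proof.
move=> H0 HN Hz; have /andP[a1 a2] := subscale n H0; split.
  by apply: le_lt_trans HN; rewrite ler_wpM2l.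
apply: le_trans Hz; rewrite ler_wpM2l// ler_sqr// nnegrE ltW//.
Qed.

(** The mass estimate makes the rescaled initial value exactly [k * c0], for every n. [ks] is the
    value of k at which it meets the doubling condition; beyond it the rescaled [X n] is at least
    2^n k c0, although [X n] stays below [C] at the fixed scale [H]. *)
Lemma nonexistence_supercritical : critical_exponent N < p ->
  exists2 ks : R, 0 < ks & forall (z : euclidean R N) k T, 0 < height z ->
    ks < k -> 0 < T -> ~ supersolvable p z k T.
Proof.
move=> pN; have p1 := lt_trans critical_exponent_gt1 pN.
have q0 : 0 < p - 1 by rewrite subr_gt0.
have N0' : 0 < N%:R :> R by rewrite ltr0n.
pose th := N%:R * p - N%:R - 2 : R.
pose e := th / (p - 1).
pose c0 := N%:R `^ (- (2 / (p - 1))) : R.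
have c00 : 0 < c0 by rewrite powR_gt0.
have rc := @recursion_const_gt0 R N p.
pose ks := (2 `^ (1 + e) / recursion_const N p) `^ (p - 1)^-1 / c0.
have ks0 : 0 < ks by rewrite divr_gt0// powR_gt0// divr_gt0// powR_gt0.
exists ks => // z k T z0 kks T0 sup.
have k0 := lt_trans ks0 kks.
have [n0 /= [HN Hz HT]] := base_scale z0 T0.
set H := (_^-1) in HN Hz HT; have H0 : 0 < H by rewrite invr_gt0 exprn_gt0.
have [C hC] := recursion N0 (lt_trans ltr01 p1) z0 (ltW k0) H0 Hz HT sup.
have he : N%:R - 2 / (p - 1) = e by rewrite /e /th; field; rewrite gt_eqF.
apply: (@unbounded_pow2 (k * c0) (C * H `^ (- e))); first exact: mulr_gt0.
move=> n; have /andP[h0 _] := subscale n H0.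
have [hN hz] := small_subscale n H0 HN Hz.
have := hC n _ _ (cube_mass_supercritical N0 h0 hN z0 hz pN p1).
case; first by rewrite mulr_ge0 ?powR_ge0.
rewrite he -/c0 => X [X0 XS Xn Xge].
pose h i := H * 2 ^+ i / 2 ^+ n.
have hi0 i : 0 < h i by rewrite divr_gt0 ?mulr_gt0 ?exprn_gt0.
have hS i : h i.+1 = 2 * h i by rewrite /h exprS; ring.
have hn : h n = H by rewrite /h mulfK// expf_neq0.
have h0E : h 0%N = H / 2 ^+ n by rewrite /h expr0 mulr1.
have XS' i : (i < n)%N -> X i + recursion_const N p * X i `^ p * h i `^ (- th) <= X i.+1.
  move=> /XS; have -> : N%:R + 2 - N%:R * p = - th by rewrite /th; ring.
  exact.
have b0 : X 0%N * h 0%N `^ (- e) = k * c0.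
  rewrite X0 h0E -!mulrA -powRD ?(gt_eqF h0) ?implybT//.
  by rewrite subrr powRr0 mulr1.
have := @scaled_doubling _ _ _ _ rc p1 h X n hi0 hS XS' 0%N n (leqnn n).
rewrite -/e add0n hn b0 => /(_ _ _)/le_trans; apply.
- by rewrite X0 mulr_gt0// mulr_gt0// powR_gt0.
- rewrite -ler_pdivrMl// mulrC.
  have -> : 2 `^ (1 + e) / recursion_const N p = (ks * c0) `^ (p - 1).
    rewrite /ks divfK ?gt_eqF// -powRrM mulVf ?gt_eqF// powRr1//.
    by rewrite divr_ge0 ?powR_ge0 ?ltW.
  apply: ge0_ler_powR; rewrite ?nnegrE; [exact: ltW|exact: ltW (mulr_gt0 ks0 c00)|
    exact: ltW (mulr_gt0 k0 c00)|].
  by rewrite ler_wpM2r ?(ltW kks) ?(ltW c00).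
- by rewrite ler_wpM2r ?powR_ge0.
Qed.

(** Adding n shells of mass of order n^(-N/2-1) gives an initial mass of order n^(-N/2). Since
    (N/2)(p-1) = 1, the power -(p-1) of [X 0] is (k c0)^(-(p-1)) n, linear in n. For k > ks it is at
    most (n/2) c3, which the first n/2 steps would use up; so the threshold is reached by then, and
    at least n/2 doublings are left. *)
Lemma nonexistence_critical : critical_exponent N = p ->
  exists2 ks : R, 0 < ks & forall (z : euclidean R N) k T, 0 < height z ->
    ks < k -> 0 < T -> ~ supersolvable p z k T.
Proof.
move=> pN; have p1 : 1 < p by rewrite -pN critical_exponent_gt1.
have q0 : 0 < p - 1 by rewrite subr_gt0.
have N0' : 0 < N%:R :> R by rewrite ltr0n.
have Nq : N%:R * (p - 1) = 2.
  by rewrite -pN /critical_exponent; field; rewrite gt_eqF.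
pose s := N%:R / 2 + 1 : R.
have s0 : 0 < s by rewrite ltr_wpDl// divr_ge0.
pose c0 := N%:R `^ (- N%:R) * 3 `^ (- s) : R.
have c00 : 0 < c0 by rewrite mulr_gt0 ?powR_gt0.
pose c1 := recursion_const N p; have rc : 0 < c1 := @recursion_const_gt0 R N p.
pose c3 := c1 * (p - 1) / (3 + 2 * (p - 1)).
have c30 : 0 < c3 by apply: divr_gt0; [exact: mulr_gt0|lra].
pose ks := (2 / c3) `^ (p - 1)^-1 / c0.
have ks0 : 0 < ks by rewrite divr_gt0// powR_gt0// divr_gt0.
exists ks => // z k T z0 kks T0 sup.
have k0 := lt_trans ks0 kks.
have [n0 /= [HN Hz HT]] := base_scale z0 T0.
set H := (_^-1) in HN Hz HT; have H0 : 0 < H by rewrite invr_gt0 exprn_gt0.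
have [C hC] := recursion N0 (lt_trans ltr01 p1) z0 (ltW k0) H0 Hz HT sup.
(* The value at which doubling sets in: c1 x0^(p-1) = 2. *)
pose x0 := (2 / c1) `^ (p - 1)^-1.
have x00 : 0 < x0 by rewrite powR_gt0// divr_gt0.
apply: (@unbounded_pow2 x0 C) => // m'.
(* [m >= n0] gives n0 + n + j + 1 <= 3n for j < n, which bounds all the logarithms by 3n; [m >= m']
   leaves at least m' doublings after the first m steps. *)
pose m := (maxn m' (maxn n0 1)); pose n := (2 * m)%N.
have m0 : (0 < m)%N by rewrite /m; clear; lia.
have mm : (m' <= m)%N by rewrite /m; clear; lia.
have n0n : (n0 <= n)%N by rewrite /n /m; clear; lia.
have n00 : (0 < n)%N by rewrite /n; move: m0; clear; lia.
have nR0 : 0 < n%:R :> R by rewrite ltr0n.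
have /andP[h0 _] := subscale n H0.
pose b : R := N%:R `^ (- N%:R) * (3 * n%:R) `^ (- s).
have hM : ((n%:R * b)%:E <=
    \int[lebesgue_tuple N]_(x in cube z (H / 2 ^+ n)) (f_sing p z x)%:E)%E.
  apply: (@cube_mass_shells _ N p z _ b n h0) => j jn.
  have /andP[hj0 _] := subscale j h0.
  have [hN hz] := small_subscale n H0 HN Hz.
  have [hjN hjz] := small_subscale j h0 hN hz.
  apply: le_trans (shell_mass_critical N0 hj0 hjN z0 hjz pN).
  rewrite lee_fin ler_wpM2l ?powR_ge0//.
  have hE : H / 2 ^+ n / 2 ^+ j / 2 = (2 ^+ (n0 + n + j).+1)^-1.
    by rewrite exprSr !exprD !invfM /H; ring.
  have lE : - ln (H / 2 ^+ n / 2 ^+ j / 2) = ln 2 *+ (n0 + n + j).+1.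
    by rewrite hE lnV ?posrE ?exprn_gt0// opprK lnXn.
  have l2 : 0 < ln (2 : R) by rewrite ln_gt0// ltr1n.
  have l21 : ln (2 : R) <= 1 by apply: (@le_ln1Dx R 1); lra.
  rewrite lE; apply: ler_powRN; rewrite ?(ltW s0) ?mulrn_wgt0//.
  apply: (@le_trans _ _ ((n0 + n + j).+1%:R)); first by rewrite lerMn2r l21 orbT.
  by rewrite -natrM ler_nat; move: jn n0n; clearbody n; clear; lia.
have [] := hC n _ _ hM; first by rewrite !mulr_ge0 ?powR_ge0.
move=> X [X0 XS Xn Xge].
have X00 : 0 < X 0%N by rewrite X0 !mulr_gt0// powR_gt0// mulr_gt0.
have XS1 i : (i < n)%N -> X i + c1 * X i `^ p <= X i.+1.
  move=> /XS; have -> : N%:R + 2 - N%:R * p = 0.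
    by rewrite -Nq; ring.
  by rewrite powRr0 mulr1.
have X0q : X 0%N `^ (- (p - 1)) = (k * c0) `^ (- (p - 1)) * n%:R.
  have -> : X 0%N = k * c0 * n%:R `^ (- (N%:R / 2)).
    rewrite X0 /b /c0 powRM ?ler0n//.
    have <- : n%:R * n%:R `^ (- s) = n%:R `^ (- (N%:R / 2)).
      rewrite -{1}[n%:R]powRr1 ?ler0n// -powRD ?(gt_eqF nR0) ?implybT//.
      by congr (_ `^ _); rewrite /s; ring.
    by ring.
  rewrite powRM ?powR_ge0 ?mulr_ge0 ?(ltW k0) ?(ltW c00)// -powRrM.
  have -> : - (N%:R / 2) * - (p - 1) = N%:R * (p - 1) / 2 by ring.
  by rewrite Nq divff// powRr1.
have [|[j jm [Xj hj]]|[Xm hm]] := threshold rc p1 X00 XS1 (m := m).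
- by rewrite /n; clearbody m; clear; lia.
(* With exponent 0 the scales disappear from the recursion, so any doubling sequence, here 2^i, can
   stand for them in [scaled_doubling]. *)
- have XS2 i : (i < n)%N -> X i + c1 * X i `^ p * (2 ^+ i) `^ (- 0) <= X i.+1.
    by move=> /XS1; rewrite oppr0 powRr0 mulr1.
  have jn : (j + (n - j) <= n)%N by rewrite subnKC// /n; move: jm; clearbody m; clear; lia.
  have := @scaled_doubling _ _ _ _ rc p1 (fun i => 2 ^+ i) X n _ _ XS2 j (n - j)%N jn Xj.
  rewrite mul0r oppr0 !powRr0 !mulr1 subnKC; last first.
    by rewrite /n; move: jm; clearbody m; clear; lia.
  rewrite addr0 powRr1// => hd.
  apply: le_trans Xn; apply: le_trans (hd _ _ hj); last 2 first.
  + by move=> i; rewrite exprn_gt0.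
  + by move=> i; rewrite exprS.
  apply: ler_pM; rewrite ?exprn_ge0 ?(ltW x00)//.
    by rewrite ler_eXn2l ?ltr1n// /n; move: mm jm; clearbody m; clear; lia.
  have -> : X j = (X j `^ (p - 1)) `^ (p - 1)^-1.
    by rewrite -powRrM mulfV ?gt_eqF// powRr1// ltW.
  apply: ge0_ler_powR; rewrite ?nnegrE ?powR_ge0 ?invr_ge0 ?divr_ge0 ?(ltW q0) ?(ltW rc)//.
  by rewrite ler_pdivrMr// mulrC.
- exfalso; move: hm; rewrite X0q -/c3 => hm.
  have : 0 < X m `^ (- (p - 1)) by rewrite powR_gt0.
  have kq : (k * c0) `^ (- (p - 1)) <= c3 / 2.
    have -> : c3 / 2 = (ks * c0) `^ (- (p - 1)).
      rewrite /ks divfK ?gt_eqF// -powRrM mulrN mulVf ?gt_eqF// powRN powRr1.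
        by rewrite [RHS]invf_div.
      exact: ltW (divr_gt0 _ c30).
    apply: ler_powRN; [exact: mulr_gt0| |exact: ltW].
    by rewrite ler_wpM2r ?(ltW kks) ?(ltW c00).
  have h3 : c3 / 2 * n%:R = m%:R * c3 by rewrite /n natrM; field.
  have : (k * c0) `^ (- (p - 1)) * n%:R <= c3 / 2 * n%:R by rewrite ler_wpM2r.
  rewrite h3 => h4 h5; have := le_trans hm h4.
  by rewrite leNgt ltrDr h5.
Qed.

Lemma nonexistence : critical_exponent N <= p ->
  exists2 ks : R, 0 < ks & forall (z : euclidean R N) k T, 0 < height z ->
    ks < k -> 0 < T -> ~ supersolvable p z k T.
Proof.
rewrite le_eqVlt => /orP[/eqP|].
- exact: nonexistence_critical.
- exact: nonexistence_supercritical.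
Qed.

End nonexistence.

(** * Superpositions of Gaussians *)

Section tuple_integral.
Context {R : realType}.
Local Open Scope ereal_scope.

Lemma ge0_integral_tuple_cons n (f : euclidean R n.+1 -> \bar R) :
  measurable_fun setT f -> (forall x, 0 <= f x) ->
  \int[lebesgue_tuple n.+1]_x f x =
  \int[lebesgue_measure]_a \int[lebesgue_tuple n]_x f (tuple_cons (a, x)).
Proof.
move=> mf f0; have mc := @measurable_tuple_cons R n.
transitivity (\int[pushforward (lebesgue_measure \x lebesgue_tuple n) (@tuple_cons R n)]_x f x).
  by apply: eq_measure_integral.
rewrite ge0_integral_pushforward//= preimage_setT.
rewrite fubini_tonelli1//; exact: measurableT_comp.
Qed.

Lemma integral_tuple_prod n (F : 'I_n -> R -> R) :
  (forall i, measurable_fun setT (F i)) -> (forall i y, 0 <= F i y)%R ->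
  \int[lebesgue_tuple n]_x (\prod_(i < n) F i (tnth x i))%:E =
  \prod_(i < n) \int[lebesgue_measure]_y (F i y)%:E.
Proof.
elim: n F => [|n IH] F mF F0.
  rewrite big_ord0; transitivity (\int[@lebesgue_tuple R 0]_x cst (1 : \bar R) x).
    by apply: eq_integral => x _; rewrite big_ord0.
  by rewrite integral_cst// mul1e/= diracT.
have mprod m (K : 'I_m -> R -> R) : (forall i, measurable_fun setT (K i)) ->
    measurable_fun setT (fun x : euclidean R m => \prod_(i < m) K i (tnth x i))%R.
  move=> mK; apply: measurable_prod => i _.
  exact: (measurableT_comp (mK i) (measurable_tnth i)).
rewrite ge0_integral_tuple_cons; last 2 first.
- by apply/measurable_EFinP; exact: (mprod _ F).
- by move=> x; rewrite lee_fin prodr_ge0.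
rewrite big_ord_recl.
have e a : \int[lebesgue_tuple n]_x
    (\prod_(i < n.+1) F i (tnth (tuple_cons (a, x)) i))%:E =
    (F ord0 a)%:E * \prod_(i < n) \int[lebesgue_measure]_y (F (lift ord0 i) y)%:E.
  rewrite -IH// -ge0_integralZl_EFin//.
  - apply: eq_integral => x _; rewrite big_ord_recl EFinM tnth0.
    by congr (_ * _%:E); apply: eq_bigr => i _; rewrite tnthS.
  - by move=> x _; rewrite lee_fin prodr_ge0.
  - by apply/measurable_EFinP; apply: (mprod _ (fun i => F (lift ord0 i))).
under eq_integral do rewrite e.
rewrite ge0_integralZr//.
- by apply/measurable_EFinP; exact: mF.
- by move=> x _; rewrite lee_fin.
- by apply: prode_ge0 => i _; apply: integral_ge0 => y _; rewrite lee_fin.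
Qed.

End tuple_integral.

(** * Gaussian integrals and the semigroup law *)

Section gauss.
Context {R : realType}.

Definition gauss1 (a t : R) : R := (4 * pi * t) `^ (- 2^-1) * expR (- (a ^+ 2 / (4 * t))).

Lemma gauss1_ge0 a t : 0 <= gauss1 a t.
Proof. by rewrite mulr_ge0 ?powR_ge0 ?expR_ge0. Qed.

Lemma measurable_gauss1 (c t : R) : measurable_fun setT (fun y : R => gauss1 (c - y) t).
Proof.
apply: measurable_funM => //; apply: (measurableT_comp (@measurable_expR R)).
apply: measurable_funN; apply: measurable_funM => //; apply: measurable_funX.
exact: measurable_funB.
Qed.

Lemma gauss_kernel_prod N (x : euclidean R N) t :
  gauss_kernel x t = \prod_(i < N) gauss1 (tnth x i) t.
Proof.
rewrite /gauss1 big_split/= prodr_const card_ord -expR_sum sumrN -mulr_suml.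
rewrite -sqr_enorm -powR_mulrn ?powR_ge0// -powRrM mulNr.
by rewrite [2^-1 * _]mulrC.
Qed.

(** [gauss1] is the normal density of variance 2t. *)
Lemma integral_gauss1 (c t : R) : 0 < t ->
  (\int[lebesgue_measure]_y (gauss1 (c - (y : R)) t)%:E = 1)%E.
Proof.
move=> t0; rewrite -(integral_normal_pdf c (Num.sqrt (2 * t))).
have s0 : 0 < Num.sqrt (2 * t) by rewrite sqrtr_gt0 mulr_gt0.
apply: eq_integral => y _; rewrite normal_pdfE ?gt_eqF//.
rewrite /normal_peak /normal_fun sqr_sqrtr ?mulr_ge0 ?ltW// /gauss1.
congr ((_ * expR _)%:E).
  rewrite powRN powR12_sqrt ?mulr_ge0 ?pi_ge0 ?ltW//; congr (Num.sqrt _)^-1.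
  by ring.
rewrite mulNr; congr (- (_ / _)); last by ring.
by rewrite -sqrrN opprB.
Qed.

(** Completing the square in y: the second factor on the right is centred at the weighted mean of a
    and b, and it is the only one that contains y. *)
Lemma gauss1_mul (a b y t s : R) : 0 < t -> 0 < s ->
  gauss1 (a - y) t * gauss1 (y - b) s =
  gauss1 (a - b) (t + s) * gauss1 ((a * s + b * t) / (t + s) - y) (t * s / (t + s)).
Proof.
move=> t0 s0; rewrite /gauss1.
have ts0 : 0 < t + s by rewrite addr_gt0.
rewrite mulrACA -expRD [RHS]mulrACA -expRD; congr (_ * expR _).
  rewrite -!powRM ?mulr_ge0 ?invr_ge0 ?pi_ge0 ?(ltW t0) ?(ltW s0) ?(ltW ts0)//.
  by congr (_ `^ _); field; rewrite gt_eqF.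
by field; rewrite !gt_eqF.
Qed.

Lemma integral_gauss1_mul (a b t s : R) : 0 < t -> 0 < s ->
  (\int[lebesgue_measure]_y (gauss1 (a - (y : R)) t * gauss1 ((y : R) - b) s)%:E =
   (gauss1 (a - b) (t + s))%:E)%E.
Proof.
move=> t0 s0; under eq_integral do rewrite (gauss1_mul _ _ _ t0 s0) EFinM.
rewrite ge0_integralZl_EFin ?gauss1_ge0//.
- by rewrite integral_gauss1 ?mule1// !mulr_gt0// invr_gt0 addr_gt0.
- by move=> y _; rewrite lee_fin gauss1_ge0.
- by apply/measurable_EFinP; exact: measurable_gauss1.
Qed.

Context (N : nat).
Implicit Types x y z : euclidean R N.

Lemma integral_gauss_kernel x t : 0 < t ->
  (\int[lebesgue_tuple N]_y (gauss_kernel (esub x y) t)%:E = 1)%E.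
Proof.
move=> t0; under eq_integral.
  move=> y _; rewrite gauss_kernel_prod.
  under eq_bigr do rewrite tnth_mktuple.
  over.
rewrite (integral_tuple_prod (F := fun i (a : R) => gauss1 ((tnth x i : R) - a) t)).
- by rewrite big1// => i _; exact: integral_gauss1.
- by move=> i; exact: measurable_gauss1.
- by move=> i y; exact: gauss1_ge0.
Qed.

Lemma gauss_kernel_semigroup x z t s : 0 < t -> 0 < s ->
  (\int[lebesgue_tuple N]_y (gauss_kernel (esub x y) t * gauss_kernel (esub y z) s)%:E =
   (gauss_kernel (esub x z) (t + s))%:E)%E.
Proof.
move=> t0 s0; under eq_integral.
  move=> y _; rewrite !gauss_kernel_prod -big_split/=.
  under eq_bigr do rewrite !tnth_mktuple.
  over.
rewrite (integral_tuple_prod (F := fun i a =>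
  gauss1 ((tnth x i : R) - a) t * gauss1 (a - tnth z i) s)).
- rewrite gauss_kernel_prod -prodEFin; apply: eq_bigr => i _.
  by rewrite tnth_mktuple integral_gauss1_mul.
- move=> i; apply: measurable_funM; first exact: measurable_gauss1.
  have -> : (fun a : R => gauss1 (a - tnth z i) s) = fun a : R => gauss1 ((tnth z i : R) - a) s.
    by apply/funext => a; rewrite /gauss1 -sqrrN opprB.
  exact: measurable_gauss1.
- by move=> i y; rewrite mulr_ge0 ?gauss1_ge0.
Qed.

End gauss.

Section potential.
Context {R : realType} (N : nat) (nu : R -> R) (z : euclidean R N).
Hypotheses (mnu : measurable_fun setT nu) (nu_ge0 : forall r, 0 <= nu r).
Hypothesis nu0 : forall r, r <= 0 -> nu r = 0.
Local Notation E := (euclidean R N * measurableTypeR R)%type.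

Definition heat_potential (e : E) : \bar R :=
  (\int[lebesgue_measure]_r (nu r * gauss_kernel (esub e.1 z) ((r : R) + e.2))%:E)%E.

Let integrand_ge0 (e : E) r : 0 <= nu r * gauss_kernel (esub e.1 z) (r + e.2).
Proof. by rewrite mulr_ge0 ?gauss_kernel_ge0. Qed.

Lemma heat_potential_ge0 e : (0 <= heat_potential e)%E.
Proof. by apply: integral_ge0 => r _; rewrite lee_fin. Qed.

Lemma measurable_heat_potential : measurable_fun setT heat_potential.
Proof.
apply: (@measurable_fun_fubini_tonelli_F _ _ _ _ _
   (@lebesgue_measure R : {sigma_finite_measure set (measurableTypeR R) -> \bar R})
   (fun a : E * measurableTypeR R =>
     (nu a.2 * gauss_kernel (esub a.1.1 z) ((a.2 : R) + a.1.2))%:E)) => [|a].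
  apply/measurable_EFinP; apply: measurable_funM.
    exact: (measurableT_comp mnu measurable_snd).
  apply: measurable_gauss_kernel.
    apply: measurable_esub => //.
    by apply: measurableT_comp; exact: measurable_fst.
  apply: measurable_funD; first exact: measurable_snd.
  by apply: measurableT_comp; [exact: measurable_snd|exact: measurable_fst].
by rewrite lee_fin.
Qed.

(** A Gaussian of age r has age r + s at time s, so Tonelli reduces the claim to a single kernel.
    The time s = 0 is allowed because [nu] vanishes for r <= 0, which keeps r + s positive. *)
Lemma heat_potential_semigroup x s t : 0 <= s -> s < t ->
  (\int[lebesgue_tuple N]_y ((gauss_kernel (esub x y) (t - s))%:E * heat_potential (y, s)) =
   heat_potential (x, t))%E.
Proof.
move=> s0 st; have ts : 0 < t - s by rewrite subr_gt0.
have mG : measurable_fun setT (fun a : E => nu a.2 * gauss_kernel (esub a.1 z) ((a.2 : R) + s)).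
  apply: measurable_funM; first exact: (measurableT_comp mnu measurable_snd).
  apply: measurable_gauss_kernel.
    by apply: measurable_esub => //; exact: measurable_fst.
  by apply: measurable_funD => //; exact: measurable_snd.
have mK : measurable_fun setT (fun y : euclidean R N => gauss_kernel (esub x y) (t - s)).
  by apply: measurable_gauss_kernel => //; exact: measurable_esub.
transitivity (\int[lebesgue_tuple N]_y \int[lebesgue_measure]_r
    (gauss_kernel (esub x y) (t - s) * (nu r * gauss_kernel (esub y z) ((r : R) + s)))%:E)%E.
  apply: eq_integral => y _; rewrite /heat_potential -ge0_integralZl_EFin ?gauss_kernel_ge0//.
  - by move=> r _; rewrite lee_fin.
  - by apply/measurable_EFinP; exact: (measurableT_comp mG (pair1_measurable y)).
rewrite (@fubini_tonelli _ _ _ _ _ (lebesgue_tuple N)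
  (lebesgue_measure : {sigma_finite_measure set (measurableTypeR R) -> \bar R})
  (fun a : E => (gauss_kernel (esub x a.1) (t - s) *
    (nu a.2 * gauss_kernel (esub a.1 z) ((a.2 : R) + s)))%:E))/=; last 2 first.
- apply/measurable_EFinP; apply: measurable_funM; last exact: mG.
  exact: (measurableT_comp mK measurable_fst).
- move=> a; rewrite lee_fin; apply: mulr_ge0; first exact: gauss_kernel_ge0.
  exact: mulr_ge0 (nu_ge0 _) (gauss_kernel_ge0 _ _).
apply: eq_integral => r _.
have [r0|r0] := leP r 0.
  rewrite nu0// mul0r; apply: integral0_eq => y _.
  by rewrite mul0r mulr0.
under eq_integral do rewrite mulrCA EFinM.
rewrite ge0_integralZl_EFin//; last 2 first.
- by move=> y _; rewrite lee_fin mulr_ge0 ?gauss_kernel_ge0.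
- apply/measurable_EFinP; apply: measurable_funM => //.
  by apply: measurable_gauss_kernel => //; exact: measurable_esub.
have rs : 0 < (r : R) + s by rewrite ltr_wpDr.
rewrite (gauss_kernel_semigroup _ _ ts rs) [RHS]EFinM; congr (_ * (gauss_kernel _ _)%:E)%E.
by rewrite addrCA subrK addrC.
Qed.

Lemma heat_potential_le x t : 0 <= t ->
  (heat_potential (x, t) <=
   \int[lebesgue_measure]_r (nu r * (4 * pi * ((r : R) + t)) `^ (- (N%:R / 2)))%:E)%E.
Proof.
move=> t0; apply: ge0_le_integral => //.
- by move=> r _; rewrite lee_fin.
- apply/measurable_EFinP; apply: measurable_funM => //.
  by apply: measurable_gauss_kernel => //; exact: measurable_funD.
- apply/measurable_EFinP; apply: measurable_funM => //.
  apply: (measurableT_comp (@measurable_powR R _)).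
  by apply: measurable_funM => //; exact: measurable_funD.
move=> r _; rewrite lee_fin.
have [r0|r0] := leP r 0; first by rewrite nu0// !mul0r.
rewrite ler_wpM2l// ler_piMr ?powR_ge0// -expR0 ler_expR oppr_le0.
by rewrite divr_ge0 ?sqr_ge0// mulr_ge0// addr_ge0// ltW.
Qed.

Lemma heat_potential_ge x t a b m : a < b -> 0 <= m ->
  (forall r, a < r < b -> m <= nu r * gauss_kernel (esub x z) (r + t)) ->
  ((m * (b - a))%:E <= heat_potential (x, t))%E.
Proof.
move=> ab m0 hm.
have -> : (m * (b - a))%:E = (\int[lebesgue_measure]_(r in `]a, b[%classic) (cst m%:E r))%E.
  rewrite integral_cst//= ?lebesgue_measure_itv/= ?lte_fin ?ab ?EFinM ?EFinB//.
rewrite /heat_potential integral_mkcond; apply: ge0_le_integral => //.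
- by move=> r _; rewrite patchE; case: ifPn.
- have mi : measurable (`]a, b[%classic : set (measurableTypeR R)) := measurable_itv _.
  by apply/(measurable_restrictT _ mi).
- apply/measurable_EFinP; apply: measurable_funM => //.
  by apply: measurable_gauss_kernel => //; exact: measurable_funD.
- move=> r _; rewrite patchE; case: ifPn => [/set_mem|_]; last by rewrite lee_fin.
  by rewrite /= in_itv/= lee_fin => /hm.
Qed.

(** Domination by the Gaussian, which preserves constants and moves the potential from time 0 to t.
    As (x, t) is fixed, [A] and [B] may depend on it; both existence proofs rely on this freedom. *)
Lemma initial_potential_le p T A B x t : 0 <= A -> 0 <= B ->
  cylinder T (x, t) ->
  (forall y, half_space y ->
     (f_sing p z y)%:E <= A%:E + B%:E * heat_potential (y, 0%R))%E ->
  (initial_potential p z T (x, t) <= A%:E + B%:E * heat_potential (x, t))%E.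
Proof.
move=> A0 B0 xt hf; have [x0 /andP[t0 _]] := xt; rewrite /= in x0 t0.
have mK : measurable_fun setT (fun y : euclidean R N => (gauss_kernel (esub x y) (t - 0))%:E).
  by apply/measurable_EFinP; apply: measurable_gauss_kernel => //; exact: measurable_esub.
have mv : measurable_fun setT (fun y : euclidean R N => heat_potential (y, 0)).
  exact: (measurableT_comp measurable_heat_potential (pair2_measurable _)).
have K0 y : (0 <= (gauss_kernel (esub x y) (t - 0))%:E)%E.
  by rewrite lee_fin gauss_kernel_ge0.
have v0 y : (0 <= heat_potential (y, 0%R))%E by exact: heat_potential_ge0.
have -> : (A%:E + B%:E * heat_potential (x, t) = \int[lebesgue_tuple N]_y
    ((gauss_kernel (esub x y) (t - 0))%:E * (A%:E + B%:E * heat_potential (y, 0%R))))%E.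
  rewrite -(heat_potential_semigroup x (lexx 0) t0).
  under [RHS]eq_integral do rewrite ge0_muleDr ?mule_ge0 ?lee_fin// muleCA.
  rewrite ge0_integralD//.
  - rewrite ge0_integralZr// ?lee_fin// integral_gauss_kernel ?subr_gt0// mul1e.
    rewrite ge0_integralZl_EFin//; last exact: emeasurable_funM.
    by move=> y _; rewrite mule_ge0.
  - by move=> y _; rewrite mule_ge0.
  - exact: emeasurable_funM.
  - by move=> y _; rewrite !mule_ge0.
  - by apply: emeasurable_funM => //; exact: emeasurable_funM.
apply: ge0_le_integral => //.
- by move=> y _; rewrite lee_fin initial_potential_integrand_ge0.
- apply/measurable_EFinP; apply: measurable_funM.
    by apply: measurable_funM => //; apply: measurable_indic; exact: measurable_half_space.
  by apply: measurable_funM; [exact: measurable_dirichlet_kernel|exact: measurable_f_sing].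
- apply: emeasurable_funM => //; apply: emeasurable_funD => //.
  exact: emeasurable_funM.
- move=> y _; rewrite !indicE mem_set// mul1r.
  have [/set_mem y0|_] := boolP (y \in half_space); last first.
    by rewrite !mul0r mule_ge0// adde_ge0 ?mule_ge0 ?lee_fin.
  rewrite mul1r EFinM; apply: lee_pmul; rewrite ?lee_fin ?f_sing_ge0//.
  - by rewrite dirichlet_kernel_ge0// ltW.
  - by rewrite subr0 dirichlet_le_gauss.
  - exact: hf.
Qed.

Lemma power_op_le p T (w : E -> \bar R) (phi psi : R -> R) x t :
  measurable_fun setT w -> (forall e, 0 <= w e)%E ->
  measurable_fun setT phi -> measurable_fun setT psi ->
  (forall s, 0 <= phi s) -> (forall s, 0 <= psi s) ->
  (forall e, cylinder T e ->
    w e `^ p <= (phi e.2)%:E * heat_potential e + (psi e.2)%:E)%E ->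
  cylinder T (x, t) ->
  (power_op (space_time N) p (duhamel_kernel T) w (x, t) <=
   (\int[lebesgue_measure]_(s in `]0%R, (t : R)[%classic) (phi s)%:E) * heat_potential (x, t) +
    \int[lebesgue_measure]_(s in `]0%R, (t : R)[%classic) (psi s)%:E)%E.
Proof.
move=> mw w0 mphi mpsi phi0 psi0 hw xt.
have v0 e : (0 <= heat_potential e)%E by exact: heat_potential_ge0.
(* [K] drops the Dirichlet correction and the restriction to the half-space, so that unit mass and
   the semigroup law hold exactly. *)
pose K (e : E) : R := \1_(`]0, t[%classic) (e.2 : R) * gauss_kernel (esub x e.1) (t - e.2).
have K0 e : 0 <= K e by rewrite mulr_ge0 ?gauss_kernel_ge0.
have mK : measurable_fun setT K.
  apply: measurable_funM.
    have m1 : measurable_fun setT (\1_(`]0, t[%classic) : measurableTypeR R -> R).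
      by apply: measurable_indic; exact: measurable_itv.
    exact: (measurableT_comp m1 measurable_snd).
  apply: measurable_gauss_kernel.
    by apply: measurable_esub => //; exact: measurable_fst.
  by apply: measurable_funB => //; exact: measurable_snd.
pose g (e : E) := ((phi e.2)%:E * heat_potential e + (psi e.2)%:E)%E.
have g0 e : (0 <= g e)%E by rewrite adde_ge0 ?mule_ge0 ?lee_fin.
have mg : measurable_fun setT g.
  apply: emeasurable_funD.
    apply: emeasurable_funM; last exact: measurable_heat_potential.
    by apply/measurable_EFinP; exact: (measurableT_comp mphi measurable_snd).
  by apply/measurable_EFinP; exact: (measurableT_comp mpsi measurable_snd).
have mKg : measurable_fun setT (fun e => (K e)%:E * g e)%E.
  by apply: emeasurable_funM => //; apply/measurable_EFinP.
apply: (@le_trans _ _ (\int[space_time N]_e ((K e)%:E * g e))%E).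
  apply: ge0_le_integral => //.
  - by move=> e _; rewrite mule_ge0 ?poweR_ge0// lee_fin duhamel_kernel_ge0.
  - by apply: measurable_power_op_integrand => //; exact: measurable_duhamel_kernel.
  move=> [y s] _.
  have [|cz] := boolP (((x, t), (y, s)) \in causal_pairs T); last first.
    by rewrite /duhamel_kernel indicE (negbTE cz) mul0r mul0e mule_ge0 ?lee_fin.
  move=> cz; have /set_mem[[_ /= cy] /= st] := cz.
  have [/= y0 /andP[s0 _]] := cy; have [/= x0 _] := xt.
  apply: lee_pmul; rewrite ?lee_fin ?poweR_ge0 ?duhamel_kernel_ge0//; last exact: hw.
  rewrite /duhamel_kernel indicE cz mul1r /K/= indicE mem_set ?mul1r ?dirichlet_le_gauss//=.
  by rewrite in_itv/= s0.
rewrite fubini_tonelli2//; last by move=> e; rewrite mule_ge0 ?lee_fin.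
have vfin : (\int[lebesgue_measure]_(s in `]0%R, (t : R)[%classic)
  ((phi s)%:E * heat_potential (x, t)) =
  (\int[lebesgue_measure]_(s in `]0%R, (t : R)[%classic) (phi s)%:E) * heat_potential (x, t))%E.
  rewrite ge0_integralZr//.
  - by apply: measurable_funTS; apply/measurable_EFinP.
  - by move=> s _; rewrite lee_fin.
rewrite -vfin -ge0_integralD//; last 4 first.
- by move=> s _; rewrite mule_ge0 ?lee_fin.
- by apply: emeasurable_funM => //; apply: measurable_funTS; apply/measurable_EFinP.
- by move=> s _; rewrite lee_fin.
- by apply: measurable_funTS; apply/measurable_EFinP.
rewrite [leRHS]integral_mkcond le_eqVlt; apply/orP; left; apply/eqP.
apply: eq_integral => s _; rewrite patchE /fubini_G /K /g/=.
case: ifPn => [/set_mem|] st; last first.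
  apply: integral0_eq => y _; rewrite indicE.
  by rewrite (negbTE st) mul0r mul0e.
move: (st); rewrite /= in_itv/= => /andP[s0 s1].
have mKs : measurable_fun setT (fun y : euclidean R N => (gauss_kernel (esub x y) (t - s))%:E).
  by apply/measurable_EFinP; apply: measurable_gauss_kernel => //; exact: measurable_esub.
have mvs : measurable_fun setT (fun y : euclidean R N => heat_potential (y, s)).
  exact: (measurableT_comp measurable_heat_potential (pair2_measurable _)).
have Ks0 y : (0 <= (gauss_kernel (esub x y) (t - s))%:E)%E.
  by rewrite lee_fin gauss_kernel_ge0.
rewrite -(heat_potential_semigroup x (ltW s0) s1).
under eq_integral.
  move=> y _; rewrite indicE mem_set// mul1r ge0_muleDr ?mule_ge0 ?lee_fin// muleCA.
  over.
rewrite ge0_integralD//.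
- rewrite ge0_integralZl_EFin//; last 2 first.
  + by move=> y _; rewrite mule_ge0.
  + exact: emeasurable_funM.
  rewrite ge0_integralZr// ?lee_fin//.
  by rewrite integral_gauss_kernel ?subr_gt0// mul1e.
- by move=> y _; rewrite mule_ge0 ?lee_fin// mule_ge0.
- by apply: emeasurable_funM => //; exact: emeasurable_funM.
- by move=> y _; rewrite mule_ge0 ?Ks0 ?lee_fin.
- exact: emeasurable_funM.
Qed.

End potential.

(** * One-dimensional integrals with endpoint singularities *)

Section antiderivative.
Context {R : realType}.

(** The fundamental theorem on compact subintervals, then monotone convergence. Bounds on [F] inside
    the interval replace its limits at the endpoints, where [phi] may blow up. *)
Lemma integral_le_antiderivative (phi F : R -> R) (a b m M : R) : a < b ->
  (forall x, a < x < b -> is_derive x 1 F (phi x)) ->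
  (forall x, a < x < b -> {for x, continuous phi}) ->
  (forall x, a < x < b -> 0 <= phi x) ->
  (forall x, a < x < b -> m <= F x <= M) ->
  (\int[lebesgue_measure]_(x in `]a, b[%classic) (phi (x : R))%:E <= (M - m)%:E)%E.
Proof.
move=> ab dF cphi phi0 mM.
(* The shift by 3 makes the margin less than half of the interval already for n = 0, so that
   [al n < be n]. *)
pose al n : R := a + (b - a) / n.+3%:R.
pose be n : R := b - (b - a) / n.+3%:R.
have ba : 0 < b - a by rewrite subr_gt0.
have d0 n : 0 < (b - a) / n.+3%:R by rewrite divr_gt0.
have d1 n : (b - a) / n.+3%:R < (b - a) / 2.
  by rewrite ltr_pM2l// ltf_pV2 ?posrE// ltr_nat.
have albe n : a < al n /\ al n < be n /\ be n < b.
  rewrite /al /be; move: (_ / n.+3%:R) (d0 n) (d1 n) => X X0 X1.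
  by split; [|split]; lra.
have in_ab n x : x \in `[al n, be n] -> a < x < b.
  have [h1 [_ h2]] := albe n.
  rewrite in_itv/= => /andP[x1 x2].
  by rewrite (lt_le_trans h1 x1) (le_lt_trans x2 h2).
have cF x : a < x < b -> F y @[y --> x] --> F x.
  move=> /dF h; apply: differentiable_continuous; apply/derivable1_diffP.
  exact: (@ex_derive _ _ _ _ _ _ _ h).
have eqU : `]a, b[%classic = \bigcup_n `[al n, be n]%classic :> set R.
  apply/seteqP; split => [x|x [n _ /in_ab]]; last by rewrite /= in_itv.
  rewrite /= in_itv/= => /andP[ax xb].
  pose d := Num.min (x - a) (b - x).
  have dp : 0 < d by rewrite lt_min !subr_gt0 ax xb.
  pose n := Num.bound ((b - a) / d).
  have hn : (b - a) / n.+3%:R <= d.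
    rewrite ler_pdivrMr// mulrC -ler_pdivrMr//.
    have := archi_boundP (ltW (divr_gt0 ba dp)); rewrite -/n => /ltW /le_trans; apply.
    by rewrite ler_nat; lia.
  exists n => //=; rewrite in_itv/= /al /be.
  have : d <= x - a by rewrite ge_min lexx.
  have : d <= b - x by rewrite ge_min lexx orbT.
  move: (_ / n.+3%:R) hn => X *; apply/andP; split; lra.
have mphi : measurable_fun (`]a, b[%classic : set R) phi.
  apply: open_continuous_measurable_fun; first exact: interval_open.
  by move=> x; rewrite inE/= in_itv/= => /cphi.
rewrite eqU.
have nd : nondecreasing_seq (fun n : nat => `[al n, be n]%classic : set (measurableTypeR R)).
  move=> i j ij; rewrite subsetEset => x; rewrite /= !in_itv/= => /andP[x1 x2].
  have h : (b - a) / j.+3%:R <= (b - a) / i.+3%:R.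
    by rewrite ler_pM2l// lef_pV2 ?posrE// ler_nat; lia.
  move: x1 x2 h; rewrite /al /be; move: (_ / i.+3%:R) (_ / j.+3%:R) => X Y *.
  by apply/andP; split; lra.
have mI n : measurable (`[al n, be n]%classic : set (measurableTypeR R)) by exact: measurable_itv.
have mphiI n : measurable_fun (`[al n, be n]%classic : set (measurableTypeR R))
    (fun x : measurableTypeR R => (phi x)%:E).
  apply/measurable_EFinP; apply: measurable_funS mphi; first exact: measurable_itv.
  by move=> x /= /in_ab; rewrite in_itv.
have f0 n x : `[al n, be n]%classic x -> (0 <= (phi x)%:E)%E.
  by move=> /in_ab /phi0; rewrite lee_fin.
rewrite -(cvg_lim _ (ge0_nondecreasing_set_cvg_integral nd mI mphiI f0))//.
apply: lime_le.
  apply: ereal_nondecreasing_is_cvgn.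
  exact: ge0_nondecreasing_set_nondecreasing_integral.
apply: nearW => n.
have [h1 [h2 h3]] := albe n.
rewrite (@continuous_FTC2 _ phi F)//.
- have al_in : a < al n < b by rewrite h1 (lt_trans h2 h3).
  have be_in : a < be n < b by rewrite h3 (lt_trans h1 h2).
  have /andP[? ?] := mM _ al_in; have /andP[? ?] := mM _ be_in.
  by rewrite -EFinB lee_fin; lra.
- apply: continuous_in_subspaceT => x; rewrite inE/= => /in_ab; exact: cphi.
- split.
  + move=> x; rewrite in_itv/= => /andP[x1 x2].
    have xab : a < x < b by rewrite (lt_trans h1 x1) (lt_trans x2 h3).
    exact: (@ex_derive _ _ _ _ _ _ _ (dF _ xab)).
  + apply: cvg_at_right_filter; apply: cF.
    by rewrite h1 (lt_trans h2 h3).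
  + apply: cvg_at_left_filter; apply: cF.
    by rewrite h3 (lt_trans h1 h2).
- move=> x; rewrite in_itv/= => /andP[x1 x2].
  have xab : a < x < b by rewrite (lt_trans h1 x1) (lt_trans x2 h3).
  by rewrite derive1E; exact: (@derive_val _ _ _ _ _ _ _ (dF _ xab)).
Qed.

Lemma continuous_powR_pos (x r : R) : 0 < x -> {for x, continuous (fun y : R => y `^ r)}.
Proof.
move=> x0; apply: differentiable_continuous; apply/derivable1_diffP.
exact: (@ex_derive _ _ _ _ _ _ _ (is_derive1_powR r x0)).
Qed.

Lemma integral_powR0 (s t : R) : 0 < s -> 0 < t ->
  (\int[lebesgue_measure]_(x in `]0%R, (t : R)[%classic) ((x : R) `^ (s - 1))%:E
   <= (t `^ s / s)%:E)%E.
Proof.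
move=> s0 t0; rewrite -[t `^ s / s]subr0.
apply: (@integral_le_antiderivative (fun x => x `^ (s - 1)) (fun x => s^-1 *: x `^ s)) => //.
- move=> x /andP[x0 _].
  have h := is_derive1_powR s x0.
  have -> : x `^ (s - 1) = s^-1 *: (s * x `^ (s - 1)).
    by rewrite /GRing.scale/= mulrA mulVf ?mul1r ?gt_eqF.
  exact: is_deriveZ.
- by move=> x /andP[x0 _]; exact: continuous_powR_pos.
- by move=> x _; exact: powR_ge0.
- move=> x /andP[x0 xt]; rewrite /GRing.scale/= mulr_ge0 ?invr_ge0 ?powR_ge0 ?(ltW s0)//=.
  rewrite mulrC ler_wpM2r ?invr_ge0 ?(ltW s0)//.
  by rewrite ge0_ler_powR ?nnegrE ?(ltW s0)//; exact: ltW.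
Qed.

Lemma integral_powR_tail (s a b : R) : 0 < s -> 0 < a -> a < b ->
  (\int[lebesgue_measure]_(x in `]a, b[%classic) ((x : R) `^ (- s - 1))%:E
   <= (a `^ (- s) / s)%:E)%E.
Proof.
move=> s0 a0 ab.
have -> : a `^ (- s) / s = 0 - (- (a `^ (- s) / s)) by rewrite sub0r opprK.
apply: (@integral_le_antiderivative (fun x => x `^ (- s - 1))
  (fun x => (- s)^-1 *: x `^ (- s))) => //.
- move=> x /andP[ax _]; have x0 := lt_trans a0 ax.
  have h := is_derive1_powR (- s) x0.
  have -> : x `^ (- s - 1) = (- s)^-1 *: (- s * x `^ (- s - 1)).
    by rewrite /GRing.scale/= mulrA mulVf ?mul1r// oppr_eq0 gt_eqF.
  exact: is_deriveZ.
- by move=> x /andP[ax _]; apply: continuous_powR_pos; exact: lt_trans ax.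
- by move=> x _; exact: powR_ge0.
- move=> x /andP[ax xb]; rewrite /GRing.scale/= invrN mulNr lerN2 oppr_le0.
  rewrite mulr_ge0 ?invr_ge0 ?powR_ge0 ?(ltW s0)// andbT.
  rewrite mulrC ler_wpM2r ?invr_ge0 ?(ltW s0)//.
  by apply: ler_powRN; rewrite ?(ltW s0) ?(ltW ax).
Qed.

Lemma integral_log (g t : R) : 0 < g -> 0 < t -> t < 1 ->
  (\int[lebesgue_measure]_(x in `]0%R, (t : R)[%classic)
     ((x : R) `^ (- 1) * (- ln (x : R)) `^ (- g - 1))%:E
   <= ((- ln t) `^ (- g) / g)%:E)%E.
Proof.
move=> g0 t0 t1; rewrite -[X in X%:E]subr0.
have lx x : 0 < x < t -> 0 < - ln x.
  by move=> /andP[x0 xt]; rewrite oppr_gt0 ln_lt0// x0 (lt_trans xt).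
have dl (x : R) : 0 < x -> is_derive x 1 (fun y => - ln y) (- x^-1).
  by move=> x0; have := is_derive1_ln x0 => h; exact: is_deriveN.
apply: (@integral_le_antiderivative (fun x => x `^ (- 1) * (- ln x) `^ (- g - 1))
  (fun x => g^-1 *: (- ln x) `^ (- g))) => //.
- move=> x xt; have /andP[x0 _] := xt.
  have h1 := is_derive1_powR (- g) (lx _ xt).
  have h2 := dl _ x0.
  have h3 := @is_derive1_comp R (fun y => y `^ (- g)) (fun y => - ln y) x _ _ h1 h2.
  have -> : x `^ (- 1) * (- ln x) `^ (- g - 1) =
    g^-1 *: ((- g * (- ln x) `^ (- g - 1)) * (- x^-1)).
    rewrite /GRing.scale/= powR_inv1 ?(ltW x0)//; field.
    by rewrite !gt_eqF.
  exact: is_deriveZ.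
- move=> x xt; have /andP[x0 _] := xt.
  apply: continuousM; first exact: continuous_powR_pos.
  apply: (@continuous_comp _ _ _ (fun y => - ln y) (fun y => y `^ (- g - 1))).
    apply: differentiable_continuous; apply/derivable1_diffP.
    exact: (@ex_derive _ _ _ _ _ _ _ (dl _ x0)).
  exact: continuous_powR_pos (lx _ xt).
- by move=> x _; rewrite mulr_ge0 ?powR_ge0.
- move=> x xt; have /andP[x0 xt'] := xt.
  rewrite /GRing.scale/= mulr_ge0 ?invr_ge0 ?powR_ge0 ?(ltW g0)//=.
  rewrite mulrC ler_wpM2r ?invr_ge0 ?(ltW g0)//.
  apply: ler_powRN; rewrite ?(ltW g0)//; first by rewrite oppr_gt0 ln_lt0// t0.
  by rewrite lerN2 ler_ln ?posrE// ltW.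
Qed.

End antiderivative.

(** * Existence *)

Section supersolutions.
Context {R : realType} (N : nat) (p : R).
Local Notation E := (euclidean R N * measurableTypeR R)%type.

(** Cutting [w] to the cylinder only lowers the power term, and off the cylinder both sides vanish;
    estimates are thus needed in the cylinder alone. *)
Lemma supersolvable_cylinder (z : euclidean R N) k T (w : E -> \bar R) : 0 < p ->
  measurable_fun setT w -> (forall e, 0 <= w e)%E ->
  (forall e, cylinder T e -> w e < +oo /\
    k%:E * initial_potential p z T e +
      power_op (space_time N) p (duhamel_kernel T) w e <= w e)%E ->
  supersolvable p z k T.
Proof.
move=> p0 mw w0 hw.
have w0' e : (0 <= (w \_ (cylinder T)) e)%E by rewrite patchE; case: ifPn.
have mw' : measurable_fun setT (w \_ (cylinder T)).
  have mC := @measurable_cylinder R N T.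
  by apply/(measurable_restrictT _ mC); exact: measurable_funTS.
exists (w \_ (cylinder T)); split => //.
  apply/nearW => e; rewrite patchE; case: ifPn => // /set_mem /hw[wy _].
  by rewrite ge0_fin_numE.
apply/nearW => -[x t].
have [/set_mem xt|xt] := boolP ((x, t) \in cylinder T); last first.
  have -> : initial_potential p z T (x, t) = 0%E.
    by apply: integral0_eq => y _; rewrite indicE (negbTE xt) !mul0r.
  rewrite mule0 add0e /power_op integral0_eq// => e _.
  rewrite /duhamel_kernel indicE memNset/= ?mul0r ?mul0e// => -[[h _] _].
  by move/negP: xt; apply; rewrite inE.
have [_ h] := hw _ xt; rewrite patchE mem_set//; apply: le_trans h; rewrite leeD2l//.
apply: le_power_op => //; [exact: measurable_duhamel_kernel|exact: duhamel_kernel_ge0|].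
by apply/nearW => e; rewrite patchE; case: ifPn.
Qed.

(** b^(p-1) = 1/(2D) and k = b/(2C) make each of the two terms equal to b/2. *)
Lemma small_constants (C D : R) : 0 < C -> 0 < D -> 1 < p ->
  exists b k : R, [/\ 0 < b, 0 < k & k * C + b `^ p * D <= b].
Proof.
move=> C0 D0 p1; have q0 : 0 < p - 1 by rewrite subr_gt0.
pose b := (2 * D)^-1 `^ (p - 1)^-1.
have b0 : 0 < b by rewrite powR_gt0// invr_gt0 mulr_gt0.
exists b, (b / (2 * C)); split => //; first by rewrite divr_gt0// mulr_gt0.
have -> : b `^ p = b / (2 * D).
  rewrite -[p in LHS](subrK 1) powRD ?(gt_eqF b0) ?implybT// powRr1 ?(ltW b0)// mulrC.
  congr (_ * _); rewrite /b -powRrM mulVf ?gt_eqF// powRr1//.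
  by rewrite invr_ge0 mulr_ge0// ltW.
rewrite le_eqVlt; apply/orP; left; apply/eqP; field.
by rewrite !gt_eqF.
Qed.

End supersolutions.

(** * Existence above the critical exponent *)

Section existence_supercritical.
Context {R : realType} (N : nat) (p : R).
Local Notation E := (euclidean R N * measurableTypeR R)%type.
Context (al : R) (pN : critical_exponent N < p) (al1 : 1 < al) (alp : al < p)
  (alN : al < N%:R * (p - 1) / 2).

Let p1 : 1 < p. Proof. exact: lt_trans al1 alp. Qed.
Let q0 : 0 < p - 1. Proof. by rewrite subr_gt0 p1. Qed.
Let al0 : 0 < al. Proof. exact: lt_trans al1. Qed.

(** f_z^al is |x-z|^(-2 dl) near z, and the potential v decays like t^-dl. [sg] is the exponent of
    the weight r^(sg-1) that produces this singularity; [alN] makes it positive. [et] measures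
    integrability in time: dl (p/al - 1) = 1 - et, positive because [al] exceeds 1. *)
Let dl := al / (p - 1).
Let sg := N%:R / 2 - dl.
Let et := (al - 1) / (p - 1).
Let dl0 : 0 < dl. Proof. by rewrite divr_gt0. Qed.
Let sg0 : 0 < sg.
Proof. by rewrite subr_gt0 ltr_pdivrMr// mulrAC. Qed.
Let et0 : 0 < et. Proof. by rewrite divr_gt0// subr_gt0. Qed.

Definition power_density (sg : R) (r : R) : R := \1_(`]0, 1[%classic) r * r `^ (sg - 1).
Local Notation nu := (power_density sg).

Lemma measurable_power_density s : measurable_fun setT (power_density s).
Proof.
apply: measurable_funM; first by apply: measurable_indic; exact: measurable_itv.
exact: measurable_powR.
Qed.

Lemma power_density_ge0 s r : 0 <= power_density s r.
Proof. by rewrite mulr_ge0 ?powR_ge0. Qed.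

Lemma power_density0 s r : r <= 0 -> power_density s r = 0.
Proof.
move=> r0; rewrite /power_density indicE memNset ?mul0r//= in_itv/=.
by move=> /andP[r1 _]; move: r0; rewrite leNgt r1.
Qed.

Lemma power_density1 s r : 1 <= r -> power_density s r = 0.
Proof.
move=> r0; rewrite /power_density indicE memNset ?mul0r//= in_itv/=.
by move=> /andP[_ r1]; move: r0; rewrite leNgt r1.
Qed.

Lemma power_densityE s r : 0 < r -> r < 1 -> power_density s r = r `^ (s - 1).
Proof.
by move=> r0 r1; rewrite /power_density indicE mem_set ?mul1r//= in_itv/= r0 r1.
Qed.

Let CV : R := (4 * pi) `^ (- (N%:R / 2)) * (2 `^ sg / sg + dl^-1).
Let c : R := (4 * pi) `^ (- (N%:R / 2)) * expR (- 2^-1) / 2.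

Let pi40 : 0 < 4 * pi :> R. Proof. by rewrite mulr_gt0// pi_gt0. Qed.
Let c4 : 0 < (4 * pi) `^ (- (N%:R / 2)) :> R. Proof. by rewrite powR_gt0. Qed.
Let CV0 : 0 < CV.
Proof. by rewrite mulr_gt0// addr_gt0 ?invr_gt0// divr_gt0// powR_gt0. Qed.
Let c0 : 0 < c. Proof. by rewrite divr_gt0// mulr_gt0// expR_gt0. Qed.

(** Split at r = t: (r + t)^(-N/2) is at most t^(-N/2) below and r^(-N/2) above. The two terms of
    [CV] are the resulting integrals; the open interval up to 2t is taken so as to cover the point r
    = t. *)
Lemma power_potential_upper (z x : euclidean R N) t : 0 < t -> t < 1 ->
  (heat_potential nu z (x, t) <= (CV * t `^ (- dl))%:E)%E.
Proof.
move=> t0 t1.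
apply: le_trans (heat_potential_le _ (@measurable_power_density sg)
  (power_density_ge0 sg) (power_density0 sg) _ (ltW t0)) _.
pose f1 (r : R) := t `^ (- (N%:R / 2)) * r `^ (sg - 1).
pose f2 (r : R) := r `^ (- dl - 1).
have mf1 : measurable_fun setT f1.
  by apply: measurable_funM => //; exact: measurable_powR.
have mf2 : measurable_fun setT f2 by exact: measurable_powR.
have f10 r : 0 <= f1 r by rewrite mulr_ge0 ?powR_ge0.
have f20 r : 0 <= f2 r by exact: powR_ge0.
have m1 : measurable (`]0, 2 * t[%classic : set (measurableTypeR R)) := measurable_itv _.
have m2 : measurable (`]t, 1[%classic : set (measurableTypeR R)) := measurable_itv _.
pose g1 : measurableTypeR R -> \bar R :=
  (fun r : measurableTypeR R => (f1 r)%:E) \_ `]0, 2 * t[%classic.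
pose g2 : measurableTypeR R -> \bar R :=
  (fun r : measurableTypeR R => (f2 r)%:E) \_ `]t, 1[%classic.
have mg1 : measurable_fun setT g1.
  by apply/(measurable_restrictT _ m1); apply/measurable_EFinP/measurable_funTS.
have mg2 : measurable_fun setT g2.
  by apply/(measurable_restrictT _ m2); apply/measurable_EFinP/measurable_funTS.
have g10 r : (0 <= g1 r)%E.
  by rewrite /g1 patchE; case: ifPn => // _; rewrite lee_fin.
have g20 r : (0 <= g2 r)%E.
  by rewrite /g2 patchE; case: ifPn => // _; rewrite lee_fin.
apply: (@le_trans _ _ (\int[lebesgue_measure]_r (((4 * pi) `^ (- (N%:R / 2)))%:E *
   (g1 r +
    g2 r)))%E).
  apply: ge0_le_integral => //.
  - by move=> r _; rewrite lee_fin mulr_ge0 ?powR_ge0// power_density_ge0.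
  - apply/measurable_EFinP; apply: measurable_funM; first exact: measurable_power_density.
    apply: (measurableT_comp (@measurable_powR R _)).
    by apply: measurable_funM => //; exact: measurable_funD.
  - by apply: emeasurable_funM => //; exact: emeasurable_funD.
  move=> r _.
  have [r0|r0] := leP r 0.
    by rewrite power_density0// mul0r mule_ge0 ?adde_ge0// lee_fin ltW.
  have [r1|r1] := leP 1 r.
    by rewrite power_density1// mul0r mule_ge0 ?adde_ge0// lee_fin ltW.
  rewrite power_densityE// powRM ?(ltW pi40)//; last by rewrite addr_ge0// ltW.
  rewrite mulrCA EFinM lee_wpmul2l ?lee_fin ?(ltW c4)//.
  have [rt|rt] := leP r t.
    apply: (@le_trans _ _ (f1 r)%:E).
      rewrite lee_fin /f1 mulrC ler_wpM2r ?powR_ge0//.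
      by apply: ler_powRN; rewrite ?divr_ge0// lerDr ltW.
    rewrite {1}/g1 patchE mem_set ?leeDl//=.
    by rewrite in_itv/= r0/=; lra.
  apply: (@le_trans _ _ (f2 r)%:E).
    rewrite lee_fin /f2 (_ : - dl - 1 = (sg - 1) + - (N%:R / 2)); last by rewrite /sg; ring.
    rewrite [leRHS]powRD ?(gt_eqF r0) ?implybT// ler_wpM2l ?powR_ge0//.
    by apply: ler_powRN; rewrite ?divr_ge0// lerDl ltW.
  rewrite {1}/g2 patchE mem_set ?leeDr//=.
  by rewrite in_itv/= rt r1.
rewrite ge0_integralZl_EFin ?(ltW c4)//; last 2 first.
- by move=> r _; exact: adde_ge0.
- exact: emeasurable_funD.
rewrite /CV -mulrA EFinM lee_wpmul2l ?lee_fin ?(ltW c4)//.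
rewrite ge0_integralD// /g1 /g2 -!integral_mkcond.
rewrite [X in (_ <= X%:E)%E]mulrDl EFinD; apply: leeD.
- under eq_integral do rewrite /f1 EFinM.
  have pos (r : measurableTypeR R) : `]0, 2 * t[%classic r -> (0 <= ((r : R) `^ (sg - 1))%:E)%E.
    by move=> _; rewrite lee_fin powR_ge0.
  have meas : measurable_fun (`]0, 2 * t[%classic : set (measurableTypeR R))
      (fun r : measurableTypeR R => ((r : R) `^ (sg - 1))%:E).
    by apply/measurable_EFinP/measurable_funTS; exact: measurable_powR.
  rewrite ge0_integralZl_EFin ?powR_ge0//.
  apply: (@le_trans _ _ ((t `^ (- (N%:R / 2)))%:E * ((2 * t) `^ sg / sg)%:E)%E).
    rewrite lee_wpmul2l ?lee_fin ?powR_ge0//.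
    by apply: integral_powR0 => //; rewrite mulr_gt0.
  rewrite -EFinM lee_fin powRM ?(ltW t0)//.
  have -> : t `^ (- dl) = t `^ (- (N%:R / 2)) * t `^ sg.
    by rewrite -powRD ?(gt_eqF t0) ?implybT//; congr (_ `^ _); rewrite /sg; ring.
  by rewrite le_eqVlt; apply/orP; left; apply/eqP; ring.
- by rewrite [_^-1 * _]mulrC; exact: integral_powR_tail.
Qed.

(** Only ages s between r^2/2 and r^2 are kept, with r = |x-z|. There the exponential is at least
    e^(-1/2), the weight and the Gaussian prefactor give s^(-dl-1), and the length r^2/2 of the
    window restores r^(-2 dl). *)
Lemma power_potential_lower (z x : euclidean R N) : 0 < enorm (esub x z) ->
  enorm (esub x z) < 1 ->
  ((c * enorm (esub x z) `^ (- (2 * dl)))%:E <= heat_potential nu z (x, 0%R))%E.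
Proof.
move=> r0 r1; set r := enorm (esub x z) in r0 r1 *.
have r20 : 0 < r ^+ 2 by rewrite exprn_gt0.
have r21 : r ^+ 2 < 1 by rewrite expr_lt1// ltW.
have h : forall s, r ^+ 2 / 2 < s < r ^+ 2 ->
    (4 * pi) `^ (- (N%:R / 2)) * expR (- 2^-1) * (r ^+ 2) `^ (- (dl + 1)) <=
    nu s * gauss_kernel (esub x z) (s + 0).
  move=> s /andP[s1 s2]; have s0 : 0 < s by lra.
  rewrite addr0 power_densityE//; last by lra.
  rewrite /gauss_kernel -/r (powRM _ (ltW pi40) (ltW s0)).
  have -> : s `^ (sg - 1) * ((4 * pi) `^ (- (N%:R / 2)) * s `^ (- (N%:R / 2)) *
      expR (- (r ^+ 2 / (4 * s)))) =
    (4 * pi) `^ (- (N%:R / 2)) * expR (- (r ^+ 2 / (4 * s))) * s `^ (- (dl + 1)).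
    have -> : s `^ (- (dl + 1)) = s `^ (sg - 1) * s `^ (- (N%:R / 2)).
      by rewrite -powRD ?(gt_eqF s0) ?implybT//; congr (_ `^ _); rewrite /sg; ring.
    by ring.
  apply: ler_pM; rewrite ?powR_ge0 ?mulr_ge0 ?expR_ge0 ?powR_ge0//.
    rewrite ler_wpM2l ?powR_ge0// ler_expR lerN2 ler_pdivrMr ?mulr_gt0//.
    by lra.
  by apply: ler_powRN => //; rewrite ?addr_ge0 ?ltW.
have -> : c * r `^ (- (2 * dl)) = (4 * pi) `^ (- (N%:R / 2)) * expR (- 2^-1) *
    (r ^+ 2) `^ (- (dl + 1)) * (r ^+ 2 - r ^+ 2 / 2).
  have -> : r `^ (- (2 * dl)) = (r ^+ 2) `^ (- (dl + 1)) * r ^+ 2.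
    rewrite -[r ^+ 2 in X in _ = _ * X]powRr1 ?(ltW r20)// -powRD ?(gt_eqF r20) ?implybT//.
    rewrite -[r ^+ 2]powR_mulrn ?(ltW r0)// -powRrM; congr (_ `^ _).
    by ring.
  by rewrite /c; field.
apply: heat_potential_ge h => //.
- exact: measurable_power_density.
- exact: power_density_ge0.
- by lra.
- by rewrite !mulr_ge0 ?powR_ge0 ?expR_ge0.
Qed.

(** Strict positivity is needed because v^(1/al) will appear with the negative exponent 1 - al. *)
Lemma power_potential_gt0 (z x : euclidean R N) t : 0 < t ->
  (0 < heat_potential nu z (x, t))%E.
Proof.
move=> t0.
pose m := (4^-1 `^ sg) * ((4 * pi * (1 + t)) `^ (- (N%:R / 2)) *
  expR (- (enorm (esub x z) ^+ 2 / (4 * t)))).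
have m0 : 0 < m by rewrite !mulr_gt0 ?expR_gt0// powR_gt0// mulr_gt0// addr_gt0.
apply: (@lt_le_trans _ _ (m * (2^-1 - 4^-1))%:E); first by rewrite lte_fin mulr_gt0//; lra.
apply: heat_potential_ge.
- exact: measurable_power_density.
- exact: power_density_ge0.
- by lra.
- exact: ltW.
move=> s /andP[s1 s2]; have s0 : 0 < s by lra.
rewrite power_densityE//; last by lra.
apply: ler_pM; rewrite ?powR_ge0 ?mulr_ge0 ?expR_ge0 ?powR_ge0//.
  apply: (@le_trans _ _ (s `^ sg)).
    by rewrite ge0_ler_powR ?nnegrE ?(ltW sg0) ?(ltW s0)//; lra.
  have -> : s `^ sg = s `^ (sg - 1) * s.
    rewrite -{3}[s]powRr1 ?(ltW s0)// -powRD ?(gt_eqF s0) ?implybT//.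
    by rewrite subrK.
  by rewrite ler_piMr ?powR_ge0//; lra.
apply: ler_pM; rewrite ?powR_ge0 ?expR_ge0//.
  apply: ler_powRN; [by rewrite mulr_gt0 ?addr_gt0| |by rewrite divr_ge0].
  by rewrite ler_wpM2l ?(ltW pi40)//; lra.
rewrite ler_expR lerN2 ler_wpM2l ?sqr_ge0// lef_pV2 ?posrE ?mulr_gt0 ?addr_gt0//.
by lra.
Qed.

(** Either f_z <= l, or f_z = f_z^(1-al) f_z^al <= l^(1-al) f_z^al, and f_z^al is controlled by the
    potential at time 0. *)
Lemma f_sing_power_bound (z y : euclidean R N) l : 0 < l ->
  ((f_sing p z y)%:E <= l%:E + (l `^ (1 - al) / c)%:E * heat_potential nu z (y, 0%R))%E.
Proof.
move=> l0; have v0 := heat_potential_ge0 z (power_density_ge0 sg) (y, 0).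
have lc0 : 0 <= l `^ (1 - al) / c by rewrite divr_ge0 ?powR_ge0 ?(ltW c0).
have [fl|lf] := leP (f_sing p z y) l.
  by apply: (@le_trans _ _ l%:E); rewrite ?lee_fin// leeDl// mule_ge0// lee_fin.
apply: (@le_trans _ _ ((l `^ (1 - al) / c)%:E * heat_potential nu z (y, 0%R))%E); last first.
  by rewrite leeDr// lee_fin ltW.
have f0 := lt_trans l0 lf.
have fE : f_sing p z y = enorm (esub y z) `^ (- (2 / (p - 1))) /\ enorm (esub y z) < 1.
  move: f0; rewrite /f_sing pN indicE.
  have [|_] := boolP (y \in _); last by rewrite mulr0 ltxx.
  by move=> /set_mem[y1 _]; rewrite mulr1.
have [fE1 r1] := fE.
have r0 : 0 < enorm (esub y z).
  rewrite lt_def enorm_ge0 andbT; apply/eqP => r0.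
  move: f0; rewrite fE1 r0 powR0 ?ltxx// oppr_eq0 gt_eqF//.
  by rewrite divr_gt0.
have := power_potential_lower r0 r1 => hl.
apply: (@le_trans _ _ ((l `^ (1 - al) / c)%:E *
    (c * enorm (esub y z) `^ (- (2 * dl)))%:E)%E); last first.
  by rewrite lee_wpmul2l// lee_fin.
rewrite -EFinM lee_fin.
have -> : l `^ (1 - al) / c * (c * enorm (esub y z) `^ (- (2 * dl))) =
    l `^ (1 - al) * enorm (esub y z) `^ (- (2 * dl)) by field; rewrite gt_eqF.
have -> : enorm (esub y z) `^ (- (2 * dl)) = f_sing p z y `^ al.
  by rewrite fE1 -powRrM; congr (_ `^ _); rewrite /dl; field; rewrite gt_eqF.
have -> : l `^ (1 - al) = l `^ (- (al - 1)) by rewrite opprB.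
apply: (@le_trans _ _ (f_sing p z y `^ (- (al - 1)) * f_sing p z y `^ al)).
  rewrite -powRD ?(gt_eqF f0) ?implybT// opprB subrK powRr1//; exact: ltW.
rewrite ler_wpM2r ?powR_ge0//; apply: ler_powRN; rewrite ?(ltW lf)// subr_ge0 ltW//.
Qed.

Lemma existence_power_density (z : euclidean R N) :
  exists2 k : R, 0 < k & supersolvable p z k 1.
Proof.
pose D := CV `^ (p / al - 1) * CV `^ (1 - al^-1) / et.
have D0 : 0 < D by rewrite divr_gt0// mulr_gt0 ?powR_gt0.
have C0 : 0 < 1 + c^-1 by rewrite addr_gt0// invr_gt0.
have [b [k [b0 k0 hbk]]] := small_constants C0 D0 p1.
exists k => //.
pose v := heat_potential nu z.
have mv : measurable_fun setT v.
  by apply: measurable_heat_potential; [exact: measurable_power_density|exact: power_density_ge0].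
have v0 e : (0 <= v e)%E by apply: heat_potential_ge0; exact: power_density_ge0.
pose w e := (b%:E * v e `^ al^-1)%E.
have mw : measurable_fun setT w.
  by apply: emeasurable_funM => //; exact: (measurableT_comp (@measurable_poweR R _)).
have w0 e : (0 <= w e)%E by rewrite mule_ge0 ?poweR_ge0// lee_fin ltW.
have vE e : cylinder 1 e -> exists r : R, [/\ v e = r%:E, 0 < r & r <= CV * e.2 `^ (- dl)].
  case: e => x t [_ /= /andP[t0 t1]].
  have := power_potential_upper z x t0 t1; have := power_potential_gt0 z x t0.
  rewrite -/v; case: (v (x, t)) => [r| |]//.
  by rewrite lte_fin lee_fin => r0 rC; exists r.
have wE e r : v e = r%:E -> w e = (b * r `^ al^-1)%:E.
  by move=> ve; rewrite /w ve poweR_EFin.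
apply: (supersolvable_cylinder (lt_trans ltr01 p1) mw w0) => -[x t] xt.
have [/= x0 /andP[t0 t1]] := xt.
have [r [vr r0 rC]] := vE _ xt; rewrite /= in rC.
rewrite (wE _ _ vr); split; first exact: ltry.
(* The free level of [f_sing_power_bound] is chosen at the point (x, t): l^al = v(x, t), so both
   terms of the bound become multiples of l. This takes the place of Jensen's inequality. *)
set l := r `^ al^-1; have l0 : 0 < l by rewrite powR_gt0.
have hF : (initial_potential p z 1 (x, t) <= ((1 + c^-1) * l)%:E)%E.
  apply: (@le_trans _ _ (l%:E + (l `^ (1 - al) / c)%:E * v (x, t))%E).
    apply: initial_potential_le => //.
    - exact: measurable_power_density.
    - exact: power_density_ge0.
    - exact: power_density0.
    - exact: ltW.
    - by rewrite divr_ge0 ?powR_ge0 ?(ltW c0).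
    - by move=> y _; exact: f_sing_power_bound.
  rewrite vr -EFinM -EFinD lee_fin.
  have -> : l `^ (1 - al) / c * r = l / c.
    rewrite mulrAC; congr (_ / _).
    have {1}-> : r = l `^ al by rewrite /l -powRrM mulVf ?gt_eqF// powRr1// ltW.
    by rewrite -powRD ?(gt_eqF l0) ?implybT// subrK powRr1// ltW.
  by rewrite le_eqVlt; apply/orP; left; apply/eqP; ring.
(* w^p is b^p v^(p/al - 1) v, and the upper bound for v turns the power p/al - 1, positive by [alp],
   into s^(et - 1). *)
pose phi (s : R) := b `^ p * CV `^ (p / al - 1) * s `^ (et - 1).
have phi0 s : 0 <= phi s by rewrite !mulr_ge0 ?powR_ge0.
have mphi : measurable_fun setT phi.
  by apply: measurable_funM => //; exact: measurable_powR.
have pal : 0 < p / al - 1 by rewrite subr_gt0 ltr_pdivlMr// mul1r.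
have hP : (power_op (space_time N) p (duhamel_kernel 1) w (x, t) <= (b `^ p * D * l)%:E)%E.
  apply: (le_trans (power_op_le _ _ _ mw w0 mphi
    (psi := fun=> 0) _ phi0 _ _ xt (nu := nu) (z := z))) => //.
  - exact: measurable_power_density.
  - exact: power_density_ge0.
  - exact: power_density0.
  - move=> e ce; have [re [vre re0 reC]] := vE _ ce.
    have [_ /andP[s0 _]] := ce.
    rewrite (wE _ _ vre) adde0 -/v vre poweR_EFin -EFinM lee_fin.
    rewrite powRM ?powR_ge0 ?(ltW b0)// -powRrM /phi -!mulrA ler_wpM2l ?powR_ge0//.
    have -> : re `^ (al^-1 * p) = re `^ (p / al - 1) * re.
      rewrite -{3}[re]powRr1 ?(ltW re0)// -powRD ?(gt_eqF re0) ?implybT//.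
      by rewrite subrK mulrC.
    rewrite mulrA ler_wpM2r ?(ltW re0)//.
    apply: (@le_trans _ _ ((CV * e.2 `^ (- dl)) `^ (p / al - 1))).
      rewrite ge0_ler_powR ?nnegrE ?(ltW pal) ?(ltW re0)//.
      by rewrite mulr_ge0 ?powR_ge0 ?(ltW CV0).
    rewrite powRM ?powR_ge0 ?(ltW CV0)// -powRrM ler_wpM2l ?powR_ge0//.
    rewrite le_eqVlt; apply/orP; left; apply/eqP; congr (_ `^ _).
    by rewrite /dl /et; field; rewrite !gt_eqF.
  rewrite integral0 adde0 -/v vr.
  have hphi : (\int[lebesgue_measure]_(s in `]0%R, (t : R)[%classic) (phi s)%:E <=
     (b `^ p * CV `^ (p / al - 1) * (t `^ et / et))%:E)%E.
    under eq_integral do rewrite /phi EFinM.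
    rewrite ge0_integralZl_EFin ?mulr_ge0 ?powR_ge0//; last 2 first.
    - by move=> s _; rewrite lee_fin powR_ge0.
    - by apply/measurable_EFinP/measurable_funTS; exact: measurable_powR.
    rewrite [leRHS]EFinM lee_wpmul2l ?lee_fin ?mulr_ge0 ?powR_ge0//.
    exact: integral_powR0.
  apply: (@le_trans _ _ ((b `^ p * CV `^ (p / al - 1) * (t `^ et / et))%:E * r%:E)%E).
    by rewrite lee_wpmul2r// lee_fin ltW.
  rewrite -EFinM lee_fin.
  (* dl (1 - 1/al) = et: passing from v to v^(1/al) costs t^-et, exactly what the time integral of
     [phi] gains. *)
  have hr : r <= l * (CV `^ (1 - al^-1) * t `^ (- et)).
    have {1}-> : r = l * r `^ (1 - al^-1).
      rewrite /l -powRD ?(gt_eqF r0) ?implybT// addrC subrK powRr1//.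
      exact: ltW.
    rewrite ler_wpM2l ?(ltW l0)//.
    have al11 : 0 <= 1 - al^-1 by rewrite subr_ge0 invf_le1// ltW.
    apply: (@le_trans _ _ ((CV * t `^ (- dl)) `^ (1 - al^-1))).
      rewrite ge0_ler_powR ?nnegrE ?(ltW r0)//.
      by rewrite mulr_ge0 ?powR_ge0 ?(ltW CV0).
    rewrite powRM ?powR_ge0 ?(ltW CV0)// -powRrM ler_wpM2l ?powR_ge0//.
    rewrite le_eqVlt; apply/orP; left; apply/eqP; congr (_ `^ _).
    by rewrite /dl /et; field; rewrite !gt_eqF.
  apply: (@le_trans _ _ (b `^ p * CV `^ (p / al - 1) * (t `^ et / et) *
      (l * (CV `^ (1 - al^-1) * t `^ (- et))))).
    by rewrite ler_wpM2l// !mulr_ge0 ?powR_ge0 ?invr_ge0 ?(ltW et0).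
  have tt : t `^ et * t `^ (- et) = 1.
    by rewrite -powRD ?(gt_eqF t0) ?implybT// subrr powRr0.
  rewrite le_eqVlt; apply/orP; left; apply/eqP.
  have -> : b `^ p * CV `^ (p / al - 1) * (t `^ et / et) *
      (l * (CV `^ (1 - al^-1) * t `^ (- et))) =
    b `^ p * CV `^ (p / al - 1) * et^-1 * l * CV `^ (1 - al^-1) * (t `^ et * t `^ (- et)) by ring.
  by rewrite tt /D; ring.
apply: (@le_trans _ _ (k%:E * ((1 + c^-1) * l)%:E + (b `^ p * D * l)%:E)%E).
  by apply: leeD => //; rewrite lee_wpmul2l// lee_fin ltW.
rewrite -EFinM -EFinD lee_fin mulrA -mulrDl ler_wpM2r ?(ltW l0)//.
Qed.

End existence_supercritical.

Lemma existence_supercritical (R : realType) (N : nat) (p : R) (z : euclidean R N) :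
  (0 < N)%N -> critical_exponent N < p ->
  exists T k : R, [/\ 0 < T, 0 < k & supersolvable p z k T].
Proof.
move=> N0 pN; have p1 := lt_trans (@critical_exponent_gt1 R N N0) pN.
have N0' : 0 < N%:R :> R by rewrite ltr0n.
have h1 : 1 < N%:R * (p - 1) / 2.
  rewrite ltr_pdivlMr// mul1r -ltr_pdivrMl// mulrC.
  by move: pN; rewrite /critical_exponent; lra.
(* N(p-1)/2 > 1 is the condition p > p_N; [al] will be the midpoint between 1 and this minimum. *)
pose m := Num.min p (N%:R * (p - 1) / 2).
have m1 : 1 < m by rewrite lt_min p1 h1.
have mp : m <= p by rewrite ge_min lexx.
have mN : m <= N%:R * (p - 1) / 2 by rewrite ge_min lexx orbT.
have a1 : 1 < (1 + m) / 2 by lra.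
have ap : (1 + m) / 2 < p by lra.
have aN : (1 + m) / 2 < N%:R * (p - 1) / 2 by apply: lt_le_trans mN; lra.
have [k k0 hk] := existence_power_density pN a1 ap aN z.
by exists 1, k.
Qed.

(** * Existence at the critical exponent *)

Section existence_critical.
Context {R : realType} (N : nat) (N0 : (0 < N)%N) (p : R).
Local Notation E := (euclidean R N * measurableTypeR R)%type.
Hypothesis pN : critical_exponent N = p.

(** Half of the exponent N/2, so that f_z is of the order of |log|x-z||^-g times the potential at
    time 0. Since g(p-1) = 1/2, the exponent gp + g(p-1) met in the Duhamel term is g + 1, and the
    time integral returns the factor |log t|^-g. *)
Let g : R := N%:R / 4.
Let NR0 : 0 < N%:R :> R. Proof. by rewrite ltr0n. Qed.
Let g0 : 0 < g. Proof. by rewrite divr_gt0. Qed.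
Let p1 : 1 < p. Proof. by rewrite -pN critical_exponent_gt1. Qed.
Let q0 : 0 < p - 1. Proof. by rewrite subr_gt0 p1. Qed.
Let gp : g * (p - 1) = 2^-1.
Proof. by rewrite /g -pN /critical_exponent; field; rewrite gt_eqF. Qed.
Let N2g : N%:R / 2 = g + g. Proof. by rewrite /g; field. Qed.
Let l2 : 0 < ln (2 : R). Proof. by rewrite ln_gt0// ltr1n. Qed.

(** On ]0, 1[ this is the derivative of |log r|^-g / g. It serves twice: as weight of the Gaussians
    in their age, and as time factor in the Duhamel estimate. *)
Definition log_weight (g : R) (r : R) : R := r `^ (- 1) * (- ln r) `^ (- g - 1).

Definition log_density (g : R) (r : R) : R := \1_(`]0, 2^-1[%classic) r * log_weight g r.
Local Notation nu := (log_density g).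

Lemma log_weight_ge0 s r : 0 <= log_weight s r.
Proof. by rewrite mulr_ge0 ?powR_ge0. Qed.

Lemma measurable_log_weight s : measurable_fun setT (log_weight s).
Proof.
apply: measurable_funM; first exact: measurable_powR.
apply: (measurableT_comp (@measurable_powR R _)).
by apply: measurable_funN; exact: measurable_ln.
Qed.

Lemma measurable_log_density s : measurable_fun setT (log_density s).
Proof.
apply: measurable_funM; first by apply: measurable_indic; exact: measurable_itv.
exact: measurable_log_weight.
Qed.

Lemma log_density_ge0 s r : 0 <= log_density s r.
Proof. by rewrite mulr_ge0 ?log_weight_ge0. Qed.

Lemma log_density0 s r : r <= 0 -> log_density s r = 0.
Proof.
move=> r0; rewrite /log_density indicE memNset ?mul0r//= in_itv/=.
by move=> /andP[r1 _]; move: r0; rewrite leNgt r1.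
Qed.

Lemma log_density_half s r : 2^-1 <= r -> log_density s r = 0.
Proof.
move=> r0; rewrite /log_density indicE memNset ?mul0r//= in_itv/=.
by move=> /andP[_ r1]; move: r0; rewrite leNgt r1.
Qed.

Lemma log_densityE s r : 0 < r -> r < 2^-1 -> log_density s r = log_weight s r.
Proof.
by move=> r0 r1; rewrite /log_density indicE mem_set ?mul1r//= in_itv/= r0 r1.
Qed.

Let c4 : R := (4 * pi) `^ (- (N%:R / 2)).
Let pi40 : 0 < 4 * pi :> R. Proof. by rewrite mulr_gt0// pi_gt0. Qed.
Let c40 : 0 < c4. Proof. by rewrite powR_gt0. Qed.
Let CV : R := c4 * (2 `^ g / g + ln 2 `^ (- g) / g).
Let c : R := c4 * expR (- 2^-1) * 3 `^ (- (g + 1)) / 2.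
Let CV0 : 0 < CV.
Proof. by rewrite mulr_gt0// addr_gt0// divr_gt0// powR_gt0. Qed.
Let c0 : 0 < c.
Proof. by rewrite divr_gt0// mulr_gt0 ?powR_gt0// mulr_gt0// expR_gt0. Qed.

Lemma ln2_lt (r : R) : 0 < r -> r < 2^-1 -> ln 2 < - ln r.
Proof.
move=> r0 r1; rewrite ltrNr -lnV ?posrE// ltr_ln ?posrE// invr_gt0//.
Qed.

(** Split at r = sqrt t, whose logarithm is half that of t. Below, the prefactor is at most t^(-N/2)
    and the weight has mass 2^g |log t|^-g / g. Above, the prefactor is at most t^(-N/4), which is
    absorbed because |log t| <= 1/t. *)
Lemma log_potential_upper (z x : euclidean R N) t : 0 < t -> t < 4^-1 ->
  (heat_potential nu z (x, t) <= (CV * (t `^ (- (N%:R / 2)) * (- ln t) `^ (- g)))%:E)%E.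
Proof.
move=> t0 t1.
apply: le_trans (heat_potential_le _ (@measurable_log_density g)
  (log_density_ge0 g) (log_density0 g) _ (ltW t0)) _.
pose u := Num.sqrt t.
have u0 : 0 < u by rewrite sqrtr_gt0.
have uu : u ^+ 2 = t by rewrite sqr_sqrtr// ltW.
have u1 : u < 2^-1.
  rewrite -(@ltr_sqr _) ?nnegrE ?(ltW u0)// uu.
  by rewrite (_ : 2^-1 ^+ 2 = 4^-1) ?t1//; field.
have lnt : ln t = 2 * ln u by rewrite -uu lnXn// mulr_natl.
have lt0 : 0 < - ln t by rewrite oppr_gt0 ln_lt0// t0; lra.
have lu0 : 0 < - ln u by rewrite oppr_gt0 ln_lt0// u0; lra.
pose g1 : measurableTypeR R -> \bar R :=
  (fun r : measurableTypeR R => (log_weight g r)%:E) \_ `]0, u[%classic.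
pose g2 : measurableTypeR R -> \bar R :=
  (fun r : measurableTypeR R => (log_weight g r)%:E) \_ `]0, 2^-1[%classic.
have mw : measurable_fun setT (fun r : measurableTypeR R => (log_weight g r)%:E).
  by apply/measurable_EFinP; exact: measurable_log_weight.
have m1 : measurable (`]0, u[%classic : set (measurableTypeR R)) := measurable_itv _.
have m2 : measurable (`]0, 2^-1[%classic : set (measurableTypeR R)) := measurable_itv _.
have mg1 : measurable_fun setT g1.
  by apply/(measurable_restrictT _ m1); apply: measurable_funTS.
have mg2 : measurable_fun setT g2.
  by apply/(measurable_restrictT _ m2); apply: measurable_funTS.
have g10 r : (0 <= g1 r)%E.
  by rewrite /g1 patchE; case: ifPn => // _; rewrite lee_fin log_weight_ge0.
have g20 r : (0 <= g2 r)%E.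
  by rewrite /g2 patchE; case: ifPn => // _; rewrite lee_fin log_weight_ge0.
pose a1 : R := t `^ (- (N%:R / 2)); pose a2 : R := t `^ (- g).
have a10 : 0 < a1 by rewrite powR_gt0.
have a20 : 0 < a2 by rewrite powR_gt0.
have mag1 : measurable_fun setT (fun r => a1%:E * g1 r)%E by exact: emeasurable_funM.
have mag2 : measurable_fun setT (fun r => a2%:E * g2 r)%E by exact: emeasurable_funM.
have ag1 r : (0 <= a1%:E * g1 r)%E by rewrite mule_ge0// lee_fin ltW.
have ag2 r : (0 <= a2%:E * g2 r)%E by rewrite mule_ge0// lee_fin ltW.
apply: (@le_trans _ _ (\int[lebesgue_measure]_r (c4%:E * (a1%:E * g1 r + a2%:E * g2 r)))%E).
  apply: ge0_le_integral => //.
  - by move=> r _; rewrite lee_fin mulr_ge0 ?powR_ge0// log_density_ge0.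
  - apply/measurable_EFinP; apply: measurable_funM; first exact: measurable_log_density.
    apply: (measurableT_comp (@measurable_powR R _)).
    by apply: measurable_funM => //; exact: measurable_funD.
  - by apply: emeasurable_funM => //; exact: emeasurable_funD.
  move=> r _.
  have rhs0 : (0 <= c4%:E * (a1%:E * g1 r + a2%:E * g2 r))%E.
    by rewrite mule_ge0 ?adde_ge0// lee_fin ltW.
  have [r0|r0] := leP r 0; first by rewrite log_density0// mul0r.
  have [r1|r1] := leP 2^-1 r; first by rewrite log_density_half// mul0r.
  have rt0 : 0 <= (r : R) + t by rewrite addr_ge0// ltW.
  rewrite log_densityE// (powRM _ (ltW pi40) rt0) mulrCA EFinM.
  rewrite lee_wpmul2l ?lee_fin ?(ltW c40)//.
  have g2r : g2 r = (log_weight g r)%:E.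
    by rewrite /g2 patchE mem_set//= in_itv/= r0 r1.
  have [ru|ru] := ltP r u.
    apply: (@le_trans _ _ (a1%:E * g1 r)%E); last by rewrite leeDl.
    rewrite /g1 patchE mem_set/=; last by rewrite in_itv/= r0 ru.
    rewrite -EFinM lee_fin mulrC ler_wpM2r ?log_weight_ge0//.
    by apply: ler_powRN; rewrite ?divr_ge0// lerDr ltW.
  apply: (@le_trans _ _ (a2%:E * g2 r)%E); last by rewrite leeDr.
  rewrite g2r -EFinM lee_fin mulrC ler_wpM2r ?log_weight_ge0//.
  have -> : a2 = u `^ (- (N%:R / 2)).
    rewrite /a2 -uu -powR_mulrn ?(ltW u0)// -powRrM; congr (_ `^ _).
    by rewrite N2g; ring.
  apply: ler_powRN; rewrite ?divr_ge0//; lra.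
rewrite ge0_integralZl_EFin ?(ltW c40)//; last 2 first.
- by move=> r _; exact: adde_ge0.
- exact: emeasurable_funD.
rewrite /CV -mulrA [X in (_ <= X)%E]EFinM lee_wpmul2l ?lee_fin ?(ltW c40)//.
rewrite ge0_integralD//.
rewrite ge0_integralZl_EFin ?(ltW a10)// ge0_integralZl_EFin ?(ltW a20)//.
rewrite /g1 /g2 -!integral_mkcond.
have i1 : (\int[lebesgue_measure]_(r in `]0%R, (u : R)[%classic) (log_weight g r)%:E <=
  (2 `^ g * (- ln t) `^ (- g) / g)%:E)%E.
  have -> : 2 `^ g * (- ln t) `^ (- g) / g = (- ln u) `^ (- g) / g.
    congr (_ / _); rewrite lnt -mulrN powRM ?(ltW lu0)// mulrA -powRD ?pnatr_eq0 ?implybT//.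
    by rewrite subrr powRr0 mul1r.
  by apply: integral_log => //; lra.
have i2 : (\int[lebesgue_measure]_(r in `]0%R, (2^-1)%R[%classic) (log_weight g r)%:E <=
  (ln 2 `^ (- g) / g)%:E)%E.
  have -> : ln 2 `^ (- g) / g = (- ln 2^-1) `^ (- g) / g by rewrite lnV ?posrE// opprK.
  by apply: integral_log => //; lra.
apply: (@le_trans _ _ (a1%:E * (2 `^ g * (- ln t) `^ (- g) / g)%:E +
   a2%:E * (ln 2 `^ (- g) / g)%:E)%E).
  by apply: leeD; rewrite lee_wpmul2l// lee_fin ltW.
rewrite -!EFinM -EFinD lee_fin.
have h : a2 <= a1 * (- ln t) `^ (- g).
  have h1 : (- ln t) `^ g <= (t `^ (- 1)) `^ g.
    rewrite ge0_ler_powR ?nnegrE ?powR_ge0 ?(ltW g0) ?(ltW lt0)//.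
    rewrite powR_inv1 ?(ltW t0)// -lnV ?posrE//.
    have ti : 0 < t^-1 by rewrite invr_gt0.
    have := @le_ln1Dx R (t^-1 - 1) ltac:(lra).
    by rewrite (_ : 1 + (t^-1 - 1) = t^-1); [lra|ring].
  have -> : a2 = a1 * (t `^ (- 1) `^ g)^-1.
    rewrite -powRN -powRrM /a1 -powRD ?(gt_eqF t0) ?implybT//; congr (_ `^ _).
    by rewrite N2g; ring.
  rewrite ler_wpM2l ?(ltW a10)// powRN lef_pV2 ?posrE ?powR_gt0//.
have k0 : 0 <= ln 2 `^ (- g) / g by rewrite divr_ge0 ?powR_ge0 ?(ltW g0).
have := ler_wpM2r k0 h.
rewrite -/a1; move: (ln 2 `^ (- g) / g) => K hK.
rewrite mulrDl; apply: lerD.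
  by rewrite le_eqVlt; apply/orP; left; apply/eqP; ring.
by rewrite [leRHS]mulrC.
Qed.

(** Again ages s between r^2/2 and r^2. As r < 1/2, |log s| <= 2|log r| + ln 2 <= 3|log r|, which is
    the origin of the factor 3 in [c]. *)
Lemma log_potential_lower (z x : euclidean R N) : 0 < enorm (esub x z) ->
  enorm (esub x z) < 2^-1 ->
  ((c * (enorm (esub x z) `^ (- N%:R) * (- ln (enorm (esub x z))) `^ (- (g + 1))))%:E
    <= heat_potential nu z (x, 0%R))%E.
Proof.
move=> r0 r1; set r := enorm (esub x z) in r0 r1 *.
have r20 : 0 < r ^+ 2 by rewrite exprn_gt0.
have r21 : r ^+ 2 < 4^-1.
  have -> : 4^-1 = (2^-1) ^+ 2 :> R by field.
  by rewrite ltr_sqr// nnegrE ?invr_ge0// ltW.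
have lr : ln 2 < - ln r by exact: ln2_lt.
have h : forall s, r ^+ 2 / 2 < s < r ^+ 2 ->
    ((r ^+ 2) `^ (- 1) * (3 * (- ln r)) `^ (- (g + 1))) *
    (c4 * (r ^+ 2) `^ (- (N%:R / 2)) * expR (- 2^-1)) <=
    nu s * gauss_kernel (esub x z) (s + 0).
  move=> s /andP[s1 s2]; have s0 : 0 < s by lra.
  have ls0 : 0 < - ln s by rewrite oppr_gt0 ln_lt0// s0; lra.
  rewrite addr0 log_densityE//; last by lra.
  apply: ler_pM; rewrite ?powR_ge0 ?mulr_ge0 ?expR_ge0 ?powR_ge0//.
    apply: ler_pM; rewrite ?powR_ge0//.
      by apply: ler_powRN => //; exact: ltW.
    rewrite -opprD; apply: ler_powRN => //; last by rewrite addr_ge0// ltW.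
    have : ln (r ^+ 2 / 2) <= ln s.
      by rewrite ler_ln ?posrE ?divr_gt0// ltW.
    rewrite ln_div ?posrE// lnXn// -[ln r *+ 2]mulr_natl; lra.
  rewrite /gauss_kernel -/r (powRM _ (ltW pi40) (ltW s0)) -/c4.
  apply: ler_pM; rewrite ?powR_ge0 ?mulr_ge0 ?expR_ge0 ?powR_ge0//.
    rewrite ler_wpM2l ?powR_ge0//; apply: ler_powRN; rewrite ?divr_ge0// ltW//.
  by rewrite ler_expR lerN2 ler_pdivrMr ?mulr_gt0//; lra.
have -> : c * (r `^ (- N%:R) * (- ln r) `^ (- (g + 1))) =
    ((r ^+ 2) `^ (- 1) * (3 * (- ln r)) `^ (- (g + 1))) *
    (c4 * (r ^+ 2) `^ (- (N%:R / 2)) * expR (- 2^-1)) * (r ^+ 2 - r ^+ 2 / 2).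
  have -> : r `^ (- N%:R) = (r ^+ 2) `^ (- (N%:R / 2)).
    rewrite -[r ^+ 2]powR_mulrn ?(ltW r0)// -powRrM; congr (_ `^ _).
    by field.
  have l3 : 0 <= - ln r by rewrite ltW// (lt_trans l2).
  rewrite (powRM _ _ l3)// powR_inv1 ?(ltW r20)// /c; field.
  by rewrite gt_eqF.
apply: heat_potential_ge h => //.
- exact: measurable_log_density.
- exact: log_density_ge0.
- by lra.
- by rewrite !mulr_ge0 ?powR_ge0 ?expR_ge0.
Qed.

(** Chosen so that qNp = 1/2: the p-th power of t^(-qN) is then t^(-1/2), integrable at 0. *)
Let q : R := (2 * (N%:R + 2))^-1.
Let qp0 : 0 < q. Proof. by rewrite invr_gt0 mulr_gt0// addr_gt0. Qed.
Let qNp : q * N%:R * p = 2^-1.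
Proof.
rewrite /q -pN /critical_exponent; field.
by rewrite !gt_eqF// ?addr_gt0// mulr_gt0.
Qed.
Let Cf : R := ln 2 `^ (- (N%:R / 2 + 1)).
Let Cg : R := q `^ (- g) / c.
Let Cf0 : 0 < Cf. Proof. by rewrite powR_gt0. Qed.
Let Cg0 : 0 < Cg. Proof. by rewrite divr_gt0// powR_gt0. Qed.

(** For |y-z| >= t^q, f_z is at most a multiple of t^(-qN). For |y-z| < t^q, |log|y-z|| >= q|log t|,
    so half of the logarithm is traded for |log t|^-g and the other half stays in the potential. *)
Lemma f_sing_log_bound (z y : euclidean R N) t : 0 < t -> t < 4^-1 ->
  ((f_sing p z y)%:E <= (Cf * t `^ (- (q * N%:R)))%:E +
     (Cg * (- ln t) `^ (- g))%:E * heat_potential nu z (y, 0%R))%E.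
Proof.
move=> t0 t1; have v0 := heat_potential_ge0 z (log_density_ge0 g) (y, 0).
have lt0 : 0 < - ln t by rewrite oppr_gt0 ln_lt0// t0; lra.
have A0 : 0 <= Cf * t `^ (- (q * N%:R)) by rewrite mulr_ge0 ?powR_ge0 ?(ltW Cf0).
have B0 : 0 <= Cg * (- ln t) `^ (- g) by rewrite mulr_ge0 ?powR_ge0 ?(ltW Cg0).
have rhs0 : (0 <= (Cf * t `^ (- (q * N%:R)))%:E +
     (Cg * (- ln t) `^ (- g))%:E * heat_potential nu z (y, 0%R))%E.
  by rewrite adde_ge0// ?mule_ge0// lee_fin.
have [f0|f0] := leP (f_sing p z y) 0; first by apply: le_trans rhs0; rewrite lee_fin.
set r := enorm (esub y z).
have [fE r1] : f_sing p z y = r `^ (- N%:R) * (- ln r) `^ (- (N%:R / 2 + 1)) /\ r < 2^-1.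
  move: f0; rewrite /f_sing pN ltxx indicE -/r.
  have [|_] := boolP (y \in _); last by rewrite mulr0 ltxx.
  move=> /set_mem[y1 _] _; rewrite mulr1 -opprD.
  have {}y1 : r < 2^-1 := y1.
  split => //; congr (_ * _ `^ _); rewrite ler0_norm//.
  by apply: ln_le0; lra.
have r0 : 0 < r.
  rewrite lt_def enorm_ge0 andbT; apply/eqP => r0.
  by move: f0; rewrite fE r0 powR0 ?mul0r ?ltxx// oppr_eq0 gt_eqF.
have lr : ln 2 < - ln r by exact: ln2_lt.
have lr0 : 0 < - ln r := lt_trans l2 lr.
rewrite fE; have [rt|rt] := leP (t `^ q) r.
  apply: (@le_trans _ _ (Cf * t `^ (- (q * N%:R)))%:E); last by rewrite leeDl// mule_ge0.
  rewrite lee_fin mulrC; apply: ler_pM; rewrite ?powR_ge0//.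
    by apply: ler_powRN; rewrite ?(ltW lr)// addr_ge0// divr_ge0.
  have -> : t `^ (- (q * N%:R)) = (t `^ q) `^ (- N%:R) by rewrite -powRrM mulrN.
  by apply: ler_powRN; rewrite ?powR_gt0.
apply: (@le_trans _ _ ((Cg * (- ln t) `^ (- g))%:E * heat_potential nu z (y, 0%R))%E); last first.
  by rewrite leeDr// lee_fin.
apply: le_trans (lee_wpmul2l _ (log_potential_lower r0 r1)); last by rewrite lee_fin.
rewrite -EFinM lee_fin -/r.
have -> : (- ln r) `^ (- (N%:R / 2 + 1)) = (- ln r) `^ (- g) * (- ln r) `^ (- (g + 1)).
  by rewrite -powRD ?(gt_eqF lr0) ?implybT// N2g; congr (_ `^ _); ring.
have -> : Cg * (- ln t) `^ (- g) * (c * (r `^ (- N%:R) * (- ln r) `^ (- (g + 1)))) =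
  r `^ (- N%:R) * ((q * - ln t) `^ (- g) * (- ln r) `^ (- (g + 1))).
  rewrite (powRM _ (ltW qp0) (ltW lt0)) /Cg; field.
  by rewrite gt_eqF.
rewrite ler_wpM2l ?powR_ge0// ler_wpM2r ?powR_ge0//.
apply: ler_powRN; [exact: mulr_gt0| |exact: ltW].
rewrite mulrN lerN2 -ln_powR ler_ln ?posrE ?powR_gt0//; exact: ltW.
Qed.

Lemma existence_critical (z : euclidean R N) :
  exists T k : R, [/\ 0 < T, 0 < k & supersolvable p z k T].
Proof.
pose D := 2 `^ p * (CV `^ (p - 1) / g + 2).
have D0 : 0 < D by rewrite mulr_gt0 ?powR_gt0// addr_gt0// divr_gt0 ?powR_gt0.
have [b [k [b0 k0 hbk]]] := small_constants (addr_gt0 Cf0 Cg0) D0 p1.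
exists 4^-1, k; split => //.
pose v := heat_potential nu z.
have mv : measurable_fun setT v.
  by apply: measurable_heat_potential; [exact: measurable_log_density|exact: log_density_ge0].
have v0 e : (0 <= v e)%E by apply: heat_potential_ge0; exact: log_density_ge0.
pose A (t : R) := t `^ (- (q * N%:R)).
pose B (t : R) := (- ln t) `^ (- g).
have mA : measurable_fun setT A by exact: measurable_powR.
have mB : measurable_fun setT B.
  apply: (measurableT_comp (@measurable_powR R _)).
  by apply: measurable_funN; exact: measurable_ln.
have A0 t : 0 <= A t by exact: powR_ge0.
have B0 t : 0 <= B t by exact: powR_ge0.
pose w (e : E) := (b%:E * ((A e.2)%:E + (B e.2)%:E * v e))%E.
have mw : measurable_fun setT w.
  apply: emeasurable_funM => //; apply: emeasurable_funD.
    by apply/measurable_EFinP; exact: (measurableT_comp mA measurable_snd).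
  apply: emeasurable_funM => //.
  by apply/measurable_EFinP; exact: (measurableT_comp mB measurable_snd).
have w0 e : (0 <= w e)%E.
  by rewrite mule_ge0 ?adde_ge0 ?mule_ge0// lee_fin// ltW.
have vE e : cylinder 4^-1 e -> exists r : R, [/\ v e = r%:E, 0 <= r &
    r <= CV * (e.2 `^ (- (N%:R / 2)) * (- ln e.2) `^ (- g))].
  case: e => x t [_ /= /andP[t0 t1]].
  have := log_potential_upper z x t0 t1; have := v0 (x, t).
  rewrite -/v; case: (v (x, t)) => [r| |]//.
  by rewrite !lee_fin => r0 rC; exists r.
have wE e r : v e = r%:E -> w e = (b * (A e.2 + B e.2 * r))%:E.
  by move=> ve; rewrite /w ve.
apply: (supersolvable_cylinder (lt_trans ltr01 p1) mw w0) => -[x t] xt.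
have [/= x0 /andP[t0 t1]] := xt.
have [r [vr r0 rC]] := vE _ xt; rewrite /= in rC.
have lt0 : 0 < - ln t by rewrite oppr_gt0 ln_lt0// t0; lra.
rewrite (wE _ _ vr); split; first exact: ltry.
have hF : (initial_potential p z 4^-1 (x, t) <= (Cf * A t + Cg * B t * r)%:E)%E.
  rewrite EFinD (EFinM (_ * _) r) -vr.
  apply: initial_potential_le => //.
  - exact: measurable_log_density.
  - exact: log_density_ge0.
  - exact: log_density0.
  - by rewrite mulr_ge0 ?(ltW Cf0).
  - by rewrite mulr_ge0 ?(ltW Cg0).
  - by move=> y _; exact: f_sing_log_bound.
pose phi (s : R) := b `^ p * 2 `^ p * CV `^ (p - 1) * log_weight g s.
pose psi (s : R) := b `^ p * 2 `^ p * s `^ (2^-1 - 1).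
have phi0 s : 0 <= phi s by rewrite !mulr_ge0 ?powR_ge0// log_weight_ge0.
have psi0 s : 0 <= psi s by rewrite !mulr_ge0 ?powR_ge0.
have mphi : measurable_fun setT phi.
  by apply: measurable_funM => //; exact: measurable_log_weight.
have mpsi : measurable_fun setT psi.
  by apply: measurable_funM => //; exact: measurable_powR.
have hw e : cylinder 4^-1 e -> (w e `^ p <= (phi e.2)%:E * v e + (psi e.2)%:E)%E.
  move=> ce; have [re [vre re0 reC]] := vE _ ce.
  have [_ /andP[s0 s1]] := ce; set s := e.2 in s0 s1 reC *.
  have ls0 : 0 < - ln s by rewrite oppr_gt0 ln_lt0// s0; lra.
  rewrite (wE _ _ vre) vre -/s poweR_EFin -EFinM -EFinD lee_fin.
  have Br0 : 0 <= B s * re by rewrite mulr_ge0.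
  rewrite powRM ?(ltW b0) ?addr_ge0//.
  have hA : A s `^ p = s `^ (2^-1 - 1).
    rewrite /A -powRrM mulNr qNp; congr (_ `^ _); lra.
  (* One factor v is kept and v^(p-1) is replaced by its upper bound; (N/2)(p-1) = 1 gives s^-1, and
     the logarithms add up to the exponent g + 1. *)
  have hB : (B s * re) `^ p <= CV `^ (p - 1) * log_weight g s * re.
    rewrite powRM//.
    have -> : re `^ p = re `^ (p - 1) * re.
      have [->|re1] := eqVneq re 0.
        by rewrite mulr0 powR0// gt_eqF// (lt_trans ltr01 p1).
      by rewrite -{3}[re]powRr1// -powRD ?re1 ?implybT ?(negbTE re1) ?implybT// subrK.
    rewrite mulrA ler_wpM2r//.
    apply: (@le_trans _ _ (B s `^ p * (CV * (s `^ (- (N%:R / 2)) * (- ln s) `^ (- g))) `^ (p - 1))).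
      rewrite ler_wpM2l ?powR_ge0// ge0_ler_powR ?nnegrE ?(ltW q0)//.
      exact: le_trans reC.
    have tv0 : 0 <= s `^ (- (N%:R / 2)) * (- ln s) `^ (- g) by rewrite mulr_ge0 ?powR_ge0.
    rewrite (powRM _ (ltW CV0) tv0) powRM ?powR_ge0//.
    rewrite /B -!powRrM /log_weight.
    have -> : - (N%:R / 2) * (p - 1) = -1.
      by rewrite N2g mulNr mulrDl gp; congr (- _); field.
    have -> : (- ln s) `^ (- g - 1) = (- ln s) `^ (- g * p) * (- ln s) `^ (- g * (p - 1)).
      rewrite -powRD ?(gt_eqF ls0) ?implybT//; congr (_ `^ _).
      have -> : - g * p = - g - g * (p - 1) by ring.
      by rewrite mulNr gp; lra.
    by rewrite le_eqVlt; apply/orP; left; apply/eqP; ring.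
  have hAB : (A s + B s * re) `^ p <= 2 `^ p * (A s `^ p + (B s * re) `^ p).
    have pp : 0 <= p by apply: ltW; exact: lt_trans p1.
    have [ab|ab] := leP (A s) (B s * re).
      apply: (@le_trans _ _ ((2 * (B s * re)) `^ p)).
        rewrite ge0_ler_powR ?nnegrE ?addr_ge0 ?mulr_ge0//; first lra.
      by rewrite (powRM _ _ Br0)// ler_wpM2l ?powR_ge0// lerDr powR_ge0.
    apply: (@le_trans _ _ ((2 * A s) `^ p)).
      rewrite ge0_ler_powR ?nnegrE ?addr_ge0 ?mulr_ge0//; lra.
    by rewrite (powRM _ _ (A0 s))// ler_wpM2l ?powR_ge0// lerDl powR_ge0.
  apply: (@le_trans _ _ (b `^ p * (2 `^ p * (A s `^ p + (B s * re) `^ p)))).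
    by rewrite ler_wpM2l ?powR_ge0.
  have bp0 : 0 <= b `^ p * 2 `^ p by rewrite mulr_ge0 ?powR_ge0.
  have := ler_wpM2l bp0 hB; rewrite hA /phi /psi.
  move: (b `^ p) (2 `^ p) (CV `^ (p - 1)) (log_weight g s) (s `^ (2^-1 - 1)) => b1 b2 b3 b4 b5.
  by move: ((B s * re) `^ p) => b6; nra.
have hP := power_op_le (@measurable_log_density g) (log_density_ge0 g) (log_density0 g)
  mw w0 mphi mpsi phi0 psi0 hw xt.
have iphi : (\int[lebesgue_measure]_(s in `]0%R, (t : R)[%classic) (phi s)%:E <=
    (b `^ p * 2 `^ p * CV `^ (p - 1) * (B t / g))%:E)%E.
  have pos (s : measurableTypeR R) : `]0, t[%classic s -> (0 <= (log_weight g s)%:E)%E.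
    by move=> _; rewrite lee_fin log_weight_ge0.
  have meas : measurable_fun (`]0, t[%classic : set (measurableTypeR R))
      (fun s : measurableTypeR R => (log_weight g s)%:E).
    by apply/measurable_EFinP/measurable_funTS; exact: measurable_log_weight.
  under eq_integral do rewrite /phi EFinM.
  rewrite ge0_integralZl_EFin ?mulr_ge0 ?powR_ge0//.
  rewrite [leRHS]EFinM lee_wpmul2l ?lee_fin ?mulr_ge0 ?powR_ge0//.
  by apply: integral_log => //; lra.
have ipsi : (\int[lebesgue_measure]_(s in `]0%R, (t : R)[%classic) (psi s)%:E <=
    (b `^ p * 2 `^ p * (2 * A t))%:E)%E.
  have pos (s : measurableTypeR R) : `]0, t[%classic s -> (0 <= ((s : R) `^ (2^-1 - 1))%:E)%E.
    by move=> _; rewrite lee_fin powR_ge0.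
  have meas : measurable_fun (`]0, t[%classic : set (measurableTypeR R))
      (fun s : measurableTypeR R => ((s : R) `^ (2^-1 - 1))%:E).
    by apply/measurable_EFinP/measurable_funTS; exact: measurable_powR.
  under eq_integral do rewrite /psi EFinM.
  rewrite ge0_integralZl_EFin ?mulr_ge0 ?powR_ge0//.
  rewrite [leRHS]EFinM lee_wpmul2l ?lee_fin ?mulr_ge0 ?powR_ge0//.
  have h2 : 0 < 2^-1 :> R by rewrite invr_gt0.
  apply: le_trans (integral_powR0 h2 t0) _; rewrite lee_fin invrK mulrC ler_wpM2l//.
  (* t^(1/2) <= 1 <= A(t) for t < 1: crude, but a multiple of [A] is all that is required. *)
  apply: (@le_trans _ _ 1).
    apply: (@le_trans _ _ (1 `^ 2^-1)); last by rewrite powR1.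
    rewrite ge0_ler_powR ?nnegrE ?(ltW t0) ?(ltW h2)//; lra.
  apply: (@le_trans _ _ (1 `^ (- (q * N%:R)))); first by rewrite powR1.
  apply: ler_powRN => //; first lra.
  by rewrite mulr_ge0 ?(ltW qp0).
rewrite -/v vr in hP.
apply: (@le_trans _ _ (k%:E * (Cf * A t + Cg * B t * r)%:E +
  ((b `^ p * 2 `^ p * CV `^ (p - 1) * (B t / g))%:E * r%:E +
   (b `^ p * 2 `^ p * (2 * A t))%:E))%E).
  apply: leeD; first by rewrite lee_wpmul2l// lee_fin ltW.
  apply: le_trans hP _; apply: leeD => //.
  by rewrite lee_wpmul2r// lee_fin.
rewrite -!EFinM -!EFinD lee_fin.
have Br0 : 0 <= B t * r by rewrite mulr_ge0.
(* The bound is enlarged by nonnegative cross terms so that the coefficient condition of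
   [small_constants] can be factored out. *)
apply: (@le_trans _ _ ((k * (Cf + Cg) + b `^ p * D) * (A t + B t * r))); last first.
  by rewrite ler_wpM2r// addr_ge0.
have e1 : 0 <= k * Cf * (B t * r) := mulr_ge0 (mulr_ge0 (ltW k0) (ltW Cf0)) Br0.
have e2 : 0 <= k * Cg * A t := mulr_ge0 (mulr_ge0 (ltW k0) (ltW Cg0)) (A0 t).
have e3 : 0 <= b `^ p * 2 `^ p * 2 * (B t * r) by rewrite !mulr_ge0 ?powR_ge0.
have e4 : 0 <= b `^ p * 2 `^ p * (CV `^ (p - 1) / g) * A t.
  by rewrite !mulr_ge0 ?powR_ge0 ?invr_ge0 ?(ltW g0).
rewrite -subr_ge0 /D.
have -> : (k * (Cf + Cg) + b `^ p * (2 `^ p * (CV `^ (p - 1) / g + 2))) * (A t + B t * r) -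
  (k * (Cf * A t + Cg * B t * r) + (b `^ p * 2 `^ p * CV `^ (p - 1) * (B t / g) * r +
    b `^ p * 2 `^ p * (2 * A t))) =
  k * Cf * (B t * r) + k * Cg * A t + b `^ p * 2 `^ p * 2 * (B t * r) +
  b `^ p * 2 `^ p * (CV `^ (p - 1) / g) * A t by ring.
by rewrite !addr_ge0.
Qed.

End existence_critical.

(** * The threshold kappa_z *)

Definition admissible (R : realType) (N : nat) (p : R) (z : euclidean R N) : set R :=
  [set k | 0 < k /\ exists2 T : R, 0 < T & supersolvable p z k T].

Lemma has_local_solutionP (R : realType) (N : nat) (p : R) (z : euclidean R N)
    (k : {posnum R}) : 0 < p ->
  has_local_solution p (initial_measure p z k) <-> admissible p z k%:num.
Proof.
move=> p0; split => [[T T0 /(solution_supersolvable _ _ _ p0) hk]|[k0 [T T0 hk]]].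
  by split => //; exists T.
by exists T => //; exact/(solution_supersolvable _ _ _ p0).
Qed.

Theorem theorem5p6 (R : realType) (N : nat) (p : R) (hN : (1 <= N)%N)
    (hp : critical_exponent N <= p) :
  exists kappa : euclidean R N -> R,
    (forall z : euclidean R N, half_space z ->
       [/\ 0 < kappa z,
           forall k : {posnum R}, k%:num < kappa z ->
             has_local_solution p (initial_measure p z k) &
           forall k : {posnum R}, kappa z < k%:num ->
             ~ has_local_solution p (initial_measure p z k)]) /\
    (ereal_sup [set (kappa z)%:E | z in half_space] < +oo)%E.
Proof.
have p0 : 0 < p.
  apply: lt_le_trans hp; apply: lt_trans ltr01 _.
  exact: critical_exponent_gt1.
have [ks ks0 hks] := nonexistence hN hp.
have ub (z : euclidean R N) : half_space z -> ubound (admissible p z) ks.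
  move=> z0 k [k0 [T T0 hk]]; rewrite leNgt; apply/negP => kks.
  exact: (hks z k T z0 kks T0).
have ne (z : euclidean R N) : admissible p z !=set0.
  move: hp; rewrite le_eqVlt => /orP[/eqP|] hp'.
    have [T [k [T0 k0 hk]]] := existence_critical hN hp' z.
    by exists k; split => //; exists T.
  have [T [k [T0 k0 hk]]] := existence_supercritical z hN hp'.
  by exists k; split => //; exists T.
(* The supremum need not be attained, which is why both properties are claimed for strict
   inequalities; [ks] bounds it for all z at once. *)
exists (fun z => sup (admissible p z)); split; last first.
  apply: (@le_lt_trans _ _ ks%:E); last exact: ltry.
  apply: ge_ereal_sup => _ [z z0 <-]; rewrite lee_fin.
  exact: ge_sup (ne z) (ub z z0).
move=> z z0.
have hsup : has_sup (admissible p z).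
  by split; [exact: ne|exists ks; exact: ub].
split.
- have [k hk] := ne z; apply: lt_le_trans hk.1 _.
  exact: (sup_upper_bound hsup).
- move=> k kk; apply/has_local_solutionP => //; split => //.
  have [k' [k'0 [T T0 hk']] kk'] := sup_gt (ne z) kk.
  by exists T => //; apply: supersolvable_le hk'; exact: ltW.
- move=> k kk /(has_local_solutionP _ _ p0) hk.
  by have := sup_upper_bound hsup hk; rewrite leNgt kk.
Qed.
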